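(* Let $\pi$ be a generic unramified principal series representation of $\mathrm{GL}_{2n}(\mathbb Q_p)$ admitting an $(\eta,\psi)$-Shalika model. Let $\chi:\mathbb Q_p^\times\to\mathbb C^\times$ be a finite order character of conductor $p^\beta>1$ with $\chi(p)=1$, and let $W\in\mathcal S_\psi^\eta(\pi^{\mathrm{Iw}_G})$. Then $$\zeta\big(s,(u^{-1}t_p^\beta)\cdot W,\chi\big)=\Upsilon'\cdot\eta(\det z^\beta)\cdot p^{-\beta\frac{n^2+n}2}\cdot p^{\beta n(s-1/2)}\cdot\tau(\chi)^n\cdot\chi(\det(-w_n))\cdot W\begin{pmatrix}w_nz^{2\beta}&\\&1_n\end{pmatrix},$$ where $\Upsilon'=\mathrm{vol}(\mathrm{Iw}_{n})\cdot(1-p^{-1})^{-n}\cdot p^{(n^2-n)/2}$ is a scalar independent of $W$, $\chi$ and $\beta$.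
   Context: $\psi:\mathbb Q_p\to\mathbb C^\times$ is the standard additive character (trivial on $\mathbb Z_p$, not on $p^{-1}\mathbb Z_p$), $\eta$ a smooth (necessarily unramified) character of $\mathbb Q_p^\times$. With $\mathcal S=\{\begin{pmatrix}h&\\&h\end{pmatrix}\begin{pmatrix}1_n&X\\&1_n\end{pmatrix}\}\subset\mathrm{GL}_{2n}$, the Shalika model $\mathcal S_\psi^\eta(\pi)$ is a realisation of $\pi$ as a space of functions $W$ on $\mathrm{GL}_{2n}(\mathbb Q_p)$ with $W(sg)=\eta(\det h)\psi(\mathrm{tr}X)W(g)$, with the group acting by right translation. $\mathcal S_\psi^\eta(\pi^{\mathrm{Iw}_G})$ is its subspace of vectors invariant under the upper-triangular Iwahori subgroup $\mathrm{Iw}_G\subset\mathrm{GL}_{2n}(\mathbb Z_p)$; $\mathrm{Iw}_n\subset\mathrm{GL}_n(\mathbb Z_p)$ is the upper-triangular Iwahori subgroup of $\mathrm{GL}_n$. $w_n$ is the antidiagonal $n\times n$ permutation matrix, $u=\begin{pmatrix}1_n&w_n\\0&1_n\end{pmatrix}$, $t_p=\mathrm{diag}(p^{2n-1},p^{2n-2},\dots,p,1)$, $z=\mathrm{diag}(p^{n-1},\dots,p,1)$. The (Friedberg–Jacquet) local zeta integral is $$\zeta(s,W,\chi)=\int_{\mathrm{GL}_n(\mathbb Q_p)}W\begin{pmatrix}x&\\&1_n\end{pmatrix}\chi(\det x)|\det x|^{s-1/2}dx$$ (convergent for $\mathrm{Re}(s)\gg0$, then continued meromorphically), for a fixed Haar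 measure $dx$ on $\mathrm{GL}_n(\mathbb Q_p)$, with respect to which $\mathrm{vol}(\mathrm{Iw}_n)$ is taken. The Gauss sum is $\tau(\chi)=p^\beta(1-p^{-1})\int_{\mathbb Z_p^\times}\chi(c)\psi(p^{-\beta}c)d^\times c$, where $d^\times c$ has total mass $1$. *)

(* Defs.v *)
From HB Require Import structures.
From mathcomp Require Import all_boot all_order all_algebra fingroup perm complex.
From mathcomp Require Import all_classical all_reals all_analysis.

Set Implicit Arguments.
Unset Strict Implicit.
Unset Printing Implicit Defensive.

Import Order.TTheory GRing.Theory Num.Theory.
Import numFieldNormedType.Exports.

Local Open Scope classical_set_scope.
Local Open Scope ring_scope.

(* For p prime, [padicFieldType p R] is the interface of the completion of
   the rationals at the p-adic absolute value (the latter taking values in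
   R), just as [realType] is the interface of the real numbers: the field
   Q_p is its only model, up to a unique isometric isomorphism. *)
HB.mixin Record Field_isPadic (p : nat) (R : realType) K of GRing.Field K := {
  pabs : K -> R;
  pabs_ge0 : forall x, 0 <= pabs x;
  pabs_eq0 : forall x, (pabs x == 0) = (x == 0);
  pabsM : {morph pabs : x y / x * y};
  pabsD : forall x y, pabs (x + y) <= Num.max (pabs x) (pabs y);
  pabs_p : pabs p%:R = p%:R^-1;
  pabs_dense : forall x (e : R), 0 < e -> exists r : rat, pabs (x - ratr r) < e;
  pabs_complete : forall u : nat -> K,
    (forall e : R, 0 < e -> exists N, forall i j,
       (N <= i)%N -> (N <= j)%N -> pabs (u i - u j) < e) ->
    exists l, forall e : R, 0 < e -> exists N, forall i,
       (N <= i)%N -> pabs (u i - l) < e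
}.

#[short(type="padicFieldType")]
HB.structure Definition PadicField (p : nat) (R : realType) :=
  {K of GRing.Field K & Field_isPadic p R K}.

Section GL.
Context {p : nat} {R : realType} (K : padicFieldType p R) (n : nat).

Record GL := MkGL { GLval :> 'M[K]_n; GLvalP : GLval \in unitmx }.

HB.instance Definition _ := [isSub for GLval].
HB.instance Definition _ := [Choice of GL by <:].

Lemma GL1_subproof : (1%:M : 'M[K]_n) \in unitmx.
Proof. exact: unitmx1. Qed.

Lemma GLM_subproof (g h : GL) : GLval g *m GLval h \in unitmx.
Proof. by rewrite unitmx_mul !GLvalP. Qed.

Lemma GLV_subproof (g : GL) : invmx g \in unitmx.
Proof. by rewrite unitmx_inv GLvalP. Qed.

Definition GL1 := MkGL GL1_subproof.
Definition GLmul g h := MkGL (GLM_subproof g h).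
Definition GLinv g := MkGL (GLV_subproof g).

Lemma GLmulA : associative GLmul.
Proof. by move=> x y z; apply: val_inj; rewrite /= mulmxA. Qed.
Lemma GLmul1 : left_id GL1 GLmul.
Proof. by move=> x; apply: val_inj; rewrite /= mul1mx. Qed.
Lemma GLmulr1 : right_id GL1 GLmul.
Proof. by move=> x; apply: val_inj; rewrite /= mulmx1. Qed.
Lemma GLmulV : left_inverse GL1 GLinv GLmul.
Proof. by move=> x; apply: val_inj; rewrite /= mulVmx ?GLvalP. Qed.
Lemma GLmulrV : right_inverse GL1 GLinv GLmul.
Proof. by move=> x; apply: val_inj; rewrite /= mulmxV ?GLvalP. Qed.

HB.instance Definition _ :=
  isGroup.Build GL GLmulA GLmul1 GLmulr1 GLmulV GLmulrV.
HB.instance Definition _ := isPointed.Build GL GL1.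

(* The subspace topology from the matrices with their maximum norm, which is
   the group topology of GL_n since inversion is continuous for it. *)
Definition GL_open : set (set GL) := [set U | forall g : GL, U g ->
  exists2 e : R, 0 < e &
    forall h : GL, (forall i j, pabs (h i j - g i j) < e) -> U h].

Lemma GL_openT : GL_open setT.
Proof. by move=> g _; exists 1. Qed.

Lemma GL_openI : setI_closed GL_open.
Proof.
move=> A B oA oB g [/oA[e e0 He] /oB[d d0 Hd]].
exists (Num.min e d); first by rewrite lt_min e0.
move=> h Hh; split; [apply: He|apply: Hd] => i j;
by have := Hh i j; rewrite lt_min => /andP[].
Qed.

Lemma GL_open_bigU (I : Type) (f : I -> set GL) :
  (forall i, GL_open (f i)) -> GL_open (\bigcup_i f i).
Proof.
move=> of_ g [i _ /of_[e e0 He]]; exists e => // h Hh.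
by exists i => //; exact: He.
Qed.

HB.instance Definition _ := isOpenTopological.Build GL GL_openT GL_openI GL_open_bigU.

End GL.

Section subgroups.
Context {p : nat} {R : realType} {K : padicFieldType p R} {n : nat}.

Definition GLint : set (GL K n) :=
  [set g : GL K n | (forall i j, pabs (g i j) <= 1) /\ pabs (\det g) = 1].

Definition iwahori : set (GL K n) :=
  GLint `&` [set g : GL K n | forall i j : 'I_n, (j < i)%N -> pabs (g i j) <= p%:R^-1].

Definition borel_sub : set (GL K n) :=
  [set g : GL K n | forall i j : 'I_n, (j < i)%N -> g i j = 0].

Definition unip_upper : set (GL K n) :=
  borel_sub `&` [set g : GL K n | forall i, g i i = 1].

End subgroups.

Definition borel (T : ptopologicalType) := g_sigma_algebraType (@open T).

Section haar.
Context {p : nat} {R : realType} {K : padicFieldType p R} {n : nat}.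

(* GL_n(Q_p) is locally compact and second countable, so that regularity is
   automatic. *)
Definition haar_measure (mu : {measure set (borel (GL K n)) -> \bar R}) :=
  [/\ forall (g : GL K n) (A : set (borel (GL K n))), measurable A ->
        mu [set (g * x)%g | x in A] = mu A,
      forall A : set (GL K n), compact A -> (mu A < +oo)%E &
      forall U : set (GL K n), open U -> U !=set0 -> (0 < mu U)%E].

End haar.

Section complex_integral.
Context {d : measure_display} {T : measurableType d} {R : realType}.
Variable mu : {measure set T -> \bar R}.

Definition cintegrable (D : set T) (f : T -> R[i]) :=
  mu.-integrable D (fun x => (complex.Re (f x))%:E) /\
  mu.-integrable D (fun x => (complex.Im (f x))%:E).

Definition cintegral (D : set T) (f : T -> R[i]) : R[i] :=
  ((\int[mu]_(x in D) complex.Re (f x))%R +i*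
   (\int[mu]_(x in D) complex.Im (f x))%R)%C.

End complex_integral.

(* Only meaningful for 0 < x *)
Definition cpow {R : realType} (x : R) (s : R[i]) : R[i] :=
  let m := expR (complex.Re s * ln x) in
  let a := complex.Im s * ln x in
  (m * cos a +i* (m * sin a))%C.

(* Complex differentiability: the scalars of the derivative are complex. *)
Definition holomorphic_near {R : realType} (h : R[i] -> R[i]) (z0 : R[i]) :=
  \forall z \near (z0 : R[i]^o), derivable (h : R[i]^o -> R[i]^o) z 1.

(* Since x / 0 = 0, this also forces f to take at a removable singularity the
   value that makes it holomorphic there (m = 0), and the value 0 at poles
   (m > 0), so that f is determined everywhere by its restriction to any
   half-plane. *)
Definition meromorphic {R : realType} (f : R[i] -> R[i]) :=
  forall z0 : R[i], exists (m : nat) (h : R[i] -> R[i]),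
    [/\ holomorphic_near h z0,
        ((0 < m)%N -> h z0 != 0) &
        \forall z \near (z0 : R[i]^o), f z = h z / (z - z0) ^+ m].

Section characters.
Context {p : nat} {R : realType} {K : padicFieldType p R}.

(* Characters of the multiplicative group of K, as functions on K whose value
   at 0 is irrelevant. *)
Definition mchar (chi : K -> R[i]) :=
  chi 1 = 1 /\
  (forall x y, x != 0 -> y != 0 -> chi (x * y) = chi x * chi y).

(* The units of Z_p if m = 0, and 1 + p^m Z_p if m > 0 *)
Definition punits (m : nat) : set K :=
  [set x | pabs x = 1 /\ pabs (x - 1) <= p%:R ^- m].

Definition trivial_on (D : set K) (chi : K -> R[i]) :=
  forall x, D x -> chi x = 1.

Definition smooth_char (chi : K -> R[i]) :=
  mchar chi /\ exists m, trivial_on (punits m) chi.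

Definition unramified_char (chi : K -> R[i]) :=
  mchar chi /\ trivial_on (punits 0) chi.

Definition finite_order (chi : K -> R[i]) :=
  exists2 N, (0 < N)%N & forall x, x != 0 -> chi x ^+ N = 1.

Definition conductor_exp (chi : K -> R[i]) (b : nat) :=
  trivial_on (punits b) chi /\
  forall m, (m < b)%N -> ~ trivial_on (punits m) chi.

Definition std_addchar (psi : K -> R[i]) :=
  [/\ {morph psi : x y / x + y >-> x * y},
      trivial_on [set x | pabs x <= 1] psi &
      ~ trivial_on [set x | pabs x <= p%:R] psi].

(* The measure d^x c on Z_p^x is the restriction of the Haar measure of
   K^x = GL_1(K) of total mass 1 on Z_p^x. *)
Definition gauss_sum (psi : K -> R[i])
    (dc : {measure set (borel (GL K 1)) -> \bar R})
    (chi : K -> R[i]) (b : nat) : R[i] :=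
  p%:R ^+ b * (1 - p%:R^-1) *
  cintegral dc GLint
    (fun c : GL K 1 => chi (c ord0 ord0) * psi (p%:R ^- b * c ord0 ord0)).

End characters.

Record rep (G : groupType) (C : fieldType) := MkRep {
  rep_space :> lmodType C;
  rep_act : G -> rep_space -> rep_space;
  rep_linear : forall g, linear (rep_act g);
  rep_act1 : forall v, rep_act 1%g v = v;
  rep_actM : forall g h v, rep_act (g * h)%g v = rep_act g (rep_act h v)
}.

Definition rep_invariants (G : groupType) (C : fieldType) (pi : rep G C)
    (H : set G) : set pi :=
  [set v | forall g, H g -> rep_act g v = v].

Definition rtrans (G : groupType) (C : Type) (g : G) (f : G -> C) : G -> C :=
  fun h => f (h * g)%g.

Definition realisation (G : groupType) (C : fieldType) (pi : rep G C)
    (L : pi -> G -> C) :=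
  [/\ forall h, linear (fun v => L v h : C^o),
      injective L &
      forall g v, L (rep_act g v) = rtrans g (L v)].

Section representations.
Context {p : nat} {R : realType} {K : padicFieldType p R} {N : nat}.

(* |b_ii| (0-based i) occurs in the modulus character of the upper triangular
   Borel subgroup with exponent N - 1 - 2i, and here with half of it. *)
Definition sqrt_modulus (b : GL K N) : R :=
  \prod_(i < N) pabs (b i i) `^ ((N%:R - 1 - 2 * i%:R) / 2).

Definition parabolic_ind (theta : 'I_N -> K -> R[i]) : set (GL K N -> R[i]) :=
  [set f |
    (forall b g, borel_sub b ->
       f (b * g)%g =
         (sqrt_modulus b)%:C%C * (\prod_(i < N) theta i (b i i)) * f g) /\
    (\forall k \near (1%g : GL K N), forall g, f (g * k)%g = f g)].

Definition unramified_principal_series (pi : rep (GL K N) R[i]) :=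
  exists (theta : 'I_N -> K -> R[i]) (L : pi -> GL K N -> R[i]),
    [/\ forall i, unramified_char (theta i),
        realisation L &
        range L = parabolic_ind theta].

Definition generic (psi : K -> R[i]) (pi : rep (GL K N) R[i]) :=
  exists l : pi -> R[i],
    [/\ linear (l : pi -> R[i]^o),
        (exists v, l v != 0) &
        forall g v, unip_upper g ->
          l (rep_act g v) =
            psi (\sum_(i < N) \sum_(j < N | j == i.+1 :> nat) g i j) * l v].

End representations.

Section elements.
Context {p : nat} {R : realType} {K : padicFieldType p R} {n : nat}.

Lemma blkdiag_subproof (x y : GL K n) :
  (block_mx x 0 0 y : 'M[K]_(n + n)) \in unitmx.
Proof. by rewrite unitmxE det_ublock unitrM -!unitmxE !GLvalP. Qed.

Definition blkdiag (x y : GL K n) : GL K (n + n) := MkGL (blkdiag_subproof x y).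

Lemma blkunip_subproof (X : 'M[K]_n) :
  (block_mx 1%:M X 0 1%:M : 'M[K]_(n + n)) \in unitmx.
Proof. by rewrite unitmxE det_ublock !det1 mulr1 unitr1. Qed.

Definition blkunip (X : 'M[K]_n) : GL K (n + n) := MkGL (blkunip_subproof X).

Definition antidiag_mx : 'M[K]_n := \matrix_(i, j) (j == rev_ord i)%:R.

Lemma antidiag_subproof : antidiag_mx \in unitmx.
Proof.
rewrite (_ : antidiag_mx = perm_mx (perm (@rev_ord_inj n))) ?unitmx_perm //.
by apply/matrixP => i j; rewrite !mxE permE eq_sym.
Qed.

Definition antidiag : GL K n := MkGL antidiag_subproof.

Definition pdiag_mx : 'M[K]_n := diag_mx (\row_i p%:R ^+ (n - i.+1)).

Lemma pdiag_subproof : prime p -> pdiag_mx \in unitmx.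
Proof.
move=> p_pr; rewrite unitmxE det_diag unitfE; apply/prodf_neq0 => i _.
by rewrite mxE expf_neq0 // -pabs_eq0 pabs_p invr_eq0 pnatr_eq0 -lt0n prime_gt0.
Qed.

Definition pdiag (p_pr : prime p) : GL K n := MkGL (pdiag_subproof p_pr).

End elements.

Section shalika.
Context {p : nat} {R : realType} {K : padicFieldType p R} {n : nat}.

(* The range of L is the (eta, psi)-Shalika model of pi. *)
Definition shalika_model (eta psi : K -> R[i]) (pi : rep (GL K (n + n)) R[i])
    (L : pi -> GL K (n + n) -> R[i]) :=
  realisation L /\
  forall v (h : GL K n) (X : 'M[K]_n) g,
    L v (blkdiag h h * blkunip X * g)%g =
      eta (\det h) * psi (\tr X) * L v g.

Definition zeta_integrand (W : GL K (n + n) -> R[i]) (chi : K -> R[i])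
    (s : R[i]) (x : GL K n) : R[i] :=
  W (blkdiag x 1%g) * chi (\det x) * cpow (pabs (\det x)) (s - 2^-1).

(* Z is the function s |-> zeta(s, W, chi): the meromorphic continuation of
   the zeta integral, which converges absolutely for Re s large. *)
Definition is_zeta (dx : {measure set (borel (GL K n)) -> \bar R})
    (W : GL K (n + n) -> R[i]) (chi : K -> R[i]) (Z : R[i] -> R[i]) :=
  meromorphic Z /\
  exists sigma : R, forall s : R[i], sigma < complex.Re s ->
    cintegrable dx setT (zeta_integrand W chi s) /\
    Z s = cintegral dx setT (zeta_integrand W chi s).

Definition Upsilon' (dx : {measure set (borel (GL K n)) -> \bar R}) : R[i] :=
  (fine (dx iwahori))%:C%C * (1 - p%:R^-1) ^- n * p%:R ^+ ((n ^ 2 - n) %/ 2).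

End shalika.

(* Main.v *)
(* The substitution x = a m z^-b, where b = beta and a = - p^-b w z^b, preserves the
   Haar measure: w z^b w^-1 is a central multiple of z^-b, so right translation by
   z^b has modulus 1. It turns the zeta integral of (u^-1 t^b) W into an explicit
   constant times the integral of psi(p^-b tr m) chi(det m) Phi(m), where
   Phi(m) = W(diag(w z^2b m, 1)) |det m|^(s-1/2) is right invariant under Iw_n and
   supported in p^-N M_n(Z_p). Averaging over right translations by the subgroup of
   those elements of Iw_n whose entries below the diagonal lie in p^b Z_p makes
   the integrand a product over the matrix entries: orthogonality of additive
   characters off the diagonal and the vanishing of Gauss sums of the wrong level on
   the diagonal leave only m in that subgroup, where the average is Phi(1) times the
   n-th power of a Gauss sum.

   Absolute convergence for large Re s: W(diag(y, 1)) vanishes unless y is integral,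
   and it is O(|det y|^-A), because averaging over a congruence subgroup K(m) moves
   diag(y, 1) W into the finite dimensional space of K(m)-invariants, on which the
   Shalika functional is bounded by the values on GL_2n(Z_p) of the associated
   functions in the principal series; and the integral matrices of determinant of
   absolute value p^-k have volume O(p^(k n^2)). *)

Require Import Defs.
From HB Require Import structures.
From mathcomp Require Import all_boot all_order all_algebra fingroup perm complex.
From mathcomp Require Import all_classical all_reals all_analysis.
From mathcomp Require Import measurable_realfun zify ring lra.
Require Import Defs.

Set Implicit Arguments.
Unset Strict Implicit.
Unset Printing Implicit Defensive.

Import Order.TTheory GRing.Theory Num.Theory.
Import numFieldNormedType.Exports.
Import Normc.

Local Open Scope classical_set_scope.
Local Open Scope ring_scope.

(** * The p-adic absolute value and integral matrices *)

(** No coordinates on GL_n and no product measures enter. Every integrand is right invariant under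
    some congruence subgroup K(M), so averages are finite sums over residues mod p^M: the integral
    is compared with the sum of its right translates by elements of GL_n(Z_p). The Gauss sum
    tau(chi) is reduced to the same sum over units mod p^M, and the auxiliary level M then cancels.

    The averaging subgroup has depth b below the diagonal for two reasons. Modulo p^b its
    determinants are the products of the diagonal entries, so chi(det) splits. And under the pairing
    psi(p^-b tr(m k)) the ranges of its off-diagonal entries are dual to one another by
    transposition, so the surviving m fill exactly the same subgroup. Its index p^((b-1)(n^2-n)/2)
    in Iw_n is the origin of the factor p^((n^2-n)/2) in Upsilon'.

    The right-hand side is entire in s, so it is itself the continuation; the analytic work is the
    absolute convergence for large Re s, without which the substitution and the averaging would be
    meaningless. *)

Section padic_absolute_value.
Context {p : nat} {R : realType} {K : padicFieldType p R}.
Implicit Types (x y : K).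

Lemma pabs0 : pabs (0 : K) = 0 :> R.
Proof. by apply/eqP; rewrite pabs_eq0. Qed.

Lemma pabs_gt0 x : (0 < pabs x) = (x != 0).
Proof. by rewrite lt_def pabs_ge0 andbT pabs_eq0. Qed.

Lemma pabs1 : pabs (1 : K) = 1 :> R.
Proof.
have /mulIf : pabs (1 : K) != 0 :> R by rewrite pabs_eq0 oner_eq0.
by apply; rewrite -pabsM mulr1 mul1r.
Qed.

Lemma pabsX x k : pabs (x ^+ k) = pabs x ^+ k.
Proof.
by elim: k => [|k IH]; rewrite ?expr0 ?pabs1 // !exprS pabsM IH.
Qed.

Lemma pabsN1 : pabs (-1 : K) = 1 :> R.
Proof.
have /eqP : pabs (-1 : K) ^+ 2 = 1 by rewrite -pabsX sqrrN expr1n pabs1.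
rewrite sqrf_eq1 => /orP[/eqP->//|/eqP h].
by have := pabs_ge0 (-1 : K); rewrite h oppr_ge0 ler10.
Qed.

Lemma pabsN x : pabs (- x) = pabs x.
Proof. by rewrite -mulN1r pabsM pabsN1 mul1r. Qed.

Lemma pabsV x : pabs x^-1 = (pabs x)^-1.
Proof.
have [->|x0] := eqVneq x 0; first by rewrite invr0 pabs0 invr0.
have px0 : pabs x != 0 by rewrite pabs_eq0.
by apply: (mulIf px0); rewrite -pabsM !mulVf ?pabs1.
Qed.

Lemma pabs_prod (I : Type) (r : seq I) (P : pred I) (F : I -> K) :
  pabs (\prod_(i <- r | P i) F i) = \prod_(i <- r | P i) pabs (F i).
Proof. by apply: (big_morph _ pabsM pabs1). Qed.

Lemma pabsD_le x y e : pabs x <= e -> pabs y <= e -> pabs (x + y) <= e.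
Proof. by move=> xe ye; rewrite (le_trans (pabsD _ _)) // ge_max xe. Qed.

Lemma pabsB_le x y e : pabs x <= e -> pabs y <= e -> pabs (x - y) <= e.
Proof. by move=> xe ye; rewrite pabsD_le // pabsN. Qed.

Lemma pabs_distC x y : pabs (x - y) = pabs (y - x).
Proof. by rewrite -opprB pabsN. Qed.

Lemma pabs_dist_trans y x z e :
  pabs (x - y) <= e -> pabs (y - z) <= e -> pabs (x - z) <= e.
Proof. by move=> h1 h2; rewrite -(subrKA y x) pabsD_le. Qed.

Lemma pabsM_le x y d e : pabs x <= d -> pabs y <= e -> pabs (x * y) <= d * e.
Proof. by move=> *; rewrite pabsM ler_pM // pabs_ge0. Qed.

Lemma pabsM_le1 x y e : pabs x <= 1 -> pabs y <= e -> pabs (x * y) <= e.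
Proof. by move=> h1 h2; rewrite -[e]mul1r pabsM_le. Qed.

Lemma pabsMr_le1 x y e : pabs x <= e -> pabs y <= 1 -> pabs (x * y) <= e.
Proof. by rewrite mulrC => *; apply: pabsM_le1. Qed.

Lemma pabs_sum_le (I : Type) (r : seq I) (P : pred I) (F : I -> K) (e : R) :
  0 <= e -> (forall i, P i -> pabs (F i) <= e) ->
  pabs (\sum_(i <- r | P i) F i) <= e.
Proof.
move=> e0 h; elim/big_ind: _ => //; first by rewrite pabs0.
by move=> *; apply: pabsD_le.
Qed.

Lemma pabs_prod_le1 (I : Type) (r : seq I) (P : pred I) (F : I -> K) :
  (forall i, P i -> pabs (F i) <= 1) -> pabs (\prod_(i <- r | P i) F i) <= 1.
Proof.
move=> h; elim/big_ind: _ => //; first by rewrite pabs1.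
by move=> *; apply: pabsM_le1.
Qed.

Lemma pabs_dominant x y : pabs (x - y) < pabs x -> pabs y = pabs x.
Proof.
move=> h; apply/le_anti/andP; split.
  by rewrite -(subKr x y) pabsB_le ?(ltW h).
rewrite leNgt; apply/negP => yx.
have : pabs x <= Num.max (pabs (x - y)) (pabs y).
  by rewrite -{1}(subrK y x) pabsD.
by rewrite le_max leNgt h leNgt yx.
Qed.

Lemma pabs_nat_le1 m : pabs (m%:R : K) <= 1.
Proof.
elim: m => [|m IH]; first by rewrite pabs0.
by rewrite -natr1 pabsD_le ?pabs1.
Qed.

Lemma pabs_int (m : int) : pabs (m%:~R : K) = pabs (`|m|%N%:R : K).
Proof.
by case: m => m //; rewrite NegzE mulrNz pabsN.
Qed.

Lemma pabs_sign b : pabs ((-1) ^+ b : K) = 1.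
Proof. by rewrite pabsX pabsN1 expr1n. Qed.

Hypothesis p_pr : prime p.

Let p_gt0 : 0 < p%:R :> R. Proof. by rewrite ltr0n prime_gt0. Qed.
Let p_gt1 : 1 < p%:R :> R. Proof. by rewrite ltr1n prime_gt1. Qed.

Lemma padicp_neq0 : p%:R != 0 :> K.
Proof. by rewrite -pabs_eq0 pabs_p invr_eq0 gt_eqF. Qed.

Lemma pabs_pX k : pabs (p%:R ^+ k : K) = p%:R ^- k.
Proof. by rewrite pabsX pabs_p exprVn. Qed.

Lemma pexpN_gt0 k : 0 < p%:R ^- k :> R.
Proof. by rewrite invr_gt0 exprn_gt0. Qed.

Lemma pexpN_le k l : (k <= l)%N -> p%:R ^- l <= p%:R ^- k :> R.
Proof.
by move=> kl; rewrite lef_pV2 ?posrE ?exprn_gt0 // ler_weXn2l // ltW.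
Qed.

Lemma pexpN_le1 k : p%:R ^- k <= 1 :> R.
Proof. by have := pexpN_le (leq0n k); rewrite expr0 invr1. Qed.

Lemma pexpN_lt k l : (p%:R ^- l < p%:R ^- k :> R) = (k < l)%N.
Proof.
rewrite ltf_pV2 ?posrE ?exprn_gt0 //.
by rewrite ltr_eXn2l.
Qed.

Lemma pexpN_small (e : R) : 0 < e -> exists k : nat, p%:R ^- k < e.
Proof.
move=> e0; have [k hk] : exists k : nat, e^-1 < k%:R.
  by exists (Num.truncn e^-1).+1; apply: truncnS_gt.
exists k; rewrite invf_plt ?posrE ?exprn_gt0 // (lt_le_trans hk) //.
by rewrite -natrX ler_nat ltnW // ltn_expl // prime_gt1.
Qed.

(** Bezout writes 1 as an integral combination of p and m; if |m| were less than 1, both terms,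
    hence 1 itself, would have absolute value below 1. *)
Lemma pabs_coprime m : coprime m p -> pabs (m%:R : K) = 1.
Proof.
rewrite coprime_sym => cop; apply/le_anti; rewrite pabs_nat_le1 /= leNgt.
apply/negP => m1; have [a _] := Bezoutl m (prime_gt0 p_pr).
rewrite (eqP cop) => /dvdnP[c hc].
have : pabs (1 : K) < 1.
  have -> : 1 = c%:R * p%:R - a%:R * m%:R :> K.
    by rewrite -!natrM -hc natrD addrK.
  apply: le_lt_trans (pabsD _ _) _; rewrite pabsN gt_max; apply/andP; split.
    apply: (@le_lt_trans _ _ p%:R^-1); last by rewrite invf_lt1.
    by rewrite pabsM_le1 ?pabs_nat_le1 ?pabs_p.
  by rewrite (le_lt_trans _ m1) // pabsM_le1 ?pabs_nat_le1.
by rewrite pabs1 ltxx.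
Qed.

Lemma pabs_natr m : (0 < m)%N -> pabs (m%:R : K) = p%:R ^- logn p m.
Proof.
move=> m0; have [k cop {1}->] := pfactor_coprime p_pr m0.
by rewrite natrM pabsM pabs_coprime 1?coprime_sym // natrX pabs_pX mul1r.
Qed.

Lemma pabs_natr_le m k : (pabs (m%:R : K) <= p%:R ^- k) = (p ^ k %| m)%N.
Proof.
have [->|m0] := posnP m.
  by rewrite pabs0 dvdn0 ltW // pexpN_gt0.
by rewrite pabs_natr // leNgt pexpN_lt -leqNgt pfactor_dvdn.
Qed.

Lemma ratr_pabsE (r : rat) : r != 0 ->
  exists a b : nat, pabs (ratr r : K) = p%:R ^- a / p%:R ^- b.
Proof.
move=> r0; exists (logn p `|numq r|), (logn p `|denq r|).
rewrite /ratr pabsM pabsV !pabs_int !pabs_natr //.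
  by rewrite absz_gt0 denq_neq0.
by rewrite absz_gt0 numq_eq0.
Qed.

(** Discreteness of the value group comes from the density of Q: a rational number at distance less
    than |x| from x has the absolute value of x. *)
Lemma pabs_expz x : x != 0 -> exists k : int, pabs x = p%:R ^ k.
Proof.
rewrite -pabs_gt0 => x0; have [r hr] := pabs_dense x _ x0.
have hx := pabs_dominant hr.
have r0 : r != 0.
  apply: contraTneq x0 => r0; rewrite -hx /ratr.
  by have /eqP-> : numq r == 0; rewrite ?numq_eq0 ?r0 // mul0r pabs0 ltxx.
have [a [b hab]] := ratr_pabsE r0.
exists (b%:Z - a%:Z); rewrite -hx hab invrK mulrC expfzDr ?gt_eqF //.
by rewrite exprnN exprnP.
Qed.

Lemma pabs_le_expN x k : x != 0 -> pabs x <= p%:R ^- k ->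
  exists2 l : nat, (k <= l)%N & pabs x = p%:R ^- l.
Proof.
move=> /pabs_expz[z ->]; rewrite exprnN ler_eXz2l // => hz.
exists `|z|%N.
  by case: z hz => z hz; have := hz; rewrite ?NegzE ?lerN2 ?lez_nat; lia.
by rewrite exprnN; congr (_ ^ _); lia.
Qed.

Lemma pabs_lt_expN x k : pabs x < p%:R ^- k -> pabs x <= p%:R ^- k.+1.
Proof.
have [->|x0] := eqVneq x 0; first by rewrite pabs0 ltW // pexpN_gt0.
move=> h; have [l kl hl] := pabs_le_expN x0 (ltW h).
by move: h; rewrite hl pexpN_lt => /pexpN_le.
Qed.

Lemma pabs_gt1_exp x : 1 < pabs x -> exists l : nat, pabs x = p%:R ^+ l.+1.
Proof.
move=> h; have x0 : x != 0 by rewrite -pabs_gt0 (lt_trans _ h).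
have [z hz] := pabs_expz x0; move: h; rewrite hz -[1](expr0z p%:R).
rewrite ltr_eXz2l //; case: z hz => [[|l]|l] // _ _.
by exists l; rewrite exprnP.
Qed.

Lemma padic_bounded (F : finType) (f : F -> K) :
  exists N : nat, forall i, pabs (p%:R ^+ N * f i) <= 1.
Proof.
have h i : exists N : nat, pabs (p%:R ^+ N * f i) <= 1.
  have [h1|/pabs_gt1_exp[l hl]] := leP (pabs (f i)) 1.
    by exists 0; rewrite mul1r.
  by exists l.+1; rewrite pabsM pabs_pX hl mulVf // gt_eqF // exprn_gt0.
have [N hN] := choice h; exists (\max_i N i)%N => i.
rewrite -(subnK (leq_bigmax i : (N i <= _)%N)) exprD -mulrA pabsM_le1 //.
by rewrite pabs_pX pexpN_le1.
Qed.

(** This is Z_p / p^M = Z / p^M. A rational number close to x is p-integral, so its reduced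
    denominator is prime to p and can be inverted mod p^M. *)
Lemma padic_residue x M : pabs x <= 1 ->
  exists a : 'I_(p ^ M), pabs (x - a%:R) <= p%:R ^- M.
Proof.
move=> x1; have [r hr] := pabs_dense x _ (pexpN_gt0 M).
have r1 : pabs (ratr r : K) <= 1.
  by rewrite -(subKr x (ratr r)) pabsB_le // (le_trans (ltW hr)) ?pexpN_le1.
have pM : (0 < p ^ M)%N by rewrite expn_gt0 prime_gt0.
suff [z hz] : exists z : int, pabs (ratr r - z%:~R : K) <= p%:R ^- M.
  have hm : (0 <= z %% (p ^ M)%N)%Z%R by rewrite modz_ge0 // lt0n_neq0.
  have hlt : (`|(z %% (p ^ M)%N)%Z| < p ^ M)%N.
    by rewrite -ltz_nat gez0_abs // ltz_pmod.
  exists (Ordinal hlt) => /=.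
  apply: (pabs_dist_trans (ltW hr)); apply: (pabs_dist_trans hz).
  rewrite {1}(divz_eq z (p ^ M)%N) [X in _ - X]pmulrn gez0_abs //.
  rewrite intrD addrK intrM -pmulrn natrX pabsM_le1 ?pabs_pX //.
  by rewrite pabs_int pabs_nat_le1.
have cop : coprime `|denq r| p.
  rewrite coprime_sym prime_coprime //; apply/negP => pd.
  have cn : coprime `|numq r| p.
    rewrite coprime_sym prime_coprime //; apply/negP => pn.
    have := coprime_num_den r; rewrite /coprime => /eqP h.
    have : (p %| gcdn `|numq r| `|denq r|)%N by rewrite dvdn_gcd pn.
    by rewrite h dvdn1 => /eqP p1; have := p_pr; rewrite p1.
  have : pabs ((denq r)%:~R : K) < 1.
    rewrite pabs_int (@le_lt_trans _ _ (p%:R ^- 1)) //.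
      by rewrite pabs_natr_le expn1.
    by rewrite expr1 invf_lt1.
  move: r1; rewrite /ratr pabsM pabsV [pabs (numq _)%:~R]pabs_int.
  rewrite (pabs_coprime cn) mul1r invf_le1 ?leNgt; first by case: ltP.
  by rewrite pabs_gt0 -pabs_eq0 pabs_int pabs_natr ?absz_gt0 ?denq_neq0 // gt_eqF ?pexpN_gt0.
(* Here -a is an inverse of the denominator mod p^M. *)
have [a _ /dvdnP[c hc]] := Bezoutl `|denq r|%N pM.
move: hc; rewrite (eqP (coprimeXl M (_ : coprime p _))) 1?coprime_sym // => hc.
exists (- (a%:Z * numq r)).
have d0 : (`|denq r|%:R : K) != 0 by rewrite -pabs_eq0 pabs_coprime ?oner_eq0.
have dE : (denq r)%:~R = `|denq r|%:R :> K.
  by rewrite -[in LHS](@gez0_abs (denq r)) // pmulrn.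
rewrite /ratr dE.
rewrite (_ : _ - _ = (numq r)%:~R * (`|denq r|%:R^-1 * (1 + a * `|denq r|)%:R)).
  rewrite hc natrM natrX pabsM_le1 //; first by rewrite pabs_int pabs_nat_le1.
  rewrite pabsM_le1 //; first by rewrite pabsV pabs_coprime ?invr1.
  by rewrite pabsM_le1 ?pabs_nat_le1 // pabs_pX.
by rewrite natrD natrM intrN intrM -pmulrn; field.
Qed.

Lemma padic_residue_inj M (a b : 'I_(p ^ M)) :
  pabs (a%:R - b%:R : K) <= p%:R ^- M -> a = b.
Proof.
wlog ab : a b / (b <= a)%N.
  move=> hw; case: (leqP b a) => [|/ltnW] ab h; first exact: hw.
  by apply/esym/hw => //; rewrite pabs_distC.
rewrite -natrB // pabs_natr_le => h; apply: val_inj => /=.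
apply/eqP; rewrite eqn_leq ab andbT -subn_eq0; apply: contraTT h => h.
by rewrite gtnNdvd ?lt0n // (leq_ltn_trans (leq_subr _ _)).
Qed.

End padic_absolute_value.

Section padic_matrices.
Context {p : nat} {R : realType} {K : padicFieldType p R}.

Definition mxle (e : R) (m n : nat) (A : 'M[K]_(m, n)) :=
  forall i j, pabs (A i j) <= e.

Lemma mxle_trans d e m n (A : 'M[K]_(m, n)) : mxle d A -> d <= e -> mxle e A.
Proof. by move=> Ad de i j; rewrite (le_trans (Ad i j)). Qed.

Lemma mxle0 e m n : 0 <= e -> mxle e (0 : 'M[K]_(m, n)).
Proof. by move=> e0 i j; rewrite mxE pabs0. Qed.

Lemma mxle1 n : mxle 1 (1%:M : 'M[K]_n).
Proof. by move=> i j; rewrite mxE; case: eqP; rewrite ?pabs1 ?pabs0. Qed.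

Lemma mxleD e m n (A B : 'M[K]_(m, n)) : mxle e A -> mxle e B -> mxle e (A + B).
Proof. by move=> Ae Be i j; rewrite mxE pabsD_le. Qed.

Lemma mxleN e m n (A : 'M[K]_(m, n)) : mxle e A -> mxle e (- A).
Proof. by move=> Ae i j; rewrite mxE pabsN. Qed.

Lemma mxleB e m n (A B : 'M[K]_(m, n)) : mxle e A -> mxle e B -> mxle e (A - B).
Proof. by move=> Ae Be; apply/mxleD/mxleN. Qed.

Lemma mxle_distC e m n (A B : 'M[K]_(m, n)) : mxle e (A - B) -> mxle e (B - A).
Proof. by rewrite -[B - A]opprB; apply: mxleN. Qed.

Lemma mxle_dist_trans e m n (B A C : 'M[K]_(m, n)) :
  mxle e (A - B) -> mxle e (B - C) -> mxle e (A - C).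
Proof. by move=> AB BC; rewrite -(subrKA B A); apply: mxleD. Qed.

(** The number of summands does not enter the bound, the absolute value being ultrametric. *)
Lemma mxleM d e m n l (A : 'M[K]_(m, n)) (B : 'M[K]_(n, l)) : 0 <= d -> 0 <= e ->
  mxle d A -> mxle e B -> mxle (d * e) (A *m B).
Proof.
move=> d0 e0 Ad Be i j; rewrite mxE pabs_sum_le ?mulr_ge0 // => k _.
exact: pabsM_le.
Qed.

Lemma mxleM1l e m n l (A : 'M[K]_(m, n)) (B : 'M[K]_(n, l)) : 0 <= e ->
  mxle 1 A -> mxle e B -> mxle e (A *m B).
Proof. by move=> e0 A1 Be; rewrite -[e]mul1r; apply: mxleM. Qed.

Lemma mxleM1r e m n l (A : 'M[K]_(m, n)) (B : 'M[K]_(n, l)) : 0 <= e ->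
  mxle e A -> mxle 1 B -> mxle e (A *m B).
Proof. by move=> e0 Ae B1; rewrite -[e]mulr1; apply: mxleM. Qed.

Lemma mxleZ (c : K) e m n (A : 'M[K]_(m, n)) : mxle e A -> mxle (pabs c * e) (c *: A).
Proof. by move=> Ae i j; rewrite mxE pabsM ler_wpM2l ?pabs_ge0. Qed.

Lemma mxle_block e m1 m2 n1 n2 (A : 'M[K]_(m1, n1)) (B : 'M[K]_(m1, n2))
    (C : 'M[K]_(m2, n1)) (D : 'M[K]_(m2, n2)) :
  mxle e A -> mxle e B -> mxle e C -> mxle e D -> mxle e (block_mx A B C D).
Proof.
move=> Ae Be Ce De i j; rewrite !mxE.
by case: (fintype.split i) => i'; rewrite mxE; case: (fintype.split j).
Qed.

Lemma pabs_prod_cong (I : Type) (r : seq I) (e : R) (F G : I -> K) :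
  0 <= e -> (forall i, pabs (F i) <= 1) -> (forall i, pabs (G i) <= 1) ->
  (forall i, pabs (F i - G i) <= e) ->
  pabs (\prod_(i <- r) F i - \prod_(i <- r) G i) <= e.
Proof.
move=> e0 F1 G1 FG; elim: r => [|i r IH]; first by rewrite !big_nil subrr pabs0.
rewrite !big_cons.
rewrite (_ : _ - _ = (F i - G i) * \prod_(j <- r) F j
   + G i * (\prod_(j <- r) F j - \prod_(j <- r) G j)); last by ring.
apply: pabsD_le; last exact: pabsM_le1.
by apply: pabsMr_le1 => //; apply: pabs_prod_le1.
Qed.

(** The determinant is a polynomial with integer coefficients, so congruences between integral
    matrices pass to it. *)
Lemma pabs_det_cong n (e : R) (A B : 'M[K]_n) : 0 <= e ->
  mxle 1 A -> mxle 1 B -> mxle e (A - B) -> pabs (\det A - \det B) <= e.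
Proof.
move=> e0 A1 B1 AB; rewrite /determinant -sumrB pabs_sum_le // => s _.
rewrite -mulrBr pabsM_le1 ?pabs_sign //; apply: pabs_prod_cong => // i.
by have := AB i (s i); rewrite !mxE.
Qed.

Lemma pabs_det_le1 n (A : 'M[K]_n) : mxle 1 A -> pabs (\det A) <= 1.
Proof.
move=> A1; rewrite pabs_sum_le // => s _.
by rewrite pabsM_le1 ?pabs_sign // pabs_prod_le1.
Qed.

Lemma det_upper n (A : 'M[K]_n) : (forall i j : 'I_n, (j < i)%N -> A i j = 0) ->
  \det A = \prod_i A i i.
Proof.
move=> A0; rewrite -det_tr det_trig; first by apply: eq_bigr => i _; rewrite mxE.
by apply/is_trig_mxP => i j ij; rewrite mxE A0.
Qed.

(** Clearing the entries below the diagonal moves the determinant by at most e and leaves a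
    triangular matrix. *)
Lemma pabs_det_lower n (e : R) (A : 'M[K]_n) : 0 <= e -> mxle 1 A ->
  (forall i j : 'I_n, (j < i)%N -> pabs (A i j) <= e) ->
  pabs (\det A - \prod_i A i i) <= e.
Proof.
move=> e0 A1 Ae; pose B := \matrix_(i, j) if (j < i)%N then 0 else A i j.
have B0 (i j : 'I_n) : (j < i)%N -> B i j = 0 by move=> ij; rewrite mxE ij.
have <- : \det B = \prod_i A i i.
  by rewrite det_upper //; apply: eq_bigr => i _; rewrite mxE ltnn.
apply: pabs_det_cong => // i j; rewrite !mxE.
  by case: ifP => _; rewrite ?pabs0.
by case: ifP => ij; rewrite ?subr0 ?subrr ?pabs0 // Ae.
Qed.

Lemma mxle_adj n (A : 'M[K]_n) : mxle 1 A -> mxle 1 (\adj A).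
Proof.
move=> A1 i j; rewrite mxE /cofactor pabsM_le1 ?pabs_sign //.
by apply: pabs_det_le1 => k l; rewrite !mxE.
Qed.

Lemma mxle_inv n (A : 'M[K]_n) : mxle 1 A -> A \in unitmx ->
  mxle (pabs (\det A))^-1 (invmx A).
Proof.
move=> A1 Au; rewrite /invmx Au -pabsV -[pabs _]mulr1.
by apply/mxleZ/mxle_adj.
Qed.

Lemma det_neq0 n (g : GL K n) : \det g != 0.
Proof. by rewrite -unitfE -unitmxE GLvalP. Qed.

(* Iwasawa decomposition, with both factors exhibited on one side so that the
   inverse of an upper triangular matrix never has to be discussed. *)
Lemma iwasawa_mx n (A : 'M[K]_n) : A \in unitmx ->
  exists k c : 'M[K]_n, [/\ mxle 1 k, pabs (\det k) = 1,
    (forall i j : 'I_n, (j < i)%N -> c i j = 0) & k *m A *m c = 1%:M].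
Proof.
elim: n A => [A _|n IH]; last rewrite -[n.+1]/(1 + n)%N => A Au.
  exists 1%:M, 1%:M; split; [exact: mxle1|by rewrite det1 pabs1|by case|].
  by apply/matrixP; case.
(* The pivot is an entry of largest absolute value in the first column, which makes the multipliers
   of the elimination integral. *)
have [i0 hi0] : exists i0, forall i, pabs (A i 0) <= pabs (A i0 0).
  have [i0 _ h] := arg_maxP (fun i => pabs (A i 0)) (isT : xpredT (0 : 'I_(1 + n))).
  by exists i0 => i; apply: h.
have a0 : A i0 0 != 0.
  apply: contraTneq Au => a0; rewrite unitmxE unitfE negbK.
  rewrite (expand_det_col _ 0) big1 // => i _.
  by move: (hi0 i); rewrite a0 pabs0 le_eqVlt ltNge pabs_ge0 orbF pabs_eq0
    => /eqP->; rewrite mul0r.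
pose s := tperm_mx 0 i0 : 'M[K]_(1 + n).
have [B sA] : exists B : 'M[K]_(1 + n), s *m A = B by exists (s *m A).
pose a := A i0 0.
have BE i j : B i j = A (tperm 0 i0 i) j.
  by rewrite -sA /s -xrowE !mxE.
have Bu : B \in unitmx by rewrite -sA unitmx_mul Au /s unitmx_perm.
have l0 : lshift n (0 : 'I_1) = 0 by apply: val_inj.
have Bul : ulsubmx B = a%:M by rewrite [LHS]mx11_scalar !mxE l0 BE tpermL.
pose r := ursubmx B; pose C := dlsubmx B; pose D := drsubmx B.
have Bbl : B = block_mx a%:M r C D by rewrite -Bul submxK.
pose D' := D - a^-1 *: (C *m r).
pose k1 : 'M[K]_(1 + n) := block_mx 1%:M 0 (- a^-1 *: C) 1%:M.
have k1B : k1 *m B = block_mx a%:M r 0 D'.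
  rewrite /k1 Bbl mulmx_block !mul1mx !mul0mx !addr0; congr block_mx.
    by rewrite mul_mx_scalar scalerA mulrN mulfV // scaleN1r addNr.
  by rewrite -scalemxAl scaleNr addrC.
have k1d : \det k1 = 1 by rewrite det_lblock !det1 mulr1.
have D'u : D' \in unitmx.
  have : k1 *m B \in unitmx by rewrite unitmx_mul Bu unitmxE k1d unitr1.
  by rewrite k1B !unitmxE det_ublock unitrM => /andP[].
have [k' [c' [k'1 k'd c'0 kDc]]] := IH D' D'u.
pose k2 : 'M[K]_(1 + n) := block_mx 1%:M 0 0 k'.
exists (k2 *m k1 *m s), (block_mx a^-1%:M (- a^-1 *: (r *m c')) 0 c'); split.
- apply: mxleM1l => //; last first.
    by move=> i j; rewrite /s !mxE; case: eqP; rewrite ?pabs1 ?pabs0.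
  apply: mxleM1l => //; apply: mxle_block => //; do ?exact: mxle1;
    do ?exact: mxle0.
  move=> i j; rewrite [j]ord1 !mxE pabsM pabsN pabsV.
  by rewrite ler_pdivrMl ?pabs_gt0 // mulr1 l0 BE hi0.
- rewrite !det_mulmx k1d det_lblock det1 mul1r mulr1 pabsM k'd mul1r det_perm pabs_sign //.
- move=> i j; rewrite !mxE.
  case: (split_ordP i) => i' ->; rewrite !mxE; case: (split_ordP j) => j' -> /=;
    rewrite ?mxE //.
  + by rewrite !ord1.
  + by rewrite ltnNge (leq_trans _ (leq_addr _ _)) // ltnW.
  + by rewrite ltn_add2l => /c'0.
rewrite -[_ *m s *m A]mulmxA sA -[k2 *m k1 *m B]mulmxA k1B /k2 !mulmx_block.
rewrite !mul1mx !mul0mx !mulmx0 !addr0 !add0r kDc -scalar_mxM mulfV //.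
rewrite mul_scalar_mx scalerA mulrN mulfV // scaleN1r addNr.
by rewrite !mul0mx add0r -scalar_mx_block.
Qed.

End padic_matrices.

(** * Congruence subgroups and Haar measure *)

Definition subgroup (G : groupType) (H : set G) :=
  [/\ H 1%g, forall g h, H g -> H h -> H (g * h)%g & forall g, H g -> H g^-1%g].

Section congruence_subgroups.
Context {p : nat} {R : realType} {K : padicFieldType p R} {n : nat}.
Implicit Types (g h k : GL K n) (A : 'M[K]_n).

Lemma GLvalM g h : GLval (g * h)%g = GLval g *m GLval h.
Proof. by []. Qed.

Lemma GLvalV g : GLval (g^-1)%g = invmx g.
Proof. by []. Qed.

Lemma detM g h : \det (GLval (g * h)%g) = \det g * \det h.
Proof. by rewrite GLvalM det_mulmx. Qed.

Lemma detV g : \det (GLval (g^-1)%g) = (\det g)^-1.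
Proof. by rewrite GLvalV det_inv. Qed.

(** Singular matrices are sent to 1, so that families indexed by all residue matrices or all
    rational matrices are total. *)
Definition toGL A : GL K n := insubd (1%g : GL K n) A.

Lemma toGLK A : A \in unitmx -> GLval (toGL A) = A.
Proof. by move=> Au; rewrite -[GLval _]/(val (toGL A)) insubdK. Qed.

Lemma pabs_det1_unit A : pabs (\det A) = 1 -> A \in unitmx.
Proof.
by move=> h; rewrite unitmxE unitfE -pabs_eq0 h oner_eq0.
Qed.

Lemma GLint_subgroup : subgroup (@GLint p R K n).
Proof.
split=> [|g h [g1 gd] [h1 hd]|g [g1 gd]].
- by split; [exact: mxle1|rewrite det1 pabs1].
- split; last by rewrite detM pabsM gd hd mulr1.
  by apply: mxleM1l.
- split; last by rewrite detV pabsV gd invr1.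
  by have := mxle_inv g1 (GLvalP g); rewrite gd invr1.
Qed.

(** The principal congruence subgroup K(M). For M = 0 the condition only says that g is integral, so
    the group properties require M > 0. *)
Definition pcong (M : nat) : set (GL K n) :=
  [set g | mxle (p%:R ^- M) (GLval g - 1%:M)].

Hypothesis p_pr : prime p.

Lemma mxle_cong_det1 M A B : (0 < M)%N -> mxle 1 A -> mxle 1 B ->
  mxle (p%:R ^- M) (A - B) -> pabs (\det A) = 1 -> pabs (\det B) = 1.
Proof.
move=> M0 A1 B1 AB Ad; rewrite -Ad; apply: pabs_dominant; rewrite Ad.
apply: (@le_lt_trans _ _ (p%:R ^- M)).
  by apply: pabs_det_cong => //; rewrite ltW // pexpN_gt0.
by have := @pexpN_lt p R p_pr 0 M; rewrite expr0 invr1 M0.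
Qed.

Lemma pcongE M g : pcong M g = mxle (p%:R ^- M) (GLval g - 1%:M).
Proof. by []. Qed.

Lemma pcong_le M M' : (M <= M')%N -> pcong M' `<=` pcong M.
Proof. by move=> MM g /mxle_trans; apply; apply: pexpN_le. Qed.

Let expN_ge0 M : 0 <= p%:R ^- M :> R.
Proof. by rewrite ltW // pexpN_gt0. Qed.

Lemma pcong_mxle1 M g : pcong M g -> mxle 1 g.
Proof.
move=> gM; rewrite -(subrK 1%:M (GLval g)); apply: mxleD; last exact: mxle1.
by apply: mxle_trans gM _; apply: pexpN_le1.
Qed.

Lemma pcong_GLint M : (0 < M)%N -> pcong M `<=` GLint.
Proof.
move=> M0 g gM; split; first exact: pcong_mxle1 gM.
apply: (mxle_cong_det1 M0 (@mxle1 _ _ _ n) (pcong_mxle1 gM)).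
  exact: mxle_distC.
by rewrite det1 pabs1.
Qed.

(** Multiplication by g or its inverse, both integral, keeps entrywise bounds: inside GL_n(Z_p) the
    cosets of K(M) are the residue classes mod p^M. *)
Lemma pcong_GLintP M g h : (0 < M)%N -> GLint g ->
  pcong M (g^-1 * h)%g <-> mxle (p%:R ^- M) (GLval h - GLval g).
Proof.
move=> M0 gI; have [_ _ /(_ g gI) [gV1 _]] := GLint_subgroup.
have [g1 _] := gI; rewrite pcongE GLvalM; split => hM.
  have -> : GLval h - GLval g = GLval g *m (GLval g^-1%g *m GLval h - 1%:M).
    by rewrite mulmxBr mulmx1 mulmxA -GLvalM mulgV mul1mx.
  exact: mxleM1l.
have -> : GLval g^-1%g *m GLval h - 1%:M = GLval g^-1%g *m (GLval h - GLval g).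
  by rewrite mulmxBr -[GLval g^-1%g *m GLval g]GLvalM mulVg.
exact: mxleM1l.
Qed.

Lemma pcong_subgroup M : (0 < M)%N -> subgroup (pcong M).
Proof.
move=> M0; have [_ _ IV] := GLint_subgroup; split => [|g h gM hM|g gM].
- by rewrite pcongE subrr; apply: mxle0.
- rewrite pcongE GLvalM -(subrKA (GLval h)).
  apply: mxleD => //; rewrite -[X in _ - X](mul1mx (GLval h)) -mulmxBl.
  by apply: mxleM1r => //; apply: pcong_mxle1 hM.
- rewrite -[g^-1%g]mulg1; apply/pcong_GLintP => //; first exact: (pcong_GLint M0).
  exact: mxle_distC.
Qed.

Lemma pcong_conj M g k : (0 < M)%N -> GLint g -> pcong M k ->
  pcong M (g * k * g^-1)%g.
Proof.
move=> M0 gI kM; have [_ _ /(_ g gI) [gV1 _]] := GLint_subgroup.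
have [g1 _] := gI; rewrite pcongE.
have -> : GLval (g * k * g^-1)%g - 1%:M
    = GLval g *m (GLval k - 1%:M) *m GLval g^-1%g.
  by rewrite mulmxBr mulmxBl mulmx1 -!GLvalM mulgV.
by apply: mxleM1r => //; apply: mxleM1l.
Qed.

Definition resmx M (a : 'M['I_(p ^ M)]_n) : 'M[K]_n := \matrix_(i, j) (a i j)%:R.

Lemma resmx_mxle1 M a : mxle 1 (@resmx M a).
Proof. by move=> i j; rewrite mxE pabs_nat_le1. Qed.

Lemma resmx_inj M (a b : 'M['I_(p ^ M)]_n) :
  mxle (p%:R ^- M) (resmx a - resmx b) -> a = b.
Proof.
move=> h; apply/matrixP => i j; apply: (padic_residue_inj (K := K) p_pr).
by have := h i j; rewrite !mxE.
Qed.

Lemma resmx_exists M A : mxle 1 A ->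
  exists a : 'M['I_(p ^ M)]_n, mxle (p%:R ^- M) (A - resmx a).
Proof.
move=> A1; have h (ij : 'I_n * 'I_n) := padic_residue p_pr M (A1 ij.1 ij.2).
have [f hf] := choice h; exists (\matrix_(i, j) f (i, j)) => i j.
by rewrite !mxE; apply: (hf (i, j)).
Qed.

(** For a subgroup H between K(M) and GL_n(Z_p), these residue matrices lift to representatives of H
    / K(M), by [reps_cover] and [reps_uniq]. *)
Definition reps M (H : set (GL K n)) : pred 'M['I_(p ^ M)]_n :=
  [pred a | (resmx a \in unitmx) && `[<H (toGL (resmx a))>]].
Arguments reps M H : clear implicits.

Lemma reps_cover M (H : set (GL K n)) g : (0 < M)%N ->
  subgroup H -> H `<=` GLint -> pcong M `<=` H -> H g ->
  exists2 a, reps M H a & pcong M ((toGL (resmx a))^-1 * g)%g.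
Proof.
move=> M0 [H1 HM HV] HI MH Hg; have [g1 gd] := HI _ Hg.
have [a ha] := resmx_exists M g1; exists a; last first.
  have ad := mxle_cong_det1 M0 g1 (@resmx_mxle1 _ a) ha gd.
  apply/pcong_GLintP => //; rewrite ?toGLK ?pabs_det1_unit //.
  by split; rewrite ?toGLK ?pabs_det1_unit //; apply: resmx_mxle1.
have ad := mxle_cong_det1 M0 g1 (@resmx_mxle1 _ a) ha gd.
have au := pabs_det1_unit ad.
apply/andP; split => //; apply/asboolP.
have -> : toGL (resmx a) = (g * (g^-1 * toGL (resmx a)))%g by rewrite mulKVg.
apply: HM => //; apply: MH; apply/pcong_GLintP => //.
by rewrite toGLK //; apply: mxle_distC.
Qed.

Lemma reps_GL M (H : set (GL K n)) a : H `<=` GLint -> reps M H a ->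
  [/\ H (toGL (resmx a)), GLint (toGL (resmx a)) & GLval (toGL (resmx a)) = resmx a].
Proof.
move=> HI /andP[au /asboolP Ha]; split; [by []|exact: HI|exact: toGLK].
Qed.

Lemma reps_uniq M (H : set (GL K n)) a b : (0 < M)%N -> H `<=` GLint ->
  reps M H a -> reps M H b ->
  pcong M ((toGL (resmx a))^-1 * toGL (resmx b))%g -> a = b.
Proof.
move=> M0 HI /(reps_GL HI)[_ aI aE] /(reps_GL HI)[_ bI bE] /(pcong_GLintP _ M0 aI).
by rewrite aE bE => /mxle_distC/resmx_inj.
Qed.

(** Left multiplication by k0 permutes the cosets in H / K(M), on which F is constant. *)
Lemma sum_reps_mull (V : nmodType) M (H : set (GL K n)) (F : GL K n -> V) k0 :
  (0 < M)%N -> subgroup H -> H `<=` GLint -> pcong M `<=` H ->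
  (forall h k, H h -> pcong M k -> F (h * k)%g = F h) -> H k0 ->
  \sum_(a | reps M H a) F (k0 * toGL (resmx a))%g =
  \sum_(a | reps M H a) F (toGL (resmx a)).
Proof.
move=> M0 sH HI MH FM Hk0; have [H1 HM HV] := sH.
have [k1 kd] := HI _ Hk0.
(* [rho] is multiplication by k0 on all residue matrices mod p^M; it is shown below to preserve
   [reps M H] in both directions. *)
have [rho hrho] := choice (fun a => resmx_exists M (mxleM1l ler01 k1 (@resmx_mxle1 M a))).
have rho_inj : injective rho.
  move=> a b ab; apply: resmx_inj.
  have [_ _ /(_ _ (HI _ Hk0)) [kV1 _]] := GLint_subgroup.
  have -> : resmx a - resmx b =
      GLval k0^-1%g *m (GLval k0 *m resmx a - GLval k0 *m resmx b).
    by rewrite -mulmxBr mulmxA -GLvalM mulVg mul1mx.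
  apply: mxleM1l => //; apply: mxle_dist_trans (hrho a) _; rewrite ab.
  exact: mxle_distC.
rewrite [RHS](reindex_inj rho_inj) /=.
have rhoP a : reps M H a -> pcong M ((k0 * toGL (resmx a))^-1 * toGL (resmx (rho a)))%g
    /\ GLval (toGL (resmx (rho a))) = resmx (rho a).
  move=> ra; have [Ha aI aE] := reps_GL HI ra.
  have Hka : H (k0 * toGL (resmx a))%g by apply: HM.
  have ad : pabs (\det (resmx (rho a))) = 1.
    apply: (mxle_cong_det1 M0 _ (@resmx_mxle1 _ _) (hrho a)).
      by apply: mxleM1l => //; apply: resmx_mxle1.
    by rewrite det_mulmx pabsM kd -aE; have [_ ->] := aI; rewrite mul1r.
  rewrite toGLK ?pabs_det1_unit //; split => //.
  apply/pcong_GLintP => //; first exact: HI.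
  rewrite toGLK ?pabs_det1_unit // GLvalM aE; exact: mxle_distC.
apply: eq_big => [a|a ra]; last first.
  have [ka _] := rhoP a ra; have [Ha _ _] := reps_GL HI ra.
  have -> : toGL (resmx (rho a)) = (k0 * toGL (resmx a) *
      ((k0 * toGL (resmx a))^-1 * toGL (resmx (rho a))))%g by rewrite mulKVg.
  by rewrite [RHS]FM //; apply: HM.
apply/idP/idP => ra.
  have [ka aE] := rhoP a ra; have [Ha _ _] := reps_GL HI ra.
  apply/andP; split; first by rewrite -aE GLvalP.
  apply/asboolP; rewrite -[toGL _](mulKVg (k0 * toGL (resmx a))%g).
  by apply: (HM); [exact: HM|exact: MH].
have [Hb bI bE] := reps_GL HI ra.
have ad : pabs (\det (GLval k0 *m resmx a)) = 1.
  apply: (mxle_cong_det1 M0 (@resmx_mxle1 _ (rho a))).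
  - by apply: mxleM1l => //; apply: resmx_mxle1.
  - exact: mxle_distC.
  - by have [_] := bI; rewrite bE.
have au : resmx a \in unitmx.
  by have := pabs_det1_unit ad; rewrite unitmx_mul GLvalP.
apply/andP; split => //; apply/asboolP.
rewrite -[toGL _](mulKg k0); apply: (HM); first exact: HV.
rewrite -[X in H X](mulKVg (toGL (resmx (rho a)))); apply: (HM) => //; apply: MH.
by apply/pcong_GLintP => //; rewrite GLvalM toGLK // bE.
Qed.

(** Applied to g^-1, [iwasawa_mx] gives k g^-1 c = 1, that is g = c k. *)
Lemma iwasawa g : exists b k, [/\ borel_sub b, GLint k & g = (b * k)%g].
Proof.
have [k [c [k1 kd c0 kc]]] := iwasawa_mx (GLvalP g^-1%g).
have ku := pabs_det1_unit kd.
have cu : c \in unitmx.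
  by have := unitmx1 K n; rewrite -kc unitmx_mul => /andP[].
exists (MkGL cu), (MkGL ku); split=> //.
apply: (mulgI g^-1%g); rewrite mulVg mulgA.
apply: (mulgI (MkGL ku)); apply: (mulIg (MkGL ku)^-1%g).
rewrite !mulgA mulgK mulg1 mulgV; apply: val_inj => /=.
by rewrite -[LHS]kc.
Qed.

Lemma iwahoriM g h : iwahori g -> iwahori h -> iwahori (g * h)%g.
Proof.
move=> [gI gl] [hI hl]; have [_ IM _] := GLint_subgroup.
split; first exact: IM.
have p0 : 0 <= p%:R^-1 :> R by rewrite invr_ge0.
have [[g1 _] [h1 _]] := (gI, hI).
move=> i j ij; rewrite GLvalM mxE pabs_sum_le // => k _.
have [ki|ik] := ltnP k i; first by apply: pabsMr_le1; rewrite ?gl ?h1.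
by apply: pabsM_le1; rewrite ?g1 // hl // (leq_trans ij).
Qed.

Lemma pcong_iwahori M : (0 < M)%N -> pcong M `<=` iwahori.
Proof.
move=> M0 g gM; split; first exact: pcong_GLint gM.
move=> i j ij; have := gM i j; rewrite !mxE -val_eqE /= gtn_eqF // subr0 => /le_trans; apply.
exact: (@pexpN_le p R p_pr 1 M).
Qed.

End congruence_subgroups.

Arguments reps {p R K n} M H.

Lemma bigsetU_exists (T : Type) (I : choiceType) (r : seq I) (P : pred I) (F : I -> set T) x :
  (\big[setU/set0]_(i <- r | P i) F i) x <-> exists i, [/\ i \in r, P i & F i x].
Proof.
rewrite -bigcup_seq_cond; split => [[i /= /andP[ir Pi] Fi]|[i [ir Pi Fi]]].
  by exists i.
by exists i => //=; rewrite ir.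
Qed.

Section finite_unions.
Context {d : measure_display} {T : measurableType d} {R : realType}.
Variable mu : {measure set T -> \bar R}.

Lemma measure_bigsetU_seq (I : choiceType) (r : seq I) (P : pred I) (F : I -> set T) :
  uniq r -> (forall i, P i -> measurable (F i)) ->
  (forall i j x, P i -> P j -> F i x -> F j x -> i = j) ->
  mu (\big[setU/set0]_(i <- r | P i) F i) = (\sum_(i <- r | P i) mu (F i))%E.
Proof.
move=> + mF dF; elim: r => [_|i r IH /= /andP[ir ur]]; rewrite ?big_nil ?measure0 //.
rewrite !big_cons; case: ifPn => Pi; last exact: IH.
have mr : measurable (\big[setU/set0]_(j <- r | P j) F j).
  by apply: bigsetU_measurable => j Pj; exact: mF.
have mi := mF _ Pi; rewrite (measureU mu mi mr); first by congr (_ + _)%E; exact: IH.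
apply/seteqP; split => // x [Fi /bigsetU_exists[j [jr Pj Fj]]].
by move: ir; rewrite (dF _ _ _ Pi Pj Fi Fj) jr.
Qed.

Lemma measure_bigsetU_le (I : choiceType) (r : seq I) (P : pred I) (F : I -> set T) :
  (forall i, P i -> measurable (F i)) ->
  (mu (\big[setU/set0]_(i <- r | P i) F i) <= \sum_(i <- r | P i) mu (F i))%E.
Proof.
move=> mF; elim: r => [|i r IH]; rewrite ?big_nil ?measure0 // !big_cons.
case: ifPn => Pi //; have mi := mF _ Pi.
have mr : measurable (\big[setU/set0]_(j <- r | P j) F j).
  by apply: bigsetU_measurable => j Pj; exact: mF.
by rewrite (le_trans (measureU2 _ mi mr)) // leeD2l.
Qed.

End finite_unions.

Section haar_measures.
Context {p : nat} {R : realType} {K : padicFieldType p R} {n : nat}.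
Hypothesis p_pr : prime p.
Implicit Types (g h k x : GL K n) (A : set (GL K n)).

Definition coset M g : set (GL K n) := [set x | pcong M (g^-1 * x)%g].

Lemma coset_refl M g : coset M g g.
Proof. by rewrite /coset /= mulVg pcongE subrr; apply: mxle0. Qed.

Lemma coset_eq M g h : (0 < M)%N -> coset M g h -> coset M g = coset M h.
Proof.
move=> M0 gh; have [_ MM MV] := pcong_subgroup p_pr M0 (K := K) (n := n).
apply/seteqP; split => x /=; rewrite /coset /= => gx.
  have -> : (h^-1 * x = (g^-1 * h)^-1 * (g^-1 * x))%g.
    by rewrite invMg invgK !mulgA mulgK.
  by apply: MM => //; apply: MV.
have -> : (g^-1 * x = (g^-1 * h) * (h^-1 * x))%g by rewrite mulgA mulgK.
exact: MM.
Qed.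

Lemma coset_le M M' g : (M <= M')%N -> coset M' g `<=` coset M g.
Proof. by move=> MM x; apply: pcong_le. Qed.

Lemma cosetP M g x : coset M g x <-> exists2 k, pcong M k & x = (g * k)%g.
Proof.
split=> [gx|[k Mk ->]]; first by exists (g^-1 * x)%g; rewrite ?mulKVg.
by rewrite /coset /= mulKg.
Qed.

Lemma GL_bounded g : exists N, mxle 1 (p%:R ^+ N *: GLval g).
Proof.
have [N hN] := padic_bounded p_pr (fun ij : 'I_n * 'I_n => g ij.1 ij.2).
by exists N => i j; rewrite mxE (hN (i, j)).
Qed.

Lemma GL_openE : @open (GL K n) = @GL_open p R K n.
Proof. by []. Qed.

(** N absorbs the denominators of g^-1. The statement is about matrices A because [rational_coset]
    deduces from it that a rational approximation of g is invertible. *)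
Lemma mx_coset_ball M g : exists N, forall A : 'M[K]_n,
  mxle (p%:R ^- N) (A - GLval g) -> mxle (p%:R ^- M) (GLval g^-1%g *m A - 1%:M).
Proof.
have [N hN] := GL_bounded g^-1%g; exists (N + M)%N => x hx.
have -> : GLval g^-1%g *m x - 1%:M = GLval g^-1%g *m (x - GLval g).
  by rewrite mulmxBr -[GLval g^-1%g *m GLval g]GLvalM mulVg.
have pN : (p%:R : K) ^+ N != 0 by rewrite expf_neq0 // padicp_neq0.
have -> : GLval g^-1%g *m (x - GLval g) =
    (p%:R ^+ N *: GLval g^-1%g) *m (p%:R ^- N *: (x - GLval g)).
  by rewrite -scalemxAl -scalemxAr scalerA mulfV // scale1r.
apply: mxleM1l => //; apply: mxle_trans (mxleZ _ hx) _.
rewrite pabsV pabs_pX // invrK exprD invfM mulrA mulfV ?mul1r //.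
by rewrite gt_eqF // exprn_gt0 // ltr0n prime_gt0.
Qed.

Lemma coset_ball M g : exists N, forall x,
  mxle (p%:R ^- N) (GLval x - GLval g) -> coset M g x.
Proof. by have [N hN] := mx_coset_ball M g; exists N => x; apply: hN. Qed.

Lemma ball_coset M g : exists N, forall x,
  coset N g x -> mxle (p%:R ^- M) (GLval x - GLval g).
Proof.
have [N hN] := GL_bounded g; exists (N + M)%N => x hx.
have pN : (p%:R : K) ^+ N != 0 by rewrite expf_neq0 // padicp_neq0.
have -> : GLval x - GLval g =
    (p%:R ^+ N *: GLval g) *m (p%:R ^- N *: (GLval (g^-1 * x)%g - 1%:M)).
  rewrite -scalemxAl -scalemxAr scalerA mulfV // scale1r mulmxBr mulmx1.
  by rewrite -GLvalM mulKVg.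
apply: mxleM1l => //; apply: mxle_trans (mxleZ _ hx) _.
rewrite pabsV pabs_pX // invrK exprD invfM mulrA mulfV ?mul1r //.
by rewrite gt_eqF // exprn_gt0 // ltr0n prime_gt0.
Qed.

Lemma open_coset M g : (0 < M)%N -> open (coset M g).
Proof.
move=> M0; rewrite GL_openE => x gx; have [N hN] := coset_ball M x.
exists (p%:R ^- N); first exact: pexpN_gt0.
move=> y hy; rewrite (coset_eq M0 gx); apply: hN => i j.
by rewrite !mxE ltW.
Qed.

Lemma open_cosetP A : open A <-> forall g, A g -> exists2 M, (0 < M)%N & coset M g `<=` A.
Proof.
split=> [oA g Ag|hA].
  have [e e0 he] := oA g Ag; have [M hM] := pexpN_small p_pr e0.
  have [N hN] := ball_coset M g; exists N.+1 => // x gx.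
  apply: he => i j; apply: le_lt_trans hM.
  by have := hN x (coset_le (leqnSn N) gx) i j; rewrite !mxE.
rewrite (_ : A = \bigcup_(x : {g & {M : nat | (0 < M)%N /\ coset M g `<=` A}})
    coset (sval (projT2 x)) (projT1 x)).
  by apply: bigcup_open => -[g [M [M0 ?]]] _; apply: open_coset.
apply/seteqP; split => [g Ag|x [[g [M [M0 MA]]] _]]; last exact: MA.
have /cid2[M M0 MA] := hA g Ag.
by exists (existT _ g (exist _ M (conj M0 MA))) => //; apply: coset_refl.
Qed.

Lemma open_measurable A : open A -> measurable (A : set (borel (GL K n))).
Proof. exact: sub_sigma_algebra. Qed.

Lemma measurable_coset M g : (0 < M)%N ->
  measurable (coset M g : set (borel (GL K n))).
Proof. by move=> M0; apply: (@open_measurable (coset M g)); apply: open_coset. Qed.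

(** Uniform local constancy: it yields measurability at once and allows averages over finitely many
    residues. *)
Definition rinvariant (T : Type) M (f : GL K n -> T) :=
  forall g k, pcong M k -> f (g * k)%g = f g.

Lemma rinvariant_open M A : (0 < M)%N ->
  (forall g k, A g -> pcong M k -> A (g * k)%g) -> open A.
Proof.
move=> M0 hA; apply/open_cosetP => g Ag; exists M => // x /cosetP[k Mk ->].
exact: hA.
Qed.

Lemma rinvariant_measurable d (T : measurableType d) M (f : GL K n -> T) :
  (0 < M)%N -> rinvariant M f ->
  measurable_fun setT (f : borel (GL K n) -> T).
Proof.
move=> M0 fM _ Y _; apply: open_measurable; rewrite setTI.
by apply: (rinvariant_open M0) => g k /= Yg Mk; rewrite fM.
Qed.

(** Second countability in the form used below: the countably many rational matrices meet every
    coset, at every level. *)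
Lemma rational_coset : exists q : nat -> GL K n,
  forall M g, exists i, coset M g (q i).
Proof.
exists (fun i => if @unpickle ('M[rat]_n) i is Some B
                 then toGL (map_mx ratr B) else 1%g).
(* Level M + 1, since a congruence at level 0 would not force the determinant to be a unit. *)
move=> M g; have [N hN] := mx_coset_ball M.+1 g.
have h (ij : 'I_n * 'I_n) := pabs_dense (g ij.1 ij.2) _ (pexpN_gt0 p_pr N (R := R)).
have [f hf] := choice h; pose B : 'M[K]_n := map_mx ratr (\matrix_(i, j) f (i, j)).
have hB : mxle (p%:R ^- M.+1) (GLval g^-1%g *m B - 1%:M).
  by apply: hN => i j; rewrite !mxE pabs_distC; apply/ltW/(hf (i, j)).
have B1 : mxle 1 (GLval g^-1%g *m B).
  rewrite -(subrK 1%:M (GLval g^-1%g *m B)); apply: mxleD; last exact: mxle1.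
  by apply: mxle_trans hB _; apply: pexpN_le1.
have Bd : pabs (\det (GLval g^-1%g *m B)) = 1.
  apply: (mxle_cong_det1 p_pr (ltn0Sn M) (@mxle1 _ _ _ n) B1).
    exact: mxle_distC.
  by rewrite det1 pabs1.
have Bu : B \in unitmx.
  by have := pabs_det1_unit Bd; rewrite unitmx_mul => /andP[].
exists (pickle (\matrix_(i, j) f (i, j))); rewrite pickleK.
apply: (coset_le (leqnSn M)); rewrite /coset /= pcongE GLvalM toGLK //.
Qed.

(** An open set is a countable union of cosets centred at the points [q i]. The empty set is added
    to make the generating family stable under intersection. *)
Lemma borel_generated : (@measurable _ (borel (GL K n)) : set (set (GL K n))) =
  <<s [set A | A = set0 \/ exists M g, (0 < M)%N /\ A = coset M g] >>.
Proof.
apply/seteqP; split => A; last first.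
  apply: smallest_sub => [|_ [->|[M [g [M0 ->]]]]].
  - exact: sigma_algebra_measurable.
  - exact: measurable0.
  - exact: measurable_coset.
apply: smallest_sub => [|U /open_cosetP oU]; first exact: smallest_sigma_algebra.
have [q hq] := rational_coset.
set G := (X in <<s X >>).
pose F M i := if `[<(0 < M)%N /\ coset M (q i) `<=` U>] then coset M (q i) else set0.
have -> : U = \bigcup_M \bigcup_i F M i.
  apply/seteqP; split => [g Ug|x [M _ [i _]]]; last first.
    by rewrite /F; case: asboolP => // -[_ MU] /MU.
  have [M M0 MU] := oU g Ug; have [i gi] := hq M g; exists M => //; exists i => //.
  have e := coset_eq M0 gi; rewrite /F asboolT -?e //; exact: coset_refl.
apply: sigma_algebra_bigcup => M; apply: sigma_algebra_bigcup => i.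
apply: sub_sigma_algebra; rewrite /F; case: asboolP => [[M0 _]|_]; last by left.
by right; exists M, (q i).
Qed.

(** Phrased with preimages, which suits pushforward measures; [haar_left_invariant] derives it from
    the formulation with images. *)
Definition left_invariant (m : set (borel (GL K n)) -> \bar R) :=
  forall g (A : set (borel (GL K n))), measurable A ->
    m [set x | A (g * x)%g] = m A.

Lemma left_invariant_coset (m : set (borel (GL K n)) -> \bar R) M g :
  left_invariant m -> (0 < M)%N -> m (coset M g) = m (pcong M).
Proof.
move=> mL M0; rewrite -(mL g^-1%g (pcong M)) //.
have -> : pcong M = coset M (1%g : GL K n).
  by apply/seteqP; split => x; rewrite /coset /= invg1 mul1g.
exact: measurable_coset.
Qed.

Lemma pcong_coset M : pcong M = coset M (1%g : GL K n).
Proof. by apply/seteqP; split => x; rewrite /coset /= invg1 mul1g. Qed.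

Lemma measurable_pcong M : (0 < M)%N -> measurable (pcong M : set (borel (GL K n))).
Proof. by rewrite pcong_coset; apply: measurable_coset. Qed.

Lemma bigcup_reps M (H : set (GL K n)) : (0 < M)%N ->
  subgroup H -> H `<=` GLint -> pcong M `<=` H ->
  H = \big[setU/set0]_(a <- index_enum 'M['I_(p ^ M)]_n | reps M H a)
        coset M (toGL (resmx a)).
Proof.
move=> M0 sH HI MH; apply/seteqP; split => g.
  move=> Hg; have [a ra ga] := reps_cover p_pr M0 sH HI MH Hg.
  by apply/bigsetU_exists; exists a; split; rewrite ?mem_index_enum.
move=> /bigsetU_exists[a [_ ra /cosetP[k Mk ->]]]; have [Ha _ _] := reps_GL HI ra.
by have [_ HM _] := sH; apply: HM => //; apply: MH.
Qed.

Lemma subgroup_measure (m : {measure set (borel (GL K n)) -> \bar R}) M H :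
  left_invariant m -> (0 < M)%N ->
  subgroup H -> H `<=` GLint -> pcong M `<=` H ->
  m H = (#|reps M H|%:R%:E * m (pcong M))%E.
Proof.
move=> mL M0 sH HI MH; rewrite {1}(bigcup_reps M0 sH HI MH).
rewrite measure_bigsetU_seq ?index_enum_uniq //.
- rewrite (eq_bigr (fun=> m (pcong M))); last by move=> a _; exact: left_invariant_coset.
  by rewrite sumr_const mule_natl.
- by move=> a _; apply: measurable_coset.
- move=> a b x ra rb ax bx; apply: (reps_uniq p_pr M0 HI ra rb).
  have : coset M (toGL (resmx a)) (toGL (resmx b)).
    by rewrite (coset_eq M0 ax) -(coset_eq M0 bx); apply: coset_refl.
  by [].
Qed.

End haar_measures.

(* The library declares this measure as a canonical instance which cannot be
   inferred, since the measurability of f does not occur in pushforward m f. *)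
Definition pushforward_measure d d' (T1 : measurableType d) (T2 : measurableType d')
    (R : realType) (m : {measure set T1 -> \bar R}) (f : T1 -> T2)
    (mf : measurable_fun setT f) : {measure set T2 -> \bar R} :=
  measure_function_pushforward__canonical__measure_function_Measure m mf.

(** * Uniqueness of Haar measure and the modulus of right translations *)

Section haar_invariance.
Context {p : nat} {R : realType} {K : padicFieldType p R} {n : nat}.
Hypothesis p_pr : prime p.
Implicit Types (g h k x : GL K n) (A : set (GL K n)).

Lemma mx_cauchy_lim (A : nat -> 'M[K]_n) :
  (forall M M', (M <= M')%N -> mxle (p%:R ^- M) (A M' - A M)) ->
  exists L, forall M, mxle (p%:R ^- M) (A M - L).
Proof.
move=> hA.
have h (ij : 'I_n * 'I_n) : exists l, forall M, pabs (A M ij.1 ij.2 - l) <= p%:R ^- M.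
  have [|l hl] := pabs_complete (fun M => A M ij.1 ij.2).
    move=> e e0; have [N hN] := pexpN_small p_pr e0; exists N => i j Ni Nj.
    apply: le_lt_trans hN.
    apply: (@pabs_dist_trans _ _ _ (A N ij.1 ij.2)).
      by have := hA _ _ Ni ij.1 ij.2; rewrite !mxE.
    by have := hA _ _ Nj ij.1 ij.2; rewrite !mxE pabs_distC.
  exists l => M; have [N hN] := hl _ (pexpN_gt0 p_pr M).
  apply: (@pabs_dist_trans _ _ _ (A (maxn M N) ij.1 ij.2)).
    by have := hA _ _ (leq_maxl M N) ij.1 ij.2; rewrite !mxE pabs_distC.
  by rewrite ltW // hN // leq_maxr.
have [l hl] := choice h; exists (\matrix_(i, j) l (i, j)) => M i j.
by rewrite !mxE; apply: (hl (i, j)).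
Qed.

(** An ultrafilter containing GL_n(Z_p) selects, at each level M, one of the finitely many residue
    classes mod p^M; the selected classes are compatible and converge by completeness. *)
Lemma compact_GLint : compact (@GLint p R K n).
Proof.
rewrite compact_ultra => F FU FI.
have hF M : exists B : 'M[K]_n,
    mxle 1 B /\ F [set g | mxle (p%:R ^- M) (GLval g - B)].
  apply: contrapT => hn.
  have hC : F [set g | forall a : 'M['I_(p ^ M)]_n,
      ~ mxle (p%:R ^- M) (GLval g - resmx a)].
    apply: filter_forall => a.
    have [Fa|//] := in_ultra_setVsetC [set g | mxle (p%:R ^- M) (GLval g - resmx a)] FU.
    by case: hn; exists (resmx a); split=> //; apply: resmx_mxle1.
  have [g [[g1 _] hg]] := filter_ex (filterI FI hC).
  by have [a ha] := resmx_exists p_pr M g1; apply: (hg a).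
have [a /all_and2[a1 ha]] := choice hF.
have [M M' MM|L hL] := mx_cauchy_lim (A := a).
  have [g [h1 h2]] := filter_ex (filterI (ha M) (ha M')).
  apply: mxle_dist_trans (GLval g) _ _ _ _.
    by apply/mxle_distC/(mxle_trans h2)/pexpN_le.
  exact: h1.
have L1 : mxle 1 L.
  rewrite -(subKr (a 0) L); apply: mxleB; first exact: a1.
  by have := hL 0; rewrite expr0 invr1.
have Ld : pabs (\det L) = 1.
  have [g [[g1 gd] hg]] := filter_ex (filterI FI (ha 1)).
  apply: (mxle_cong_det1 p_pr (ltn0Sn 0) g1 L1 _ gd).
  exact: mxle_dist_trans hg (hL 1).
have Lu := pabs_det1_unit Ld; have LE := toGLK Lu.
have LI : GLint (toGL L) by split; rewrite LE.
exists (toGL L); split=> // U; rewrite nbhsE => -[B [oB BL] BU].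
have [M M0 MB] := (open_cosetP p_pr _).1 oB _ BL.
apply: filterS (filterI FI (ha M)) => g [gI hg]; apply/BU/MB.
by apply/(pcong_GLintP p_pr _ M0 LI); rewrite LE; apply: mxle_dist_trans hg (hL M).
Qed.

Lemma mule_EFinI (r : R) (x y : \bar R) : 0 < r ->
  (r%:E * x = r%:E * y -> x = y)%E.
Proof.
move=> r0 e; rewrite -[x]mul1e -[y]mul1e -(mulVf (lt0r_neq0 r0)) EFinM -!muleA.
by rewrite e.
Qed.

Lemma pcong1_measure (m : {measure set (borel (GL K n)) -> \bar R}) M :
  left_invariant m -> (0 < M)%N ->
  m (pcong 1) = (#|reps M (@pcong p R K n 1)|%:R%:E * m (pcong M))%E /\
  (0 < #|reps M (@pcong p R K n 1)|)%N.
Proof.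
move=> lm M0; have s1 := pcong_subgroup p_pr (ltn0Sn 0) (K := K) (n := n).
have I1 := pcong_GLint p_pr (ltn0Sn 0) (K := K) (n := n).
have M1 := @pcong_le p R K n p_pr _ _ M0.
split; first exact: (subgroup_measure p_pr lm M0 s1 I1 M1).
have [a ra _] := reps_cover p_pr M0 s1 I1 M1 (let: And3 x _ _ := s1 in x).
by apply/card_gt0P; exists a.
Qed.

(** K(1) is a finite disjoint union of cosets of K(M), so its measure determines that of K(M) and of
    every coset; with the empty set the cosets form a pi-system generating the Borel sets. *)
Lemma left_invariant_unique (m1 m2 : {measure set (borel (GL K n)) -> \bar R}) :
  left_invariant m1 -> left_invariant m2 ->
  (m1 (pcong 1) < +oo)%E -> m1 (pcong 1) = m2 (pcong 1) ->
  forall A : set (borel (GL K n)), measurable A -> m1 A = m2 A.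
Proof.
move=> l1 l2 f1 e1.
have eM M : (0 < M)%N -> m1 (pcong M) = m2 (pcong M).
  move=> M0; have [h1 N0] := pcong1_measure l1 M0.
  have [h2 _] := pcong1_measure l2 M0.
  by apply: (@mule_EFinI #|reps M (@pcong p R K n 1)|%:R); rewrite ?ltr0n // -h1 -h2.
have [q hq] := rational_coset (K := K) (n := n) p_pr.
apply: (@measure_unique _ _ (borel (GL K n)) [set A | A = set0 \/ exists M g, (0 < M)%N /\ A = coset M g]
  (fun i => coset 1 (q i))).
- exact: borel_generated.
- move=> A B [->|[M [g [M0 ->]]]]; first by move=> _; rewrite set0I; left.
  move=> [->|[M' [g' [M'0 ->]]]]; first by rewrite setI0; left.
  have [->|/set0P[x [gx g'x]]] := eqVneq (coset M g `&` coset M' g') set0.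
    by left.
  (* Cosets sharing a point x are nested, so their intersection is the one of larger level. *)
  right; exists (maxn M M'), x; split; first by rewrite leq_max M0.
  rewrite (coset_eq p_pr M0 gx) (coset_eq p_pr M'0 g'x).
  have [MM|/ltnW MM] := leqP M M'.
    by rewrite setIC setIidl //; apply: coset_le.
  by rewrite setIidl //; apply: coset_le.
- by move=> i; right; exists 1, (q i).
- apply/seteqP; split => // g _; have [i gi] := hq 1 g; exists i => //.
  by rewrite -(coset_eq p_pr _ gi) //; apply: coset_refl.
- move=> _ [->|[M [g [M0 ->]]]]; first by rewrite !measure0.
  by rewrite !(left_invariant_coset p_pr) // eM.
- by move=> i; rewrite (left_invariant_coset p_pr).
Qed.

Lemma open_lmul g A : open A -> open [set x | A (g * x)%g].
Proof.
move=> /(open_cosetP p_pr) oU; apply/(open_cosetP p_pr) => x /= /oU[M M0 MU].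
exists M => // y xy; apply: MU; move: xy; rewrite /coset /=.
by rewrite invMg -mulgA mulKg.
Qed.

Lemma measurable_lmul g : measurable_fun [set: borel (GL K n)]
  (fun x : borel (GL K n) => (g * (x : GL K n))%g : borel (GL K n)).
Proof.
apply: (@measurability _ _ (borel (GL K n)) (borel (GL K n)) _ _ (@open (GL K n))) => // _ [U oU <-].
by rewrite setTI; apply: (@open_measurable _ _ K n [set x | U (g * x)%g]); apply: open_lmul.
Qed.

Lemma pcong_conj_exists M g : exists2 N, (0 < N)%N &
  forall k, pcong N k -> pcong M (g^-1 * k * g)%g.
Proof.
have [N1 h1] := coset_ball p_pr M g; have [N2 h2] := GL_bounded p_pr g.
exists (N2 + N1).+1 => // k kN; rewrite -mulgA; apply: h1.
have pN : (p%:R : K) ^+ N2 != 0 by rewrite expf_neq0 // padicp_neq0.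
have -> : GLval (k * g)%g - GLval g =
    (p%:R ^- N2 *: (GLval k - 1%:M)) *m (p%:R ^+ N2 *: GLval g).
  rewrite -scalemxAl -scalemxAr scalerA mulVf // scale1r mulmxBl mul1mx.
  by rewrite GLvalM.
apply: mxleM1r => //; apply: mxle_trans (mxleZ _ (pcong_le p_pr (leqnSn _) kN)) _.
rewrite pabsV pabs_pX // invrK exprD invfM mulrA mulfV ?mul1r //.
by rewrite gt_eqF // exprn_gt0 // ltr0n prime_gt0.
Qed.

Lemma open_rmul g A : open A -> open [set x | A (x * g)%g].
Proof.
move=> /(open_cosetP p_pr) oU; apply/(open_cosetP p_pr) => x /= /oU[M M0 MU].
have [N N0 hN] := pcong_conj_exists M g; exists N => // y /hN xy; apply: MU.
by move: xy; rewrite /coset /= invMg !mulgA.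
Qed.

Lemma measurable_rmul g : measurable_fun [set: borel (GL K n)]
  (fun x : borel (GL K n) => ((x : GL K n) * g)%g : borel (GL K n)).
Proof.
apply: (@measurability _ _ (borel (GL K n)) (borel (GL K n)) _ _ (@open (GL K n))) => // _ [U oU <-].
by rewrite setTI; apply: (@open_measurable _ _ K n [set x | U (x * g)%g]); apply: open_rmul.
Qed.

Lemma measurable_lpreim g (A : set (borel (GL K n))) : measurable A ->
  measurable ([set x | A (g * x)%g] : set (borel (GL K n))).
Proof.
move=> mA; have := measurable_lmul g measurableT mA.
by rewrite setTI.
Qed.

Lemma measurable_rpreim g (A : set (borel (GL K n))) : measurable A ->
  measurable ([set x | A (x * g)%g] : set (borel (GL K n))).
Proof.
move=> mA; have := measurable_rmul g measurableT mA.
by rewrite setTI.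
Qed.

Lemma haar_left_invariant (mu : {measure set (borel (GL K n)) -> \bar R}) :
  haar_measure mu -> left_invariant mu.
Proof.
move=> [hl _ _] g A mA; rewrite -(hl g^-1%g A mA); congr (mu _).
apply/seteqP; split => [x Ax|_ [x Ax <-]] /=; last by rewrite mulKVg.
by exists (g * x)%g => //; rewrite mulKg.
Qed.

Variable mu : {measure set (borel (GL K n)) -> \bar R}.
Hypothesis mu_haar : haar_measure mu.

Lemma haar_GLint_fin : (mu (@GLint p R K n) < +oo)%E.
Proof. by have [_ hc _] := mu_haar; apply/hc/compact_GLint. Qed.

Lemma haar_pcong_fin M : (0 < M)%N -> (mu (@pcong p R K n M) < +oo)%E.
Proof.
move=> M0; apply: le_lt_trans haar_GLint_fin; apply: le_measure.
- by rewrite inE; apply: measurable_pcong.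
- rewrite inE; apply: open_measurable; apply: (rinvariant_open p_pr M0) => g k gI kM.
  have [_ IM _] := GLint_subgroup (K := K) (n := n); apply: IM => //.
  exact: pcong_GLint kM.
- exact: pcong_GLint.
Qed.

Lemma haar_pcong_gt0 M : (0 < M)%N -> (0 < mu (@pcong p R K n M))%E.
Proof.
move=> M0; have [_ _ ho] := mu_haar; apply: ho.
  by rewrite pcong_coset; apply: open_coset.
by exists 1%g; have [] := pcong_subgroup p_pr M0 (K := K) (n := n).
Qed.

Let rmeas g := pushforward_measure mu (measurable_rmul g).

Let rmeasE g A : rmeas g A = mu [set x | A (x * g)%g]. Proof. by []. Qed.

Let fin (x : \bar R) : (0 < x)%E -> (x < +oo)%E -> exists2 r : R, 0 < r & x = r%:E.
Proof. by case: x => [r| |] //; rewrite lte_fin => r0 _; exists r. Qed.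

Lemma rmul_left_invariant g : left_invariant (rmeas g).
Proof.
move=> h A mA; rewrite !rmeasE.
rewrite -[RHS](haar_left_invariant mu_haar h); last exact: measurable_rpreim.
by congr (mu _); apply/seteqP; split => x /=; rewrite mulgA.
Qed.

(** By finiteness of the index K(1) may be replaced by a small K(M); and K(M) g^-1 is a left
    translate of g K(M) g^-1, which lies in K(1). *)
Lemma rmul_pcong1_fin g : (rmeas g (pcong 1) < +oo)%E.
Proof.
have [M M0 hM] := pcong_conj_exists 1 g^-1%g.
have [-> _] := pcong1_measure (rmul_left_invariant g) M0.
suff h : (rmeas g (pcong M) < +oo)%E.
  by apply: lte_mul_pinfty => //; rewrite lee_fin.
rewrite rmeasE -(haar_left_invariant mu_haar g^-1%g); last first.
  by apply: measurable_rpreim; apply: measurable_pcong.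
apply: le_lt_trans (haar_pcong_fin (ltn0Sn 0)); apply: le_measure.
- rewrite inE; apply: open_measurable.
  suff -> : [set x | [set x | pcong M (x * g)%g] (g^-1 * x)%g] =
      [set x | [set y | (pcong M) (g^-1 * y)%g] (x * g)%g].
    apply: open_rmul; exact: open_coset.
  by apply/seteqP; split => x /=; rewrite mulgA.
- by rewrite inE; apply: measurable_pcong.
- by move=> x /= /hM; rewrite invgK mulgA mulKVg mulgK.
Qed.

Lemma rmul_pcong1_gt0 g : (0 < rmeas g (pcong 1))%E.
Proof.
have [_ _ ho] := mu_haar; rewrite rmeasE; apply: ho.
  by apply: open_rmul; rewrite pcong_coset; apply: open_coset.
exists g^-1%g; rewrite /= mulVg.
by have [] := pcong_subgroup p_pr (ltn0Sn 0) (K := K) (n := n).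
Qed.

(* Uniqueness of Haar measure, applied to the right translate of mu by g. *)
Lemma rmul_modulus g : exists2 c : R, 0 < c &
  forall A : set (borel (GL K n)), measurable A ->
    mu [set x | A (x * g)%g] = (c%:E * mu A)%E.
Proof.
have [a a0 ha] := fin (rmul_pcong1_gt0 g) (rmul_pcong1_fin g).
have [b b0 hb] := fin (haar_pcong_gt0 (ltn0Sn 0)) (haar_pcong_fin (ltn0Sn 0)).
have c0 : 0 < a / b by rewrite divr_gt0.
exists (a / b) => // A mA; rewrite -rmeasE.
pose m2 : {measure set (borel (GL K n)) -> \bar R} := mscale (NngNum (ltW c0)) mu.
apply: (@left_invariant_unique (rmeas g) m2) => //.
- exact: rmul_left_invariant.
- move=> h B mB; rewrite /m2 /mscale /=; congr (_ * _)%E.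
  exact: haar_left_invariant.
- by rewrite ha ltry.
- transitivity ((a / b)%:E * mu (pcong 1))%E => //.
  by rewrite ha hb -EFinM divfK // gt_eqF.
Qed.

Definition right_stable g := forall A : set (borel (GL K n)), measurable A ->
  mu [set x | A (x * g)%g] = mu A.

(** K(1) is normal in GL_n(Z_p), so the translated measure agrees with [mu] on K(1), and uniqueness
    applies. *)
Lemma right_stable_GLint g : GLint g -> right_stable g.
Proof.
move=> gI A mA; rewrite -rmeasE; apply: left_invariant_unique => //.
- exact: rmul_left_invariant.
- exact: haar_left_invariant.
- exact: rmul_pcong1_fin.
rewrite rmeasE -(haar_left_invariant mu_haar g^-1%g); last first.
  by apply: measurable_rpreim; apply: measurable_pcong.
have [_ _ IV] := GLint_subgroup (K := K) (n := n).
congr (mu _); apply/seteqP; split => x /=.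
  move=> /(pcong_conj p_pr (ltn0Sn 0) gI).
  by rewrite !mulgA mulgV mul1g mulgK.
by move=> /(pcong_conj p_pr (ltn0Sn 0) (IV _ gI)); rewrite invgK.
Qed.

Lemma right_stable_central g : (forall x, x * g = g * x)%g -> right_stable g.
Proof.
move=> gC A mA; rewrite -[RHS](haar_left_invariant mu_haar g) //.
by congr (mu _); apply/seteqP; split => x /=; rewrite gC.
Qed.

(* The modulus is a homomorphism to a commutative group, trivial on w and z. *)
Lemma right_stable_flip g w z : right_stable w -> right_stable w^-1%g ->
  right_stable z -> (w * g * w^-1 = z * g^-1)%g -> right_stable g.
Proof.
move=> sw swV sz e; have [c c0 hc] := rmul_modulus g.
have mr h (A : set (borel (GL K n))) : measurable A ->
    measurable ([set x | A (x * h)%g] : set (borel (GL K n))).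
  exact: measurable_rpreim.
have h1 (A : set (borel (GL K n))) : measurable A ->
    mu [set x | A (x * (w * g * w^-1))%g] = (c%:E * mu A)%E.
  move=> mA; rewrite (_ : [set _ | _] = [set x | [set y | [set t | A (t * w^-1)%g]
     (y * g)%g] (x * w)%g]); last by apply/seteqP; split => x /=; rewrite !mulgA.
  rewrite sw; last by apply: (mr g [set t | _]); apply: mr.
  by rewrite (hc [set t | A (t * w^-1)%g]) ?swV //; apply: mr.
(* As z has modulus 1, [h1] says that g^-1 scales the measure by the same c as g; composing the two
   gives c^2 = 1. *)
have c1 : c * c = 1.
  have mP := measurable_pcong (K := K) (n := n) p_pr (ltn0Sn 0).
  have h2 : (mu (pcong 1) = (c * c)%:E * mu (pcong 1))%E.
    rewrite EFinM -muleA -hc // -h1; last exact: mr.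
    rewrite -(sz (pcong 1)) //; congr (mu _).
    by apply/seteqP; split => x /=; rewrite e mulgA mulgKV.
  move: h2; have [b b0 ->] := fin (haar_pcong_gt0 (ltn0Sn 0)) (haar_pcong_fin (ltn0Sn 0)).
  by move=> [h2]; apply: (mulIf (lt0r_neq0 b0)); rewrite mul1r.
have {}c1 : c = 1 by nra.
by move=> A mA; rewrite hc // c1 mul1e.
Qed.

End haar_invariance.

(** * Complex-valued integrals *)

Section complex_modulus.
Context {R : realType}.
Implicit Types z w : R[i].

Lemma Re_add z w : complex.Re (z + w) = complex.Re z + complex.Re w.
Proof. by case: z; case: w. Qed.

Lemma Im_add z w : complex.Im (z + w) = complex.Im z + complex.Im w.
Proof. by case: z; case: w. Qed.

Lemma Re_mul z w : complex.Re (z * w) =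
  complex.Re z * complex.Re w - complex.Im z * complex.Im w.
Proof. by case: z; case: w. Qed.

Lemma Im_mul z w : complex.Im (z * w) =
  complex.Re z * complex.Im w + complex.Im z * complex.Re w.
Proof. by case: z; case: w. Qed.

Lemma normc_ge0 z : 0 <= normc z.
Proof. by case: z => a b; apply: sqrtr_ge0. Qed.

Lemma normc_Re z : `|complex.Re z| <= normc z.
Proof.
case: z => a b /=; rewrite -sqrtr_sqr ler_wsqrtr // lerDl; exact: sqr_ge0.
Qed.

Lemma normc_Im z : `|complex.Im z| <= normc z.
Proof.
case: z => a b /=; rewrite -sqrtr_sqr ler_wsqrtr // lerDr; exact: sqr_ge0.
Qed.

Lemma normcD_le z w : normc (z + w) <= normc z + normc w.
Proof. exact: le_normcD. Qed.

Lemma normc_sum_le (I : Type) (r : seq I) (P : pred I) (F : I -> R[i]) :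
  normc (\sum_(i <- r | P i) F i) <= \sum_(i <- r | P i) normc (F i).
Proof.
elim/big_ind2: _ => [|x a y b xa yb|//]; first by rewrite normc0.
by rewrite (le_trans (normcD_le _ _)) // lerD.
Qed.

Lemma normcX z k : normc (z ^+ k) = normc z ^+ k.
Proof. by elim: k => [|k IH]; rewrite ?expr0 ?normc1 // !exprS normcM IH. Qed.

Lemma normc_prod (I : Type) (r : seq I) (P : pred I) (F : I -> R[i]) :
  normc (\prod_(i <- r | P i) F i) = \prod_(i <- r | P i) normc (F i).
Proof. by apply: (big_morph _ (@normcM R) (@normc1 R)). Qed.

Lemma normc_real (x : R) : normc (x%:C)%C = `|x|.
Proof. by rewrite /= expr0n addr0 sqrtr_sqr. Qed.

Lemma normc_root_of_unity z k : (0 < k)%N -> z ^+ k = 1 -> normc z = 1.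
Proof.
move=> k0 zk; have : normc z ^+ k = 1 by rewrite -normcX zk normc1.
by move=> /eqP; rewrite pexpr_eq1 ?normc_ge0 // => /eqP.
Qed.

End complex_modulus.

Section complex_integration.
Context {d : measure_display} {T : measurableType d} {R : realType}.
Variable mu : {measure set T -> \bar R}.
Implicit Types (f g : T -> R[i]) (D : set T).

Definition cmeasurable f :=
  measurable_fun setT (fun x => complex.Re (f x)) /\
  measurable_fun setT (fun x => complex.Im (f x)).

Lemma cintegrable_bound f (b : T -> \bar R) : cmeasurable f ->
  measurable_fun setT b ->
  (forall x, ((normc (f x))%:E <= b x)%E) -> (\int[mu]_x b x < +oo)%E ->
  cintegrable mu setT f.
Proof.
move=> [mR mI] mb fb bfin.
have b0 x : (0 <= b x)%E by apply: le_trans (fb x); rewrite lee_fin normc_ge0.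
have ib : mu.-integrable setT b.
  apply/integrableP; split=> //.
  by under eq_integral do rewrite gee0_abs //.
split; apply: (le_integrable measurableT _ _ ib) => [|x _];
  do ?exact/measurable_EFinP.
- by rewrite (gee0_abs (b0 x)) (le_trans _ (fb x)) // lee_fin normc_Re.
- by rewrite (gee0_abs (b0 x)) (le_trans _ (fb x)) // lee_fin normc_Im.
Qed.

Lemma cintegral_ext D f g : {in D, f =1 g} -> cintegral mu D f = cintegral mu D g.
Proof. by move=> fg; congr (_ +i* _)%C; apply: eq_Rintegral => x xD; rewrite fg. Qed.

Lemma cintegrableD f g : cintegrable mu setT f -> cintegrable mu setT g ->
  cintegrable mu setT (fun x => f x + g x).
Proof.
move=> [f1 f2] [g1 g2]; split.
  rewrite (_ : (fun x => _) = (fun x => (complex.Re (f x))%:E + (complex.Re (g x))%:E)%E).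
    exact: integrableD.
  by apply/funext => x; rewrite Re_add EFinD.
rewrite (_ : (fun x => _) = (fun x => (complex.Im (f x))%:E + (complex.Im (g x))%:E)%E).
  exact: integrableD.
by apply/funext => x; rewrite Im_add EFinD.
Qed.

Lemma cintegralD f g : cintegrable mu setT f -> cintegrable mu setT g ->
  cintegral mu setT (fun x => f x + g x) = cintegral mu setT f + cintegral mu setT g.
Proof.
move=> [f1 f2] [g1 g2]; rewrite /cintegral.
rewrite (_ : (fun x => complex.Re _) = (fun x => complex.Re (f x) + complex.Re (g x))).
  rewrite (_ : (fun x => complex.Im _) = (fun x => complex.Im (f x) + complex.Im (g x))).
    by rewrite !RintegralD.
  by apply/funext => x; rewrite Im_add.
by apply/funext => x; rewrite Re_add.
Qed.

Lemma cintegrableZ c f : cintegrable mu setT f -> cintegrable mu setT (fun x => c * f x).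
Proof.
move=> [f1 f2]; split.
  rewrite (_ : (fun x => _) = (fun x => (complex.Re c)%:E * (complex.Re (f x))%:E
      + (- complex.Im c)%:E * (complex.Im (f x))%:E)%E).
    by apply: integrableD => //; apply: integrableZl.
  by apply/funext => x; rewrite Re_mul -!EFinM -EFinD mulNr.
rewrite (_ : (fun x => _) = (fun x => (complex.Re c)%:E * (complex.Im (f x))%:E
    + (complex.Im c)%:E * (complex.Re (f x))%:E)%E).
  by apply: integrableD => //; apply: integrableZl.
by apply/funext => x; rewrite Im_mul EFinD !EFinM.
Qed.

Lemma cintegralZ c f : cintegrable mu setT f ->
  cintegral mu setT (fun x => c * f x) = c * cintegral mu setT f.
Proof.
move=> [f1 f2]; rewrite /cintegral.
have iZ (r : R) h : mu.-integrable setT (EFin \o h) ->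
    mu.-integrable setT (EFin \o (fun x => r * h x)).
  move=> ih; rewrite (_ : _ \o _ = (fun x => r%:E * (h x)%:E)%E).
    exact: integrableZl.
  by apply/funext => x /=; rewrite EFinM.
apply/eqP; rewrite eq_complex Re_mul Im_mul /=; apply/andP; split; apply/eqP.
  transitivity (\int[mu]_x (complex.Re c * complex.Re (f x)
      + - complex.Im c * complex.Im (f x))).
    by apply: eq_Rintegral => x _; rewrite Re_mul mulNr.
  rewrite RintegralD //; do ?exact: iZ.
  by rewrite !RintegralZl // mulNr.
transitivity (\int[mu]_x (complex.Re c * complex.Im (f x)
    + complex.Im c * complex.Re (f x))).
  by apply: eq_Rintegral => x _; rewrite Im_mul.
rewrite RintegralD //; do ?exact: iZ.
by rewrite !RintegralZl.
Qed.

Lemma cintegrable0 : cintegrable mu setT (fun=> 0).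
Proof. by split; apply: integrable0. Qed.

Lemma cintegral0 : cintegral mu setT (fun=> 0) = 0.
Proof. by rewrite /cintegral !Rintegral_cst // !mul0r. Qed.

Lemma cintegral_sum (I : Type) (r : seq I) (P : pred I) (F : I -> T -> R[i]) :
  (forall i, P i -> cintegrable mu setT (F i)) ->
  cintegrable mu setT (fun x => \sum_(i <- r | P i) F i x) /\
  cintegral mu setT (fun x => \sum_(i <- r | P i) F i x) =
  \sum_(i <- r | P i) cintegral mu setT (F i).
Proof.
move=> iF; elim: r => [|i r [IH1 IH2]].
  rewrite big_nil; under eq_fun do rewrite big_nil.
  by split; [exact: cintegrable0|exact: cintegral0].
rewrite big_cons; under eq_fun do rewrite big_cons.
case: ifPn => // Pi; split; first by apply: cintegrableD => //; exact: iF.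
by rewrite cintegralD ?IH2 //; exact: iF.
Qed.

Lemma cintegral_indicator A c : measurable A -> (mu A < +oo)%E ->
  cintegrable mu setT (fun x => if x \in A then c else 0) /\
  cintegral mu setT (fun x => if x \in A then c else 0) = c * (fine (mu A))%:C%C.
Proof.
move=> mA fA.
have i1 : mu.-integrable setT (EFin \o (\1_A : T -> R)).
  apply/integrableP; split; first exact/measurable_EFinP/measurable_indic.
  under eq_integral do rewrite gee0_abs ?lee_fin //.
  by rewrite integral_indic // setIT.
have e1 x : (if x \in A then c else 0) = c * (\1_A x : R)%:C%C.
  by rewrite indicE; case: (x \in A); rewrite ?mulr1 ?mulr0.
have i2 : cintegrable mu setT (fun x => (\1_A x : R)%:C%C).
  by split=> //; apply: integrable0.
split; first by under eq_fun do rewrite e1; apply: cintegrableZ.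
under eq_fun do rewrite e1; rewrite cintegralZ //; congr (_ * _).
rewrite /cintegral /= Rintegral_cst // mul0r; congr (_ +i* _)%C.
by rewrite /Rintegral integral_indic // setIT.
Qed.

Lemma cintegral_restrict D f : cintegral mu D f =
  cintegral mu setT (fun x => if x \in D then f x else 0).
Proof.
rewrite /cintegral !(Rintegral_mkcond _ D); congr (_ +i* _)%C;
  by apply: eq_Rintegral => x _; rewrite patchE; case: ifP.
Qed.

Section change_of_variables.
Variable phi : T -> T.
Hypothesis mphi : measurable_fun setT phi.
Hypothesis mu_phi : forall A, measurable A -> mu (phi @^-1` A) = mu A.

Lemma integral_pushforward_preserved (f : T -> \bar R) :
  (\int[pushforward mu phi]_x f x = \int[mu]_x f x)%E.
Proof.
have := @eq_measure_integral _ _ _ setT mu (pushforward_measure mu mphi) f.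
by apply=> A mA _; exact: mu_phi.
Qed.

Lemma ge0_integral_preserved (f : T -> \bar R) : measurable_fun setT f ->
  (forall x, (0 <= f x)%E) -> (\int[mu]_x f (phi x) = \int[mu]_x f x)%E.
Proof.
move=> mf f0; have := ge0_integral_pushforward mphi mu measurableT mf (fun x _ => f0 x).
rewrite preimage_setT => <-.
by apply: integral_pushforward_preserved.
Qed.

(** Integrability passes from the substituted function back to f: convergence of the zeta integral
    is established in the new variable. *)
Lemma integral_preserved (f : T -> R) : measurable_fun setT f ->
  mu.-integrable setT (fun x => (f (phi x))%:E) ->
  mu.-integrable setT (EFin \o f) /\ \int[mu]_x f (phi x) = \int[mu]_x f x.
Proof.
move=> mf iphi; have /integrableP[_ fphi] := iphi.
have mE : measurable_fun setT (EFin \o f) by exact/measurable_EFinP.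
have mA : measurable_fun setT (fun x => `|(f x)%:E|)%E.
  exact: (measurableT_comp _ mE).
have fi : mu.-integrable setT (EFin \o f).
  apply/integrableP; split => //.
  by rewrite -(ge0_integral_preserved mA) // => x; apply: abse_ge0.
split => //; rewrite /Rintegral; congr fine.
have := integral_pushforward mphi mE (mu := mu) (D := setT).
rewrite preimage_setT => /(_ iphi measurableT) <-.
exact: integral_pushforward_preserved.
Qed.

Lemma cintegral_preserved (f : T -> R[i]) : cmeasurable f ->
  cintegrable mu setT (fun x => f (phi x)) ->
  cintegrable mu setT f /\
  cintegral mu setT (fun x => f (phi x)) = cintegral mu setT f.
Proof.
move=> [mR mI] [iR iI].
have [iR' eR] := integral_preserved mR iR; have [iI' eI] := integral_preserved mI iI.
by split=> //; rewrite /cintegral eR eI.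
Qed.

Lemma cintegrable_comp (f : T -> R[i]) : cmeasurable f ->
  cintegrable mu setT f -> cintegrable mu setT (fun x => f (phi x)).
Proof.
have h (h : T -> R) : measurable_fun setT h -> mu.-integrable setT (EFin \o h) ->
    mu.-integrable setT (fun x => (h (phi x))%:E).
  move=> mh /integrableP[mE fh]; apply/integrableP; split.
    exact: (measurableT_comp mE).
  rewrite (ge0_integral_preserved (f := fun x => `|(h x)%:E|%E)) //.
  exact: (measurableT_comp _ mE).
by move=> [mR mI] [iR iI]; split; [exact: (h _ mR)|exact: (h _ mI)].
Qed.

End change_of_variables.
End complex_integration.

(** * Characters and Gauss sums *)

Section characters.
Context {p : nat} {R : realType} {K : padicFieldType p R}.
Hypothesis p_pr : prime p.

Let pX_gt0 M : 0 < p%:R ^+ M :> R.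
Proof. by rewrite exprn_gt0 // ltr0n prime_gt0. Qed.

Lemma unit_neq0 (x : K) : pabs x = 1 -> x != 0.
Proof. by move=> x1; rewrite -pabs_eq0 x1 oner_eq0. Qed.

Lemma residue_mulr_inj M (x : K) : pabs x = 1 ->
  exists2 rho : 'I_(p ^ M) -> 'I_(p ^ M), injective rho &
    forall a : 'I_(p ^ M), pabs (x * a%:R - (rho a)%:R) <= p%:R ^- M.
Proof.
move=> x1; have h (a : 'I_(p ^ M)) : exists b : 'I_(p ^ M), pabs (x * a%:R - b%:R) <= p%:R ^- M.
  by apply: padic_residue => //; rewrite pabsM x1 mul1r pabs_nat_le1.
have [rho hrho] := choice h; exists rho => // a b ab.
apply: (padic_residue_inj (K := K) p_pr).
have -> : a%:R - b%:R = x^-1 * (x * a%:R - x * b%:R) :> K.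
  by rewrite -mulrBr mulKf // unit_neq0.
apply: pabsM_le1; first by rewrite pabsV x1 invr1.
apply: pabs_dist_trans (hrho a) _; rewrite ab pabs_distC; exact: hrho.
Qed.

(** The finite counterpart of an integral over Z_p^x, for F periodic mod p^M. *)
Definition unit_sum (V : nmodType) M (F : K -> V) : V :=
  \sum_(a < p ^ M | pabs (a%:R : K) == 1) F a%:R.

Lemma unit_cong M (x y : K) : (0 < M)%N -> pabs x = 1 ->
  pabs (x - y) <= p%:R ^- M -> pabs y = 1.
Proof.
move=> M0 x1 xy; rewrite -x1; apply: pabs_dominant; rewrite x1.
apply: le_lt_trans xy _; have := @pexpN_lt p R p_pr 0 M.
by rewrite expr0 invr1 M0.
Qed.

Lemma unit_sum_mull (V : nmodType) M (F : K -> V) (x : K) : (0 < M)%N ->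
  (forall y z, pabs y = 1 -> pabs (y - z) <= p%:R ^- M -> F y = F z) ->
  pabs x = 1 -> unit_sum M (fun a => F (x * a)) = unit_sum M F.
Proof.
move=> M0 FM x1; have [rho rho_inj hrho] := residue_mulr_inj M x1.
rewrite /unit_sum [RHS](reindex_inj rho_inj) /=; apply: eq_big => [a|a /eqP a1].
  have xa : pabs (x * a%:R) = pabs (a%:R : K) by rewrite pabsM x1 mul1r.
  apply/eqP/eqP => h; first by apply: (unit_cong M0 _ (hrho a)); rewrite xa.
  by rewrite -xa; apply: (unit_cong M0 h); rewrite pabs_distC; apply: hrho.
by apply: FM (hrho a); rewrite pabsM x1 a1 mulr1.
Qed.

Section additive_character.
Variable psi : K -> R[i].
Hypothesis psi_std : std_addchar psi.

Let psiD : {morph psi : x y / x + y >-> x * y}. Proof. by case: psi_std. Qed.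

Lemma addchar_int x : pabs x <= 1 -> psi x = 1.
Proof. by case: psi_std => _ h _ /h. Qed.

Lemma addchar0 : psi 0 = 1.
Proof. by apply: addchar_int; rewrite pabs0. Qed.

Lemma addcharMn x k : psi (x * k%:R) = psi x ^+ k.
Proof.
elim: k => [|k IH]; first by rewrite mulr0 addchar0 expr0.
by rewrite -natr1 mulrDr mulr1 psiD IH exprSr.
Qed.

Lemma addchar_sum (I : Type) (r : seq I) (P : pred I) (F : I -> K) :
  psi (\sum_(i <- r | P i) F i) = \prod_(i <- r | P i) psi (F i).
Proof. exact: (big_morph psi psiD addchar0). Qed.

Lemma addchar_cong x y : pabs (x - y) <= 1 -> psi x = psi y.
Proof.
by move=> xy; rewrite -(subrK y x) psiD addchar_int // mul1r.
Qed.

(** Some p^N x is integral, so psi(x) is a root of unity. *)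
Lemma normc_addchar x : normc (psi x) = 1.
Proof.
have [N hN] := padic_bounded p_pr (fun _ : 'I_1 => x).
apply: (@normc_root_of_unity _ _ (p ^ N)); first by rewrite expn_gt0 prime_gt0.
by rewrite -addcharMn natrX mulrC addchar_int // (hN ord0).
Qed.

(** If psi(x) = 1, then psi is 1 at all integer multiples of c = p^l x, where |c| = p. These
    represent p^-1 Z_p modulo Z_p, so psi would be trivial on p^-1 Z_p. *)
Lemma addchar_neq1 x : 1 < pabs x -> psi x != 1.
Proof.
move=> x1; apply/eqP => px; have [_ _] := psi_std; apply => y y1.
have [l hl] := pabs_gt1_exp p_pr x1.
have x0 : x != 0 by rewrite -pabs_gt0 (lt_trans _ x1).
pose c := p%:R ^+ l * x.
have c0 : c != 0 by rewrite mulf_neq0 // expf_neq0 // padicp_neq0.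
have hc : pabs c = p%:R by rewrite pabsM pabs_pX // hl exprS mulrCA mulVf ?mulr1 // gt_eqF.
have hyc : pabs (y / c) <= 1.
  by rewrite pabsM pabsV hc ler_pdivrMr ?mul1r // ltr0n prime_gt0.
have [a ha] := padic_residue p_pr 1 hyc.
rewrite (@addchar_cong _ (x * (p ^ l * a)%:R)).
  by rewrite addcharMn px expr1n.
have -> : y - x * (p ^ l * a)%:R = c * (y / c - a%:R).
  by rewrite mulrBr mulrCA mulfV // mulr1 natrM natrX /c; ring.
rewrite pabsM hc -(@ler_pM2l _ p%:R^-1) ?invr_gt0 ?ltr0n ?prime_gt0 //.
by rewrite mulKf ?mulr1 // gt_eqF // ltr0n prime_gt0.
Qed.

(** If |c| > 1 this is a geometric sum whose ratio psi(c) differs from 1 and has p^M-th power 1. *)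
Lemma sum_addchar M c : pabs c <= p%:R ^+ M ->
  \sum_(a < p ^ M) psi (c * a%:R) = if pabs c <= 1 then (p ^ M)%:R else 0.
Proof.
move=> cM; case: ifPn => c1.
  rewrite (eq_bigr (fun=> 1)) ?sumr_const ?card_ord // => a _.
  by rewrite addchar_int // pabsMr_le1 ?pabs_nat_le1.
have /mulfI : psi c - 1 != 0 by rewrite subr_eq0 addchar_neq1 // ltNge.
apply; rewrite mulr0; under eq_bigr do rewrite addcharMn.
rewrite -subrX1 -addcharMn addchar_int ?subrr //.
by rewrite natrX pabsM pabs_pX // ler_pdivrMr ?mul1r.
Qed.

End additive_character.

Section multiplicative_character.
Variable chi : K -> R[i].
Hypothesis chi_char : mchar chi.

Let chi1 : chi 1 = 1. Proof. by case: chi_char. Qed.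

Lemma mcharM x y : x != 0 -> y != 0 -> chi (x * y) = chi x * chi y.
Proof. by case: chi_char => _; apply. Qed.

Lemma mchar_neq0 x : x != 0 -> chi x != 0.
Proof.
move=> x0; apply: contraTneq (oner_neq0 R[i]) => chix.
by rewrite -chi1 -(mulfV x0) mcharM ?invr_eq0 // chix mul0r eqxx.
Qed.

Lemma mcharX x k : x != 0 -> chi (x ^+ k) = chi x ^+ k.
Proof.
move=> x0; elim: k => [|k IH]; first by rewrite !expr0.
by rewrite !exprS mcharM ?IH // expf_neq0.
Qed.

Lemma mchar_prod (I : Type) (r : seq I) (F : I -> K) : (forall i, F i != 0) ->
  chi (\prod_(i <- r) F i) = \prod_(i <- r) chi (F i).
Proof.
move=> F0; elim: r => [|i r IH]; first by rewrite !big_nil.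
rewrite !big_cons mcharM ?IH //.
by elim/big_ind: _ => [|x y|j _]; [exact: oner_neq0|exact: mulf_neq0|exact: F0].
Qed.

Lemma mchar_cong b x y : (0 < b)%N -> trivial_on (punits b) chi ->
  pabs x = 1 -> pabs (x - y) <= p%:R ^- b -> chi x = chi y.
Proof.
move=> b0 chib x1 xy; have y1 := unit_cong b0 x1 xy.
have [x0 y0] := (unit_neq0 x1, unit_neq0 y1).
have : chi (x / y) = 1.
  apply: chib; split; first by rewrite pabsM pabsV x1 y1 divr1.
  have -> : x / y - 1 = y^-1 * (x - y) by rewrite mulrBr mulVf // mulrC.
  by apply: pabsM_le1 => //; rewrite pabsV y1 invr1.
move=> e; rewrite -{1}(divfK y0 x) mcharM ?e ?mul1r //.
by rewrite mulf_neq0 // invr_eq0.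
Qed.

Hypothesis chi_fin : finite_order chi.

Lemma normc_mchar x : x != 0 -> normc (chi x) = 1.
Proof.
by case: chi_fin => N N0 h /h; apply: normc_root_of_unity.
Qed.

End multiplicative_character.

Section gauss_sums.
Variables (psi chi : K -> R[i]) (b : nat).
Hypothesis psi_std : std_addchar psi.
Hypothesis chi_char : mchar chi.
Hypothesis chi_cond : conductor_exp chi b.
Hypothesis b0 : (0 < b)%N.

Lemma gauss_periodic M c x y : (b <= M)%N -> pabs c <= p%:R ^+ M -> pabs x = 1 ->
  pabs (x - y) <= p%:R ^- M -> chi x * psi (c * x) = chi y * psi (c * y).
Proof.
move=> bM cM x1 xy; congr (_ * _).
  apply: (mchar_cong chi_char b0 _ x1); first by case: chi_cond.
  by apply: le_trans xy _; apply: pexpN_le.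
apply: (addchar_cong psi_std); rewrite -mulrBr.
have -> : 1 = p%:R ^+ M * p%:R ^- M :> R by rewrite mulfV // gt_eqF.
exact: pabsM_le.
Qed.

(* Orthogonality: translating a by 1 + p^b Z_p kills the sum if |m| > 1,
   translating by a unit congruent to 1 mod p^(b-1) kills it if |m| < 1. *)
Lemma gauss_unit_sum M m : (b <= M)%N -> pabs (p%:R ^- b * m) <= p%:R ^+ M ->
  unit_sum M (fun a => chi a * psi (p%:R ^- b * m * a)) =
  if pabs m == 1 then (chi m)^-1 * unit_sum M (fun a => chi a * psi (p%:R ^- b * a)) else 0.
Proof.
move=> bM cM; have M0 : (0 < M)%N := leq_trans b0 bM.
have pb0 : (p%:R : K) ^+ b != 0 by rewrite expf_neq0 // padicp_neq0.
set c := _ * m in cM *; have per := gauss_periodic bM cM.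
have c_m : c = p%:R ^- b * m by [].
clearbody c; have m_c : m = p%:R ^+ b * c by rewrite c_m mulVKf.
case: ifPn => [/eqP m1|].
  have m0 := unit_neq0 m1.
  have bM' : pabs (p%:R ^- b : K) <= p%:R ^+ M.
    by rewrite pabsV pabs_pX // invrK ler_weXn2l // ler1n prime_gt0.
  rewrite -(unit_sum_mull (F := fun a => chi a * psi (p%:R ^- b * a)) M0
    (fun x y => gauss_periodic bM bM') m1) /unit_sum mulr_sumr.
  apply: eq_bigr => a /eqP a1; have a0 := unit_neq0 a1.
  by rewrite mcharM // !mulrA mulVf ?mchar_neq0 // mul1r c_m.
rewrite neq_lt => /orP[m1|m1].
  have [u [u1 ub] cu] : exists2 u, punits b.-1 u & chi u != 1.
    have [_ /(_ b.-1)] := chi_cond; rewrite prednK // => /(_ (leqnn _)) h.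
    apply: contrapT => hn; apply: h => u ub; apply/eqP.
    by apply: contrapT => /negP cu; apply: hn; exists u.
  set S := unit_sum _ _; have : S = chi u * S.
    rewrite /S -{1}(unit_sum_mull (F := fun a => chi a * psi (c * a)) M0 per u1) /unit_sum mulr_sumr.
    apply: eq_bigr => a /eqP a1; have [u0 a0] := (unit_neq0 u1, unit_neq0 a1).
    rewrite mcharM // -!mulrA; congr (_ * (_ * _)).
    apply: (addchar_cong psi_std).
    have -> : c * (u * a%:R) - c * a%:R = c * (u - 1) * a%:R by ring.
    apply: pabsMr_le1; last by rewrite a1.
    have -> : c * (u - 1) = p%:R ^- b * (m * (u - 1)) by rewrite c_m mulrA.
    have mp : pabs m <= p%:R ^- 1.
      by apply: pabs_lt_expN => //; rewrite expr0 invr1.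
    rewrite pabsM pabsV pabs_pX // invrK.
    apply: le_trans (ler_wpM2l (ltW (pX_gt0 b)) (pabsM_le mp ub)) _.
    by rewrite -invfM -exprD add1n prednK // mulfV // gt_eqF.
  move/eqP; rewrite -[X in X == _]mul1r -subr_eq0 -mulrBl mulf_eq0 subr_eq0.
  by rewrite eq_sym (negPf cu) => /eqP.
have pM0 : ((p ^ M)%:R : R[i]) != 0 by rewrite pnatr_eq0 -lt0n expn_gt0 prime_gt0.
apply: (mulfI pM0); rewrite mulr0.
set S := unit_sum _ _.
(* Replacing a by (1 + p^b d) a fixes chi(a) and inserts psi(m a d), because c p^b = m. Summing over
   d then brings in [sum_addchar]. *)
have hb (d : 'I_(p ^ M)) : S = unit_sum M (fun a => chi a * psi (c * a) * psi (m * a * d%:R)).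
  have u1 : pabs (1 + p%:R ^+ b * d%:R : K) = 1.
    apply: (@unit_cong b 1) => //; first exact: pabs1.
    by rewrite opprD addrA subrr add0r pabsN pabsMr_le1 ?pabs_nat_le1 ?pabs_pX.
  rewrite /S -(unit_sum_mull (F := fun a => chi a * psi (c * a)) M0 per u1) /unit_sum.
  apply: eq_bigr => a /eqP a1; have a0 := unit_neq0 a1.
  have -> : chi ((1 + p%:R ^+ b * d%:R) * a%:R) = chi a%:R.
    apply/esym; apply: (mchar_cong chi_char b0 _ a1); first by case: chi_cond.
    have -> : a%:R - (1 + p%:R ^+ b * d%:R) * a%:R = - (p%:R ^+ b * (d%:R * a%:R)) :> K.
      by ring.
    by rewrite pabsN pabsMr_le1 ?pabs_pX // -natrM pabs_nat_le1.
  rewrite -mulrA; congr (_ * _); have [psiD _ _] := psi_std; rewrite -psiD.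
  by congr (psi _); rewrite m_c; ring.
transitivity (\sum_(d < p ^ M) S).
  by rewrite sumr_const card_ord mulr_natl.
rewrite (eq_bigr _ (fun d _ => hb d)) /unit_sum exchange_big /= big1 // => a /eqP a1.
rewrite -mulr_sumr (sum_addchar psi_std).
  by rewrite pabsM a1 mulr1 leNgt m1 /= mulr0.
rewrite pabsM a1 mulr1 m_c; apply: pabsM_le1 => //.
by rewrite pabs_pX // pexpN_le1.
Qed.

End gauss_sums.
End characters.

Section haar_integrals.
Context {p : nat} {R : realType} {K : padicFieldType p R} {n : nat}.
Hypothesis p_pr : prime p.
Variable mu : {measure set (borel (GL K n)) -> \bar R}.
Hypothesis mu_haar : haar_measure mu.

Lemma rinvariant_cmeasurable M (f : GL K n -> R[i]) : (0 < M)%N -> rinvariant M f ->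
  cmeasurable (f : borel (GL K n) -> R[i]).
Proof.
move=> M0 fM; split.
  apply: (@rinvariant_measurable _ _ K n p_pr _ _ M (fun x => complex.Re (f x))) => //.
  by move=> g k Mk; rewrite fM.
apply: (@rinvariant_measurable _ _ K n p_pr _ _ M (fun x => complex.Im (f x))) => //.
by move=> g k Mk; rewrite fM.
Qed.

Lemma haar_translate (a x : GL K n) : right_stable mu x ->
  measurable_fun [set: borel (GL K n)]
    (fun g : borel (GL K n) => (a * (g : GL K n) * x)%g : borel (GL K n)) /\
  forall A : set (borel (GL K n)), measurable A ->
    mu ((fun g : borel (GL K n) => (a * (g : GL K n) * x)%g : borel (GL K n)) @^-1` A)
      = mu A.
Proof.
move=> sx; split.
  exact: (measurableT_comp (measurable_rmul p_pr x) (measurable_lmul p_pr a)).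
move=> A mA; rewrite -[RHS]sx // -[RHS](haar_left_invariant mu_haar a) //.
exact: measurable_rpreim.
Qed.

Lemma cintegral_translate (a x : GL K n) (f : GL K n -> R[i]) : right_stable mu x ->
  cmeasurable (f : borel (GL K n) -> R[i]) ->
  cintegrable mu setT (fun g => f (a * g * x)%g) ->
  cintegrable mu setT f /\
  cintegral mu setT (fun g => f (a * g * x)%g) = cintegral mu setT f.
Proof.
move=> /(haar_translate a)[m1 m2] mf fi.
exact: (cintegral_preserved m1 m2 mf fi).
Qed.

Lemma cintegral_rmul (x : GL K n) (f : GL K n -> R[i]) : GLint x ->
  cmeasurable (f : borel (GL K n) -> R[i]) -> cintegrable mu setT f ->
  cintegrable mu setT (fun g => f (g * x)%g) /\
  cintegral mu setT (fun g => f (g * x)%g) = cintegral mu setT f.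
Proof.
move=> xI mf fi.
have [m1 m2] := haar_translate 1%g (right_stable_GLint p_pr mu_haar xI).
have e : (fun g => f (g * x)%g) = (fun g => f (1 * g * x)%g).
  by apply/funext => g; rewrite mul1g.
have fx : cintegrable mu setT (fun g => f (1 * g * x)%g).
  exact: (cintegrable_comp m1 m2 mf fi).
rewrite e; split=> //; have [_ <-] := cintegral_preserved m1 m2 mf fx; by [].
Qed.

Lemma cintegrable_finite_support M (A : set (GL K n)) (f : GL K n -> R[i]) (B : R) :
  (0 < M)%N -> rinvariant M f ->
  measurable (A : set (borel (GL K n))) -> (mu A < +oo)%E -> 0 <= B ->
  (forall g, A g -> normc (f g) <= B) -> (forall g, ~ A g -> f g = 0) ->
  cintegrable mu setT f.
Proof.
move=> M0 fM mA fA B0 fB f0.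
apply: (@cintegrable_bound _ _ _ mu f (fun x => (B * \1_A x)%:E)).
- exact: rinvariant_cmeasurable fM.
- apply/measurable_EFinP; apply: measurable_funM => //.
- move=> x; rewrite lee_fin indicE; case: (boolP (x \in A)) => xA.
    by rewrite mulr1 fB //; move: xA; rewrite inE.
  by rewrite mulr0 f0 ?normc0 // => Ax; move: xA; rewrite notin_setE.
- under eq_integral do rewrite EFinM.
  rewrite ge0_integralZl_EFin //.
    by rewrite integral_indic // setIT lte_mul_pinfty // lee_fin.
  by apply/measurable_EFinP.
Qed.

Lemma measurable_GLint : measurable (@GLint p R K n : set (borel (GL K n))).
Proof.
apply: open_measurable; apply: (rinvariant_open p_pr (ltn0Sn 0)) => g k gI kM.
have [_ IM _] := GLint_subgroup (K := K) (n := n); apply: IM => //.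
exact: pcong_GLint kM.
Qed.

End haar_integrals.

(** * The Gauss sum as a finite sum over units *)

Section gauss_sum_evaluation.
Context {p : nat} {R : realType} {K : padicFieldType p R}.
Hypothesis p_pr : prime p.
Variables (psi chi : K -> R[i]) (b : nat).
Hypothesis psi_std : std_addchar psi.
Hypothesis chi_char : mchar chi.
Hypothesis chi_fin : finite_order chi.
Hypothesis chi_cond : conductor_exp chi b.
Hypothesis b0 : (0 < b)%N.
Variable dc : {measure set (borel (GL K 1)) -> \bar R}.
Hypothesis dc_haar : haar_measure dc.
Hypothesis dc_mass : dc GLint = 1%E.

Lemma GL1_entryM (g h : GL K 1) : (g * h)%g ord0 ord0 = g ord0 ord0 * h ord0 ord0.
Proof. by rewrite GLvalM mxE big_ord1. Qed.

Lemma GL1_GLint (g : GL K 1) : GLint g <-> pabs (g ord0 ord0) = 1.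
Proof.
have dE : \det g = g ord0 ord0 by rewrite det_mx11.
split=> [[_]|g1]; first by rewrite dE.
by split=> [i j|]; rewrite ?dE // !ord1 g1.
Qed.

(** Summing the integrand over its translates by the units mod p^M gives, by [unit_sum_mull], a
    constant on Z_p^x, whose mass is 1. The factor on the left counts the translates. *)
Lemma gauss_sum_unit_sum M : (b <= M)%N ->
  gauss_sum psi dc chi b * unit_sum M (fun _ : K => 1) =
  p%:R ^+ b * (1 - p%:R^-1) * unit_sum M (fun a => chi a * psi (p%:R ^- b * a)).
Proof.
move=> bM; rewrite /gauss_sum -!mulrA; congr (_ * (_ * _)).
have M0 : (0 < M)%N := leq_trans b0 bM.
pose F (x : K) := chi x * psi (p%:R ^- b * x).
pose H (c : GL K 1) := if c \in GLint then F (c ord0 ord0) else 0.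
have [_ IM IV] := GLint_subgroup (K := K) (n := 1).
have bp : pabs (p%:R ^- b : K) <= p%:R ^+ M.
  by rewrite pabsV pabs_pX // invrK ler_weXn2l // ler1n prime_gt0.
have FM := gauss_periodic p_pr psi_std chi_char chi_cond b0 bM bp.
have H_M : rinvariant M H.
  move=> g k Mk; have kI := pcong_GLint p_pr M0 Mk; rewrite /H.
  have [|gI] := boolP (g \in GLint).
    rewrite inE => gI; rewrite mem_set; last exact: IM.
    have /GL1_GLint g1 := gI; apply/esym/FM => //.
    rewrite GL1_entryM -{1}(mulr1 (g ord0 ord0)) -mulrBr.
    rewrite pabsM g1 mul1r pabs_distC.
    by have := Mk ord0 ord0; rewrite !mxE.
  rewrite ifN //; apply: contra gI; rewrite !inE => gI.
  by rewrite -(mulgK k g); apply: IM => //; apply: IV.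
have Hm : cmeasurable (H : borel (GL K 1) -> R[i]) by exact: rinvariant_cmeasurable H_M.
have Hi : cintegrable dc setT H.
  apply: (cintegrable_finite_support p_pr M0 H_M (measurable_GLint p_pr) _ ler01).
  - by rewrite dc_mass ltry.
  - move=> g gI; rewrite /H mem_set // normcM normc_mchar ?normc_addchar ?mulr1 //.
    by apply: unit_neq0; apply/GL1_GLint.
  - by move=> g gI; rewrite /H memNset.
rewrite cintegral_restrict -/H.
have kE (a : 'I_(p ^ M)) : pabs (a%:R : K) == 1 ->
    GLint (toGL a%:R%:M : GL K 1) /\ (toGL a%:R%:M : GL K 1) ord0 ord0 = a%:R.
  move=> /eqP a1; have E : (toGL a%:R%:M : GL K 1) ord0 ord0 = a%:R.
    rewrite toGLK; first by rewrite mxE eqxx mulr1n.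
    by rewrite unitmxE det_scalar1 unitfE unit_neq0.
  by split=> //; apply/GL1_GLint; rewrite E.
transitivity (\sum_(a < p ^ M | pabs (a%:R : K) == 1)
    cintegral dc setT (fun c => H (c * toGL a%:R%:M)%g)).
  rewrite /unit_sum mulr_sumr; apply: eq_bigr => a /kE[aI _].
  by rewrite mulr1; have [_ ->] := cintegral_rmul p_pr dc_haar aI Hm Hi.
have := @cintegral_sum _ _ _ dc _ (index_enum 'I_(p ^ M)) (fun a => pabs (a%:R : K) == 1)
  (fun a c => H (c * toGL a%:R%:M)%g).
case; first by move=> a /kE[aI _]; have [] := cintegral_rmul p_pr dc_haar aI Hm Hi.
move=> _ <-.
transitivity (cintegral dc setT
    (fun c => if c \in GLint then unit_sum M F else 0)); last first.
  have [|_ ->] := cintegral_indicator (mu := dc) (unit_sum M F) (measurable_GLint p_pr).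
    by rewrite dc_mass ltry.
  by rewrite dc_mass /= mulr1.
apply: cintegral_ext => c _; case: ifPn => cI.
  rewrite inE in cI; have /GL1_GLint c1 := cI.
  rewrite -(unit_sum_mull p_pr M0 FM c1) /unit_sum; apply: eq_bigr => a /kE[aI aE].
  by rewrite /H mem_set ?GL1_entryM ?aE //; apply: IM.
rewrite big1 // => a /kE[aI aE]; rewrite /H ifN //.
apply: contra cI; rewrite !inE => cI.
by rewrite -(mulgK (toGL a%:R%:M) c); apply: IM => //; apply: IV.
Qed.

Lemma unit_sum1_neq0 M : (0 < M)%N -> unit_sum M (fun _ : K => 1 : R[i]) != 0 :> R[i].
Proof.
move=> M0; rewrite /unit_sum sumr_const pnatr_eq0 -lt0n; apply/card_gt0P.
have h1 : (1 < p ^ M)%N by rewrite -(exp1n M) ltn_exp2r // prime_gt1.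
by exists (Ordinal h1); rewrite unfold_in /= mulr1n; apply/eqP; exact: pabs1.
Qed.

End gauss_sum_evaluation.

(** * Iwahori subgroups of depth b *)

Section iwahori_volume.
Context {p : nat} {R : realType} {K : padicFieldType p R} {n : nat}.
Hypothesis p_pr : prime p.

Definition iwahori_level (b : nat) : set (GL K n) :=
  iwahori `&` [set g | forall i j : 'I_n, (j < i)%N -> pabs (g i j) <= p%:R ^- b].

Lemma prod_pabs1 (I : finType) (F : I -> K) : (forall i, pabs (F i) <= 1) ->
  pabs (\prod_i F i) = 1 -> forall i, pabs (F i) = 1.
Proof.
move=> F1 e i; apply/le_anti; rewrite F1 /= -e (bigD1 i) //= pabsM ler_piMr ?pabs_ge0 //.
by apply: pabs_prod_le1 => *; apply: F1.
Qed.

(** Modulo p the determinant is the product of the diagonal entries, and a product of integral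
    elements is a unit only if each factor is. *)
Lemma iwahori_diag (g : GL K n) i : iwahori g -> pabs (g i i) = 1.
Proof.
move=> [[g1 gd] gl]; apply: (@prod_pabs1 _ (fun i => g i i)) => //.
rewrite -gd; apply: pabs_dominant; rewrite gd.
apply: (@le_lt_trans _ _ p%:R^-1); last by rewrite invf_lt1 ?ltr1n ?prime_gt1 ?ltr0n ?prime_gt0.
by apply: pabs_det_lower => //; rewrite invr_ge0.
Qed.

Lemma unit_diag_det (A : 'M[K]_n) : mxle 1 A -> (forall i, pabs (A i i) = 1) ->
  (forall i j : 'I_n, (j < i)%N -> pabs (A i j) <= p%:R^-1) -> pabs (\det A) = 1.
Proof.
move=> A1 Ad Al.
have e : pabs (\prod_i A i i) = 1 by rewrite pabs_prod big1.
rewrite -e; apply: pabs_dominant; rewrite e pabs_distC.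
apply: (@le_lt_trans _ _ p%:R^-1); last by rewrite invf_lt1 ?ltr1n ?prime_gt1 ?ltr0n ?prime_gt0.
by apply: pabs_det_lower => //; rewrite invr_ge0.
Qed.

Section transvection.
Variables i j : 'I_n.
Hypothesis ji : (j < i)%N.

Definition transv (x : K) : 'M[K]_n := 1%:M + x *: delta_mx i j.

Lemma transv_row (x : K) (A : 'M[K]_n) k l :
  (transv x *m A) k l = A k l + (if k == i then x * A j l else 0).
Proof.
rewrite /transv mulmxDl mul1mx !mxE; congr (_ + _).
case: eqP => [->|ki].
  rewrite (bigD1 j) //= big1 => [|m mj]; first by rewrite !mxE !eqxx addr0 mulr1.
  by rewrite !mxE (negPf mj) andbF mulr0 mul0r.
by rewrite big1 // => m _; rewrite !mxE; case: eqP => // _; rewrite mulr0 mul0r.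
Qed.

Lemma transvD (x y : K) : transv x *m transv y = transv (x + y).
Proof.
have ij : (i == j) = false by apply/negbTE; rewrite -val_eqE /= gtn_eqF.
apply/matrixP => k l; rewrite transv_row !mxE.
have [->|_] := eqVneq k i; last by rewrite !mulr0 !addr0.
rewrite !(eq_sym j i) ij mulr0 addr0 /=.
by rewrite (eq_sym j l); ring.
Qed.

Lemma transv0 : transv 0 = 1%:M.
Proof. by rewrite /transv scale0r addr0. Qed.

Lemma transv_unit x : transv x \in unitmx.
Proof. by case: (@mulmx1_unit _ _ (transv x) (transv (- x))); rewrite // transvD subrr transv0. Qed.

Definition transvGL x : GL K n := MkGL (transv_unit x).

Lemma transvGLD x y : (transvGL x * transvGL y)%g = transvGL (x + y).
Proof. by apply: val_inj; rewrite /= transvD. Qed.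

Lemma transvGL0 : transvGL 0 = 1%g.
Proof. by apply: val_inj; rewrite /= transv0. Qed.

Lemma transv_iwahori x : pabs x <= p%:R^-1 -> iwahori (transvGL x).
Proof.
move=> xp; have x1 : pabs x <= 1.
  by apply: le_trans xp _; have := @pexpN_le1 p R p_pr 1; rewrite expr1.
have ij : (i == j) = false by apply/negbTE; rewrite -val_eqE /= gtn_eqF.
have E k l : transv x k l = (k == l)%:R + (if (k == i) && (l == j) then x else 0).
  by rewrite !mxE; case: ifP => _; rewrite ?mulr1 ?mulr0.
have low (k l : 'I_n) : (l < k)%N -> pabs (transv x k l) <= p%:R^-1.
  move=> lk; rewrite E -val_eqE /= gtn_eqF // add0r; case: ifP => // _.
  by rewrite pabs0 invr_ge0.
have t1 : mxle 1 (transv x).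
  move=> k l; rewrite E; apply: pabsD_le; first exact: pabs_nat_le1.
  by case: ifP => _; rewrite ?pabs0.
split=> //; split=> //; apply: unit_diag_det => // k.
rewrite E eqxx; case: eqP => [->|_]; rewrite ?ij ?addr0 ?pabs1 //.
Qed.

End transvection.

(* The entries below the diagonal are pushed into p^b Z_p one at a time, row by
   row from the top and from left to right in each row; t counts the entries of
   the matrix already visited. *)
Definition iwahori_partial (b t : nat) : set (GL K n) :=
  iwahori `&` [set g | forall i j : 'I_n, (j < i)%N -> (i * n + j < t)%N ->
                        pabs (g i j) <= p%:R ^- b].

Lemma iwahori_partial0 b : iwahori_partial b 0 = iwahori.
Proof. by apply/seteqP; split => g; [case|split]. Qed.

Lemma iwahori_partial_full b : iwahori_partial b (n * n) = iwahori_level b.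
Proof.
apply/seteqP; split => g [gI h]; split => // i j ji; last by move=> _; apply: h.
apply: h => //; rewrite (leq_trans (_ : _ < i * n + n)%N) ?ltn_add2l //.
by rewrite addnC -mulSn leq_mul2r ltn_ord orbT.
Qed.

(** The visited entries of row i lie in columns l < j. Adding a multiple of row j changes them by
    multiples of entries (j, l), which are below the diagonal and already visited. *)
Lemma iwahori_partial_transv b t (i j : 'I_n) (ji : (j < i)%N) x g :
  (i * n + j)%N = t -> pabs x <= p%:R^-1 ->
  iwahori_partial b t g -> iwahori_partial b t (transvGL ji x * g)%g.
Proof.
move=> tE xp [gI gb]; split; first by apply: iwahoriM => //; apply: transv_iwahori.
move=> k l lk klt; rewrite GLvalM transv_row.
apply: pabsD_le; first exact: gb.
case: eqP => [ki|_]; last by rewrite pabs0.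
have x1 : pabs x <= 1.
  by apply: le_trans xp _; have := @pexpN_le1 p R p_pr 1; rewrite expr1.
apply: pabsM_le1 => //; apply: gb.
  by move: klt; rewrite ki -tE ltn_add2l.
rewrite -tE (leq_trans (_ : _ < j * n + n)%N) ?ltn_add2l //.
by rewrite addnC -mulSn (leq_trans _ (leq_addr _ _)) // leq_mul2r ji orbT.
Qed.

Lemma iwahori_partialS b t (i j : 'I_n) g : (j < i)%N -> (i * n + j)%N = t ->
  iwahori_partial b t.+1 g <-> iwahori_partial b t g /\ pabs (g i j) <= p%:R ^- b.
Proof.
move=> ji tE; split=> [[gI h]|[[gI h] gij]].
  split; last by apply: h => //; rewrite tE.
  by split=> // k l lk klt; apply: h => //; rewrite ltnW.
split=> // k l lk; rewrite ltnS leq_eqVlt => /orP[/eqP e|]; last exact: h.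
suff [-> ->] : k = i /\ l = j by [].
have n0 : (0 < n)%N by apply: leq_ltn_trans (ltn_ord i).
move: e; rewrite -tE => e; split; apply: val_inj => /=.
  by have := congr1 (divn^~ n) e; rewrite !divnMDl // !divn_small ?addn0.
by have := congr1 (modn^~ n) e; rewrite !modnMDl !modn_small.
Qed.

Lemma pcong_iwahori_partial b t : (0 < b)%N -> forall g k,
  iwahori_partial b t g -> pcong b k -> iwahori_partial b t (g * k)%g.
Proof.
move=> b0 g k [gI gb] kM; split.
  by apply: iwahoriM => //; apply: (pcong_iwahori p_pr b0).
move=> i j ji ijt; have -> : GLval (g * k)%g = GLval g + GLval g *m (GLval k - 1%:M).
  by rewrite mulmxBr mulmx1 addrC subrK.
rewrite mxE.
apply: pabsD_le; first exact: gb.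
by case: gI => [[g1 _] _]; apply: mxleM1l.
Qed.

Lemma measurable_iwahori_partial b t : (0 < b)%N ->
  measurable (iwahori_partial b t : set (borel (GL K n))).
Proof.
move=> b0; apply: open_measurable; apply: (rinvariant_open p_pr b0) => g k.
exact: pcong_iwahori_partial.
Qed.

Variable mu : {measure set (borel (GL K n)) -> \bar R}.
Hypothesis mu_haar : haar_measure mu.

(** The transvections with entry p a at (i, j), for a mod p^(b-1), exhibit the larger set as a
    disjoint union of left translates of the smaller one. The exponent is b - 1 because the entry
    already lies in p Z_p. *)
Lemma iwahori_partial_measure b t (i j : 'I_n) : (0 < b)%N -> (j < i)%N ->
  (i * n + j)%N = t ->
  mu (iwahori_partial b t) = ((p ^ b.-1)%:R%:E * mu (iwahori_partial b t.+1))%E.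
Proof.
move=> b0 ji tE.
have px (a : nat) : pabs (p%:R * a%:R : K) <= p%:R^-1.
  by apply: pabsMr_le1; rewrite ?pabs_p ?pabs_nat_le1.
pose k (a : 'I_(p ^ b.-1)) : GL K n := transvGL ji (p%:R * a%:R).
have entry x g : (transvGL ji x * g)%g i j = g i j + x * g j j.
  by rewrite GLvalM transv_row eqxx.
have -> : iwahori_partial b t = \big[setU/set0]_(a <- index_enum 'I_(p ^ b.-1) | true)
    [set g | iwahori_partial b t.+1 (k a * g)%g].
  apply/seteqP; split => g.
    move=> gt; have [gI _] := gt; have gj := iwahori_diag j gI.
    have gj0 := unit_neq0 gj; have p0 := padicp_neq0 (K := K) p_pr.
    (* The residue a of this quotient cancels the entry (i, j) mod p^b; the quotient is integral
       since p divides g_ij and g_jj is a unit. *)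
    have y1 : pabs (- (g i j / (p%:R * g j j))) <= 1.
      rewrite pabsN pabsM pabsV pabsM gj mulr1 pabs_p invrK.
      rewrite -ler_pdivlMr ?ltr0n ?prime_gt0 // mul1r.
      by case: gI => _; apply.
    have [a ha] := padic_residue p_pr b.-1 y1.
    apply/bigsetU_exists; exists a; split; rewrite ?mem_index_enum //=.
    apply/(iwahori_partialS _ _ ji tE); split.
      exact: iwahori_partial_transv.
    rewrite entry (_ : _ + _ = - (p%:R * g j j * (- (g i j / (p%:R * g j j)) - a%:R))).
      rewrite pabsN pabsM pabsM gj mulr1 pabs_p.
      apply: le_trans (ler_wpM2l _ ha) _; first by rewrite invr_ge0.
      by rewrite -invfM -exprS prednK.
    by field; rewrite gj0.
  move=> /bigsetU_exists[a [_ _ /= /(iwahori_partialS _ _ ji tE)[gt _]]].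
  have -> : g = (transvGL ji (- (p%:R * a%:R)) * (k a * g))%g.
    by rewrite mulgA transvGLD addNr transvGL0 mul1g.
  by apply: iwahori_partial_transv => //; rewrite pabsN.
have mS := measurable_iwahori_partial t.+1 b0.
rewrite measure_bigsetU_seq ?index_enum_uniq //.
- rewrite (eq_bigr (fun=> mu (iwahori_partial b t.+1))).
    by rewrite sumr_const card_ord mule_natl.
  by move=> a _; exact: (haar_left_invariant mu_haar).
- by move=> a _; apply: measurable_lpreim.
- move=> a a' g _ _ /= /(iwahori_partialS _ _ ji tE)[gt ga] /(iwahori_partialS _ _ ji tE)[_ ga'].
  apply: (padic_residue_inj (K := K) p_pr).
  have gI : iwahori g.
    have -> : g = (transvGL ji (- (p%:R * a%:R)) * (k a * g))%g.
      by rewrite mulgA transvGLD addNr transvGL0 mul1g.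
    by case: gt => gt _; apply: iwahoriM => //; apply: transv_iwahori; rewrite pabsN.
  have := pabsB_le ga ga'; rewrite !entry.
  rewrite (_ : _ - _ = p%:R * g j j * (a%:R - a'%:R)); last by ring.
  rewrite pabsM pabsM (iwahori_diag j gI) mulr1 pabs_p.
  have -> : p%:R ^- b.-1 = p%:R * p%:R ^- b :> R.
    rewrite -[in RHS](prednK b0) exprS invfM mulVKf //.
    by rewrite gt_eqF // ltr0n prime_gt0.
  by rewrite ler_pdivrMl ?ltr0n ?prime_gt0.
Qed.

(** Position s stands for row s / n and column s mod n; row i has i entries below the diagonal. *)
Lemma sum_strictly_lower k : (k <= n)%N ->
  (\sum_(s < k * n) (s %% n < s %/ n) = 'C(k, 2))%N.
Proof.
elim: k => [_|k IH kn]; first by rewrite big_ord0.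
rewrite mulSn addnC big_split_ord /= IH; last exact: ltnW.
rewrite binS bin1; congr (_ + _)%N.
have n0 : (0 < n)%N by apply: leq_ltn_trans kn.
rewrite (eq_bigr (fun s : 'I_n => (s < k)%N : nat)); last first.
  by move=> s _; rewrite modnMDl modn_small // divnMDl // divn_small // addn0.
transitivity (\sum_(s < n | (s < k)%N) 1)%N.
  by rewrite [RHS]big_mkcond; apply: eq_bigr => s _; case: (s < k)%N.
by rewrite -(big_ord_widen n (fun=> 1%N) (ltnW kn)) sum1_card card_ord.
Qed.

(** Each of the (n^2 - n)/2 positions below the diagonal contributes an index p^(b-1); passing any
    other position imposes no condition. *)
Lemma iwahori_level_measure b : (0 < b)%N ->
  mu iwahori = ((p ^ (b.-1 * ((n ^ 2 - n) %/ 2)))%:R%:E * mu (iwahori_level b))%E.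
Proof.
move=> b0.
have h t : (t <= n * n)%N -> mu iwahori =
    ((p ^ (b.-1 * \sum_(s < t) (s %% n < s %/ n)))%:R%:E * mu (iwahori_partial b t))%E.
  elim: t => [_|t IH tn].
    by rewrite big_ord0 muln0 expn0 mul1e iwahori_partial0.
  rewrite IH; last exact: ltnW.
  have n0 : (0 < n)%N by case: (n) tn.
  have hi : (t %/ n < n)%N by rewrite ltn_divLR.
  have hj : (t %% n < n)%N by rewrite ltn_mod.
  have tE : (Ordinal hi * n + Ordinal hj)%N = t by rewrite /= -divn_eq.
  rewrite big_ord_recr /=; have [ji|ij] := ltnP (t %% n) (t %/ n).
    rewrite (iwahori_partial_measure b0 (i := Ordinal hi) (j := Ordinal hj) ji tE).
    by rewrite muleA -EFinM -natrM -expnD addn1 mulnSr.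
  rewrite addn0; congr (_ * mu _)%E; apply/seteqP; split => g [gI gb]; split => // i j ji it.
    apply: gb => //; move: it; rewrite ltnS leq_eqVlt => /orP[/eqP e|//].
    move: ij; rewrite -e modnMDl modn_small // divnMDl // divn_small // addn0.
    by rewrite leqNgt ji.
  by apply: gb => //; rewrite ltnW.
rewrite (h (n * n)%N) // iwahori_partial_full sum_strictly_lower // bin2.
congr ((p ^ (_ * _))%:R%:E * _)%E.
by rewrite -divn2 -subn1 mulnBr muln1 mulnn.
Qed.

End iwahori_volume.

(** * Averaging the twisted integral *)

Section twisted_iwahori_integral.
Context {p : nat} {R : realType} {K : padicFieldType p R} {n : nat}.
Hypothesis p_pr : prime p.
Variables (psi chi : K -> R[i]) (b : nat).
Hypothesis psi_std : std_addchar psi.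
Hypothesis chi_char : mchar chi.
Hypothesis chi_cond : conductor_exp chi b.
Hypothesis b0 : (0 < b)%N.

Let expNb_p : p%:R ^- b <= p%:R^-1 :> R.
Proof. by have := @pexpN_le p R p_pr 1 b; rewrite expr1; apply. Qed.

Let mcharC := mcharM chi_char.

(** The determinant is congruent to the product of the diagonal mod p^b, the conductor of chi. This
    is what dictates the depth b. *)
Lemma iwahori_level_det (g : GL K n) : iwahori_level b g ->
  chi (\det g) = \prod_i chi (g i i).
Proof.
move=> [gI gb]; have [[g1 gd] _] := gI.
rewrite -mchar_prod // => [|i]; last exact/unit_neq0/iwahori_diag.
apply: (mchar_cong p_pr chi_char b0 _ gd); first by case: chi_cond.
exact: pabs_det_lower.
Qed.

(** The conditions bear on one entry at a time, as the factorisation over entries demands. *)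
Lemma iwahori_levelP (g : GL K n) : iwahori_level b g <->
  [/\ forall i, pabs (g i i) = 1,
      forall i j : 'I_n, (j < i)%N -> pabs (g i j) <= p%:R ^- b &
      forall i j : 'I_n, (i < j)%N -> pabs (g i j) <= 1].
Proof.
split=> [[gI gb]|[gd gl gu]].
  by have [[g1 _] _] := gI; split => // i; apply: iwahori_diag.
have g1 : mxle 1 g.
  move=> i j; case: (ltngtP i j) => [/gu//|/gl h|/val_inj->]; last by rewrite gd.
  by apply: le_trans h _; apply: pexpN_le1.
have gp (i j : 'I_n) : (j < i)%N -> pabs (g i j) <= p%:R^-1.
  by move=> /gl/le_trans; apply.
by split=> //; split=> //; split=> //; apply: unit_diag_det.
Qed.

Section average.
Variable M : nat.
Let I := ('I_n * 'I_n)%type.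

(** Entries below the diagonal run over p^b times residues mod p^M, so a class mod K(M) may be hit
    several times. This is harmless: all translates have the same integral, and only their number
    matters. *)
Definition avg_mx (f : {ffun I -> 'I_(p ^ M)}) : 'M[K]_n :=
  \matrix_(i, j) ((if (j < i)%N then p%:R ^+ b else 1) * (f (i, j))%:R).

Definition avg_diag (f : {ffun I -> 'I_(p ^ M)}) : bool :=
  [forall i, pabs ((f (i, i))%:R : K) == 1].

Lemma avg_mx_iwahori f : avg_diag f ->
  iwahori_level b (toGL (avg_mx f)) /\ GLval (toGL (avg_mx f)) = avg_mx f.
Proof.
move=> /forallP fd.
have E i j : avg_mx f i j = (if (j < i)%N then p%:R ^+ b else 1) * (f (i, j))%:R.
  by rewrite mxE.
have fd' i : pabs (avg_mx f i i) = 1 by rewrite E ltnn mul1r; apply/eqP/fd.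
have fl (i j : 'I_n) : (j < i)%N -> pabs (avg_mx f i j) <= p%:R ^- b.
  by move=> ji; rewrite E ji pabsMr_le1 ?pabs_nat_le1 ?pabs_pX.
have f1 : mxle 1 (avg_mx f).
  move=> i j; rewrite E pabsM_le1 ?pabs_nat_le1 //; case: ifP => _; rewrite ?pabs1 //.
  by rewrite pabs_pX // pexpN_le1.
have fu : avg_mx f \in unitmx.
  apply/pabs_det1_unit/unit_diag_det => // i j ji.
  exact: le_trans (fl _ _ ji) expNb_p.
split; last exact: toGLK.
by apply/iwahori_levelP; rewrite toGLK //; split => // i j _; apply: f1.
Qed.

(** The trace of m k pairs entry (i, j) of k with entry (j, i) of m, hence the swapped indices;
    below the diagonal the p^b of [avg_mx] cancels p^-b. The value 0 at diagonal non-units extends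
    the sum to all f, where it factors. *)
Definition avg_weight (m : 'M[K]_n) (ij : I) (a : 'I_(p ^ M)) : R[i] :=
  if ij.1 == ij.2 then
    if pabs (a%:R : K) == 1 then chi a%:R * psi (p%:R ^- b * m ij.2 ij.1 * a%:R) else 0
  else psi ((if (ij.2 < ij.1)%N then m ij.2 ij.1 else p%:R ^- b * m ij.2 ij.1) * a%:R).

Lemma diag_prod (x : I -> R[i]) :
  \prod_(ij : I) (if ij.1 == ij.2 then x ij else 1) = \prod_i x (i, i).
Proof.
transitivity (\prod_i \prod_j if i == j then x (i, j) else 1).
  by rewrite pair_bigA; apply: eq_bigr => -[].
apply: eq_bigr => i _; rewrite (bigD1 i) //= eqxx big1 ?mulr1 // => j ji.
by rewrite eq_sym (negPf ji).
Qed.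

Lemma avg_weightE (m : 'M[K]_n) f : avg_diag f ->
  psi (p%:R ^- b * \tr (m *m avg_mx f)) * chi (\det (avg_mx f)) =
  \prod_ij avg_weight m ij (f ij).
Proof.
move=> fd; have [fI fE] := avg_mx_iwahori fd.
rewrite -fE iwahori_level_det // fE.
have -> : p%:R ^- b * \tr (m *m avg_mx f) =
    \sum_(ij : I) p%:R ^- b * (m ij.2 ij.1 * avg_mx f ij.1 ij.2).
  transitivity (\sum_i \sum_j p%:R ^- b * (m j i * avg_mx f i j)).
    rewrite exchange_big /= /mxtrace mulr_sumr; apply: eq_bigr => j _.
    by rewrite mxE mulr_sumr.
  by rewrite pair_bigA.
rewrite (addchar_sum psi_std) -(diag_prod (fun ij => chi (avg_mx f ij.1 ij.2))) -big_split /=.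
apply: eq_bigr => -[i j] _ /=; rewrite /avg_weight /=.
have [<-|ij] := eqVneq i j.
  by rewrite (forallP fd) mulrC mxE ltnn mul1r mulrA.
rewrite mulr1; congr (psi _); rewrite mxE; case: ifP => _; last by rewrite mul1r mulrA.
rewrite mulrCA mulKf //.
by rewrite expf_neq0 // padicp_neq0.
Qed.

Lemma sum_avg_weight (m : 'M[K]_n) :
  \sum_(f | avg_diag f) psi (p%:R ^- b * \tr (m *m avg_mx f)) * chi (\det (avg_mx f))
  = \prod_(ij : I) \sum_a avg_weight m ij a.
Proof.
rewrite bigA_distr_bigA big_mkcond; apply: eq_bigr => f _.
case: ifPn => fd; first exact: avg_weightE.
move: fd; rewrite negb_forall => /existsP[i fi].
by rewrite (bigD1 (i, i)) //= /avg_weight /= eqxx (negPf fi) mul0r.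
Qed.

(** The number of translates, written as a product over entries so that its off-diagonal powers
    cancel against those of [prod_avg_weight]. *)
Lemma card_avg_diag :
  \sum_(f : {ffun I -> 'I_(p ^ M)} | avg_diag f) (1 : R[i]) =
  \prod_(ij : I) if ij.1 == ij.2 then unit_sum M (fun _ : K => 1) else (p ^ M)%:R.
Proof.
transitivity (\prod_(ij : I) \sum_(a : 'I_(p ^ M))
    (if ij.1 == ij.2 then if pabs (a%:R : K) == 1 then 1 else 0 else 1 : R[i])).
  rewrite bigA_distr_bigA big_mkcond; apply: eq_bigr => f _.
  case: ifPn => fd.
    rewrite big1 // => -[i j] _ /=; case: eqP => // <-.
    by rewrite (forallP fd).
  move: fd; rewrite negb_forall => /existsP[i fi].
  by rewrite (bigD1 (i, i)) //= eqxx (negPf fi) mul0r.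
apply: eq_bigr => -[i j] _ /=; case: eqP => _; first by rewrite /unit_sum [RHS]big_mkcond.
by rewrite sumr_const card_ord.
Qed.

Variable N : nat.
Hypothesis MN : (b + N <= M)%N.

Let gauss := unit_sum M (fun a : K => chi a * psi (p%:R ^- b * a)).

(** A factor below the diagonal survives only if the transposed entry of g is integral, one above
    only if that entry is in p^b Z_p, a diagonal one only if g_ii is a unit: jointly this is
    [iwahori_level b]. The bound on M makes the characters involved periodic mod p^M. *)
Lemma prod_avg_weight (g : GL K n) : mxle (p%:R ^+ N) g ->
  \prod_(ij : I) \sum_a avg_weight g ij a =
  if `[<iwahori_level b g>] then
    (\prod_(ij : I) if ij.1 == ij.2 then gauss else (p ^ M)%:R) * (chi (\det g))^-1
  else 0.
Proof.
move=> gN.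
have pb : pabs (p%:R ^- b : K) = p%:R ^+ b by rewrite pabsV pabs_pX // invrK.
have p_ge1 : 1 <= p%:R :> R by rewrite ler1n prime_gt0.
have lvl x : pabs (x : K) <= p%:R ^+ N -> pabs (p%:R ^- b * x) <= p%:R ^+ M.
  move=> xN; rewrite pabsM pb; apply: le_trans (ler_wpM2l _ xN) _.
    by rewrite exprn_ge0.
  by rewrite -exprD ler_weXn2l.
have bM : (b <= M)%N by apply: leq_trans MN; apply: leq_addr.
have diagE i : \sum_a avg_weight g (i, i) a =
    if pabs (g i i) == 1 then (chi (g i i))^-1 * gauss else 0.
  rewrite -(gauss_unit_sum p_pr psi_std chi_char chi_cond b0 bM) ?lvl //.
  rewrite /unit_sum [RHS]big_mkcond; apply: eq_bigr => a _.
  by rewrite /avg_weight /= eqxx.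
have offE (i j : 'I_n) : i != j -> \sum_a avg_weight g (i, j) a =
    if pabs (if (j < i)%N then g j i else p%:R ^- b * g j i) <= 1 then (p ^ M)%:R else 0.
  move=> ij; rewrite -(sum_addchar p_pr psi_std).
    by apply: eq_bigr => a _; rewrite /avg_weight /= (negPf ij).
  case: ifP => _; last exact: lvl.
  by apply: le_trans (gN _ _) _; rewrite ler_weXn2l // (leq_trans _ MN) // leq_addl.
have lowE x : (pabs (p%:R ^- b * x : K) <= 1) = (pabs x <= p%:R ^- b).
  by rewrite pabsM pb mulrC -ler_pdivlMr ?div1r // exprn_gt0 // ltr0n prime_gt0.
case: asboolP => [gI|gI].
  have [gd gl gu] := (iwahori_levelP g).1 gI.
  rewrite iwahori_level_det // -prodfV -(diag_prod (fun ij => (chi (g ij.1 ij.2))^-1)).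
  rewrite -big_split /=; apply: eq_bigr => -[i j] _ /=.
  have [<-|ij] := eqVneq i j; first by rewrite diagE gd eqxx mulrC.
  rewrite mulr1 offE //; case: ltnP => ji; first by rewrite gu.
  by rewrite lowE gl // ltn_neqAle ij ji.
apply/eqP; apply: contrapT => /negP/prodf_neq0 hn; apply: gI; apply/iwahori_levelP.
split=> [i|i j ji|i j ij].
- by have := hn (i, i) isT; rewrite diagE; case: ifP => [/eqP//|_]; rewrite eqxx.
- have := hn (j, i) isT; rewrite offE /=; last by rewrite -val_eqE /= ltn_eqF.
  by rewrite ltnNge ltnW //= lowE; case: ifP => //; rewrite eqxx.
- have := hn (j, i) isT; rewrite offE /=; last by rewrite -val_eqE /= gtn_eqF.
  by rewrite ij; case: ifP => //; rewrite eqxx.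
Qed.

End average.

Variable mu : {measure set (borel (GL K n)) -> \bar R}.
Hypothesis mu_haar : haar_measure mu.
Variable Phi : GL K n -> R[i].
Hypothesis Phi_iwahori : forall g k, iwahori k -> Phi (g * k)%g = Phi g.
Variable N : nat.
Hypothesis Phi_support : forall g, Phi g != 0 -> mxle (p%:R ^+ N) g.

Definition twist (g : GL K n) : R[i] :=
  psi (p%:R ^- b * \tr g) * chi (\det g) * Phi g.

(** On the support of Phi the entries of g have absolute value at most p^N, so K(b + N) moves p^-b
    tr g only by elements of Z_p. *)
Lemma twist_rinvariant : rinvariant (b + N) twist.
Proof.
move=> g k kM; have kM0 : (0 < b + N)%N by rewrite addn_gt0 b0.
rewrite /twist Phi_iwahori; last exact: (pcong_iwahori p_pr kM0).
have [->|/Phi_support gN] := eqVneq (Phi g) 0; first by rewrite !mulr0.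
congr (_ * _ * _).
  apply: (addchar_cong psi_std).
  have -> : p%:R ^- b * \tr (GLval (g * k)%g) - p%:R ^- b * \tr g
      = p%:R ^- b * \tr (GLval g *m (GLval k - 1%:M)).
    by rewrite -mulrBr -raddfB /= mulmxBr mulmx1.
  have : mxle (p%:R ^+ N * p%:R ^- (b + N)) (GLval g *m (GLval k - 1%:M)).
    by apply: mxleM => //; rewrite exprn_ge0.
  have pN : p%:R ^+ N != 0 :> R by rewrite expf_neq0 // pnatr_eq0 -lt0n prime_gt0.
  rewrite (addnC b) exprD invfM mulVKf // => hk.
  have pb0 : p%:R ^+ b != 0 :> R by rewrite expf_neq0 // pnatr_eq0 -lt0n prime_gt0.
  rewrite -(mulfV pb0).
  apply: pabsM_le; first by rewrite pabsV pabs_pX // invrK.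
  by apply: pabs_sum_le => // i _; apply: hk.
rewrite detM mcharC ?det_neq0 //.
have kI := pcong_GLint p_pr kM0 kM.
have -> : chi (\det k) = 1; last by rewrite mulr1.
have [chi1 _] := chi_char; rewrite -chi1.
have [k1 kd] := kI; apply: (mchar_cong p_pr chi_char b0 _ kd); first by case: chi_cond.
rewrite -(det1 K n); apply: pabs_det_cong => //; first exact: mxle1.
by apply: mxle_trans kM _; apply: pexpN_le => //; apply: leq_addr.
Qed.

Lemma sum_twist M g : (b + N <= M)%N ->
  \sum_(f | avg_diag f) twist (g * toGL (@avg_mx M f))%g =
  if `[<iwahori_level b g>] then
    Phi 1%g * \prod_(ij : 'I_n * 'I_n)
      (if ij.1 == ij.2 then unit_sum M (fun a : K => chi a * psi (p%:R ^- b * a))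
       else (p ^ M)%:R)
  else 0.
Proof.
move=> MN; have P1 : iwahori_level b g -> Phi 1%g = Phi g.
  by move=> [gI _]; rewrite -(Phi_iwahori 1%g gI) mul1g.
have [g0|g0] := eqVneq (Phi g) 0.
  rewrite big1 => [|f fd]; first by case: asboolP => // gI; rewrite P1 // g0 mul0r.
  by rewrite /twist Phi_iwahori ?g0 ?mulr0 //; case: (avg_mx_iwahori fd) => -[].
transitivity (Phi g * chi (\det g) * \sum_(f | avg_diag f)
    psi (p%:R ^- b * \tr (GLval g *m @avg_mx M f)) * chi (\det (avg_mx f))).
  rewrite mulr_sumr; apply: eq_bigr => f fd; have [[fI _] fE] := avg_mx_iwahori fd.
  rewrite /twist Phi_iwahori // GLvalM det_mulmx mcharC ?det_neq0 // fE.
  by ring.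
rewrite sum_avg_weight (prod_avg_weight MN); last exact: Phi_support.
case: asboolP => gI; last by rewrite mulr0.
rewrite P1 // mulrCA -!mulrA mulfV ?mulr1; last by apply: mchar_neq0 => //; apply: det_neq0.
by rewrite mulrC.
Qed.

Lemma measurable_iwahori_level : measurable (iwahori_level b : set (borel (GL K n))).
Proof. by rewrite -iwahori_partial_full; apply: measurable_iwahori_partial. Qed.

Lemma iwahori_level_fin : (mu (iwahori_level b) < +oo)%E.
Proof.
apply: le_lt_trans (haar_GLint_fin p_pr mu_haar); apply: le_measure.
- by rewrite inE; apply: measurable_iwahori_level.
- by rewrite inE; apply: measurable_GLint.
- by move=> g [[]].
Qed.

(** Summing over translates multiplies the integral by their number, and by [sum_twist] makes the
    integrand constant on [iwahori_level b] and zero elsewhere. The common off-diagonal factor is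
    cancelled as [P]. *)
Lemma cintegral_twist M : (b + N <= M)%N -> cintegrable mu setT twist ->
  cintegral mu setT twist * unit_sum M (fun _ : K => 1) ^+ n =
  Phi 1%g * (fine (mu (iwahori_level b)))%:C%C *
  unit_sum M (fun a : K => chi a * psi (p%:R ^- b * a)) ^+ n.
Proof.
move=> MN ti.
have bN0 : (0 < b + N)%N by rewrite addn_gt0 b0.
have M0 : (0 < M)%N by apply: leq_trans MN.
have tm := rinvariant_cmeasurable p_pr bN0 twist_rinvariant.
have pM0 : ((p ^ M)%:R : R[i]) != 0 by rewrite pnatr_eq0 -lt0n expn_gt0 prime_gt0.
have split_prod (x : R[i]) :
    \prod_(ij : 'I_n * 'I_n) (if ij.1 == ij.2 then x else (p ^ M)%:R) =
    x ^+ n * \prod_(ij : 'I_n * 'I_n) (if ij.1 == ij.2 then 1 else (p ^ M)%:R).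
  have -> : x ^+ n = \prod_(i < n) x by rewrite prodr_const card_ord.
  rewrite -(diag_prod (fun=> x)) -big_split.
  by apply: eq_bigr => ij _ /=; case: eqP => _; rewrite ?mulr1 ?mul1r.
set P := \prod_ij _ in split_prod.
have P0 : P != 0 by apply/prodf_neq0 => ij _; case: ifP; rewrite ?oner_eq0.
apply: (mulIf P0); rewrite -!mulrA -!split_prod.
rewrite -card_avg_diag mulr_sumr.
transitivity (\sum_(f | avg_diag f)
    cintegral mu setT (fun g => twist (g * toGL (@avg_mx M f))%g)).
  apply: eq_bigr => f fd; rewrite mulr1; have [[[fI _] _] _] := avg_mx_iwahori fd.
  by have [_ ->] := cintegral_rmul p_pr mu_haar fI tm ti.
have := @cintegral_sum _ _ _ mu _ (index_enum {ffun 'I_n * 'I_n -> 'I_(p ^ M)}) (@avg_diag M)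
  (fun f g => twist (g * toGL (avg_mx f))%g).
case.
  move=> f fd; have [[[fI _] _] _] := avg_mx_iwahori fd.
  by have [] := cintegral_rmul p_pr mu_haar fI tm ti.
move=> _ <-.
under eq_fun do rewrite (sum_twist _ MN).
have [_] := cintegral_indicator (Phi 1%g * \prod_(ij : 'I_n * 'I_n)
      (if ij.1 == ij.2 then unit_sum M (fun a : K => chi a * psi (p%:R ^- b * a))
       else (p ^ M)%:R)) measurable_iwahori_level iwahori_level_fin.
by move=> ->; rewrite -!mulrA; congr (_ * _); rewrite mulrC.
Qed.

End twisted_iwahori_integral.

(** * Growth of Shalika functions *)

Section bounded_functionals.
Context {R : realType} {V : lmodType R[i]}.

Definition is_linear_form (f : V -> R[i]) := forall a u v, f (a *: u + v) = a * f u + f v.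

Lemma normcB_le (z w : R[i]) : normc (z - w) <= normc z + normc w.
Proof. by rewrite (le_trans (normcD_le _ _)) // (normcN w). Qed.

(* Induction on d: a multiple of a vector on which the first coordinate does not
   vanish is subtracted. *)
Lemma bounded_linear_form d (S : set V) (e : 'I_d -> V -> R[i]) (l : V -> R[i]) :
  (forall a u v, S u -> S v -> S (a *: u + v)) ->
  (forall i, is_linear_form (e i)) -> is_linear_form l ->
  (forall v, S v -> (forall i, e i v = 0) -> l v = 0) ->
  exists2 c : R, 0 <= c & forall v (B : R), S v -> 0 <= B ->
    (forall i, normc (e i v) <= B) -> normc (l v) <= c * B.
Proof.
elim: d S e => [|d IH] S e SL eL lL el.
  exists 0 => // v B Sv _ _; rewrite mul0r el ?normc0 //.
  by case.
have [[v1 [Sv1 /eqP v10]]|hn] := pselect (exists v, S v /\ e ord0 v <> 0).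
  have [|i|||c c0 hc] := IH [set v | S v /\ e ord0 v = 0] (fun i => e (lift ord0 i)).
  - by move=> a u v [Su u0] [Sv v0]; split; [exact: SL|rewrite eL u0 v0 mulr0 addr0].
  - exact: eL.
  - exact: lL.
  - move=> v [Sv v0] h; apply: el => // i.
    by have [j ->|->] := unliftP ord0 i.
  pose q := (normc (e ord0 v1))^-1.
  have q0 : 0 <= q by rewrite invr_ge0 normc_ge0.
  pose s := \sum_i normc (e i v1).
  have s0 : 0 <= s by apply: sumr_ge0 => i _; apply: normc_ge0.
  (* With a of modulus at most q B, the coordinates of w = v - a v1 are bounded by (1 + q s) B, and
     l(v) = l(w) + a l(v1). *)
  exists (c * (1 + q * s) + q * normc (l v1)) => [|v B Sv B0 hB].
    apply: addr_ge0; apply: mulr_ge0 => //; last exact: normc_ge0.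
    by rewrite addr_ge0 // mulr_ge0.
  pose a := e ord0 v / e ord0 v1.
  have aB : normc a <= q * B.
    by rewrite normcM normcV mulrC ler_wpM2l.
  pose w := (- a) *: v1 + v.
  have Sw : S w by apply: SL.
  have ew i : e i w = e i v - a * e i v1 by rewrite eL mulNr addrC.
  have w0 : e ord0 w = 0 by rewrite ew /a divfK // subrr.
  have lw : l v = l w + a * l v1 by rewrite lL mulNr addrC addrA subrr add0r.
  rewrite lw (le_trans (normcD_le _ _)) // mulrDl; apply: lerD; last first.
    by rewrite normcM mulrAC ler_wpM2r ?normc_ge0.
  rewrite -mulrA; apply: hc => //; first by rewrite mulr_ge0 // addr_ge0 // mulr_ge0.
  move=> i; rewrite ew (le_trans (normcB_le _ _)) // mulrDl mul1r lerD //.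
  rewrite normcM [q * s]mulrC -mulrA mulrC ler_pM ?normc_ge0 //.
  rewrite /s (bigD1 (lift ord0 i)) //= lerDl.
  by apply: sumr_ge0 => j _; apply: normc_ge0.
have [|i|||c c0 hc] := IH S (fun i => e (lift ord0 i)).
- exact: SL.
- exact: eL.
- exact: lL.
- move=> v Sv h; apply: el => // i; have [j ->|->] := unliftP ord0 i; first exact: h.
  by apply: contrapT => v0; apply: hn; exists v.
by exists c => // v B Sv B0 hB; apply: hc.
Qed.

End bounded_functionals.

Section principal_series_growth.
Context {p : nat} {R : realType} {K : padicFieldType p R} {N : nat}.
Hypothesis p_pr : prime p.
Variable theta : 'I_N -> K -> R[i].
Hypothesis theta_unram : forall i, unramified_char (theta i).

Let p_gt0 : 0 < p%:R :> R. Proof. by rewrite ltr0n prime_gt0. Qed.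
Let p_gt1 : 1 < p%:R :> R. Proof. by rewrite ltr1n prime_gt1. Qed.

Lemma unramified_normc (x : K) l (chi : K -> R[i]) : unramified_char chi ->
  pabs x = p%:R ^- l -> normc (chi x) = normc (chi p%:R) ^+ l.
Proof.
move=> [chi_char chi1] xl.
have p0 := padicp_neq0 (K := K) p_pr; have pl0 : (p%:R : K) ^+ l != 0 by rewrite expf_neq0.
have u1 : pabs (x / p%:R ^+ l) = 1.
  by rewrite pabsM pabsV pabs_pX // xl invrK mulVf // gt_eqF // exprn_gt0.
have -> : x = x / p%:R ^+ l * p%:R ^+ l by rewrite divfK.
have chiu : chi (x / p%:R ^+ l) = 1.
  by apply: chi1; split=> //; rewrite expr0 invr1 pabsB_le ?u1 ?pabs1.
by rewrite (mcharM chi_char (unit_neq0 u1) pl0) chiu mul1r (mcharX chi_char) // normcX.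
Qed.

(** Compared factor by factor: |b_ii| = p^-l with l >= 0, the exponents in [sqrt_modulus] are at
    least -N, and |theta_i(b_ii)| = |theta_i(p)|^l is at most p^(A0 l). *)
Lemma borel_sub_growth : exists A : nat, forall b : GL K N, borel_sub b -> mxle 1 b ->
  normc ((sqrt_modulus b)%:C%C * \prod_(i < N) theta i (b i i)) <= pabs (\det b) ^- A.
Proof.
have [A0 hA0] : exists A0 : nat, forall i, normc (theta i p%:R) <= p%:R ^+ A0.
  have h i : exists a : nat, normc (theta i p%:R) <= p%:R ^+ a.
    have q0 : 0 < (normc (theta i p%:R) + 1)^-1 by rewrite invr_gt0 ltr_wpDl ?normc_ge0.
    have [k hk] := pexpN_small p_pr q0; exists k.
    move: hk; rewrite ltf_pV2 ?posrE ?exprn_gt0 //; last by rewrite -invr_gt0.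
    by move=> /ltW; apply: le_trans; rewrite lerDl.
  have [a ha] := choice h; exists (\max_i a i)%N => i.
  by apply: le_trans (ha i) _; rewrite ler_weXn2l ?(ltW p_gt1) // leq_bigmax.
exists (N + A0)%N => b bB b1.
rewrite (det_upper bB) pabs_prod -exprVn -prodfV -prodrXl.
rewrite normcM normc_real /sqrt_modulus ger0_norm; last first.
  by apply: prodr_ge0 => i _; apply: powR_ge0.
rewrite normc_prod -big_split /=; apply: ler_prod => i _.
rewrite mulr_ge0 ?powR_ge0 ?normc_ge0 //=.
have bi0 : b i i != 0.
  have := det_neq0 b; rewrite (det_upper bB) => /prodf_neq0; exact.
have bi1 : pabs (b i i) <= p%:R ^- 0 by rewrite expr0 invr1.
have [l _ hl] := pabs_le_expN p_pr bi0 bi1.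
rewrite (unramified_normc (theta_unram i) hl) hl invrK exprD -!exprM; apply: ler_pM.
- exact: powR_ge0.
- by rewrite exprn_ge0 ?normc_ge0.
- have h01 : 0 < (p%:R ^- l : R) <= 1 by rewrite pexpN_gt0 // pexpN_le1.
  apply: le_trans (ger_powR h01 (_ : - N%:R <= _)) _.
    rewrite ler_pdivlMr // mulNr.
    have : (i : nat)%:R + 1 <= N%:R :> R by rewrite natr1 ler_nat.
    have : (0 : R) <= i%:R by [].
    lra.
  by rewrite powR_invn ?invr_ge0 ?exprn_ge0 ?(ltW p_gt0) // exprVn invrK exprM.
- rewrite mulnC exprM; by apply: lerXn2r; rewrite ?nnegrE ?normc_ge0.
Qed.

Lemma parabolic_ind_bound M (f : GL K N -> R[i]) : (0 < M)%N -> rinvariant M f ->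
  exists2 S : R, 0 <= S & forall k, GLint k -> normc (f k) <= S.
Proof.
(* A crude substitute for the maximum over the finitely many cosets of K(M) in GL_N(Z_p). *)
move=> M0 fM; exists (\sum_(a : 'M['I_(p ^ M)]_N) normc (f (toGL (resmx a)))).
  by apply: sumr_ge0 => *; apply: normc_ge0.
move=> k kI; have [a _ ka] := reps_cover p_pr M0 GLint_subgroup (fun g gI => gI)
  (pcong_GLint p_pr M0) kI.
rewrite -(mulKVg (toGL (resmx a)) k) fM // (bigD1 a) //= lerDl.
by apply: sumr_ge0 => *; apply: normc_ge0.
Qed.

(** In the Iwasawa decomposition g = b k the factor b = g k^-1 is again integral and |det b| = |det
    g|, so [borel_sub_growth] applies to it. *)
Lemma parabolic_ind_growth : exists A : nat, forall M (f : GL K N -> R[i]),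
  (0 < M)%N -> rinvariant M f -> parabolic_ind theta f ->
  exists2 S : R, 0 <= S & forall g : GL K N, mxle 1 g -> normc (f g) <= S * pabs (\det g) ^- A.
Proof.
have [A hA] := borel_sub_growth; exists A => M f M0 fM [fB _].
have [S S0 hS] := parabolic_ind_bound M0 fM; exists S => // g g1.
have [b [k [bB kI gE]]] := iwasawa g.
have [_ _ IV] := GLint_subgroup (K := K) (n := N).
have [kV1 _] := IV _ kI.
have b1 : mxle 1 b.
  have -> : b = (g * k^-1)%g by rewrite gE mulgK.
  exact: mxleM1l.
have dg : pabs (\det g) = pabs (\det b).
  by rewrite gE detM pabsM; case: kI => _ ->; rewrite mulr1.
rewrite dg gE fB // normcM mulrC ler_pM ?normc_ge0 ?hS //.
exact: hA.
Qed.

Lemma parabolic_ind_eq0 (f : GL K N -> R[i]) : parabolic_ind theta f ->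
  (forall k, GLint k -> f k = 0) -> forall g, f g = 0.
Proof.
move=> [fB _] f0 g; have [b [k [bB kI ->]]] := iwasawa g.
by rewrite fB // f0 // mulr0.
Qed.

End principal_series_growth.

Section shalika_growth.
Context {p : nat} {R : realType} {K : padicFieldType p R} {n : nat}.
Hypothesis p_pr : prime p.
Variables (psi eta : K -> R[i]).
Hypothesis psi_std : std_addchar psi.

Lemma pcong_mx m M (A : 'M[K]_m) : (0 < M)%N -> mxle (p%:R ^- M) (A - 1%:M) ->
  A \in unitmx /\ pcong M (toGL A).
Proof.
move=> M0 AM; have A1 : mxle 1 A.
  rewrite -(subrK 1%:M A); apply: mxleD; last exact: mxle1.
  by apply: mxle_trans AM _; apply: pexpN_le1.
have Ad : pabs (\det A) = 1.
  apply: (mxle_cong_det1 p_pr M0 (@mxle1 _ _ _ m) A1); first exact: mxle_distC.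
  by rewrite det1 pabs1.
have Au := pabs_det1_unit Ad; split=> //.
by rewrite pcongE toGLK.
Qed.

Lemma blkdiag1M (x y : GL K n) : (blkdiag x 1 * blkdiag y 1)%g = blkdiag (x * y)%g 1%g.
Proof.
apply: val_inj => /=; rewrite mulmx_block !mulmx0 !mul0mx !addr0 !add0r mulmx1.
by [].
Qed.

Lemma mxle_blkdiag1 (y : GL K n) : mxle 1 y -> mxle 1 (blkdiag y 1%g).
Proof.
by move=> y1; apply: mxle_block => //; do ?exact: mxle0; exact: mxle1.
Qed.

Lemma det_blkdiag1 (y : GL K n) : \det (blkdiag y 1%g) = \det y.
Proof. by rewrite /= det_ublock det1 mulr1. Qed.

(* An element k of the congruence subgroup is a Shalika element times a block
   lower triangular r, and diag(y, 1) conjugates r back into the congruence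
   subgroup since y is integral. *)
Lemma pcong_shalika m (k : GL K (n + n)) (y : GL K n) : (0 < m)%N -> pcong m k ->
  mxle 1 y -> exists (h : GL K n) (X : 'M[K]_n) (r : GL K (n + n)),
    [/\ pcong m h, mxle 1 X, pcong m r &
        (k * blkdiag y 1 = blkdiag h h * blkunip X * (blkdiag y 1 * r))%g].
Proof.
move=> m0 km y1; have p1 : p%:R ^- m <= 1 :> R by apply: pexpN_le1.
set A := ulsubmx (GLval k); set B := ursubmx (GLval k).
set C := dlsubmx (GLval k); set D := drsubmx (GLval k).
have kE : GLval k = block_mx A B C D by rewrite submxK.
have km' : mxle (p%:R ^- m) (block_mx (A - 1%:M) B C (D - 1%:M)).
  have := km; rewrite pcongE kE scalar_mx_block opp_block_mx add_block_mx.
  by rewrite !oppr0 !addr0.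
have Am : mxle (p%:R ^- m) (A - 1%:M).
  by move=> i j; have := km' (lshift n i) (lshift n j); rewrite block_mxEul.
have Bm : mxle (p%:R ^- m) B.
  by move=> i j; have := km' (lshift n i) (rshift n j); rewrite block_mxEur.
have Cm : mxle (p%:R ^- m) C.
  by move=> i j; have := km' (rshift n i) (lshift n j); rewrite block_mxEdl.
have Dm : mxle (p%:R ^- m) (D - 1%:M).
  by move=> i j; have := km' (rshift n i) (rshift n j); rewrite block_mxEdr.
have [Du Dp] := pcong_mx m0 Dm.
have [_ _ sV] := pcong_subgroup p_pr m0 (K := K) (n := n).
have D1 : mxle 1 (invmx D).
  by have := pcong_mxle1 p_pr (sV _ Dp); rewrite GLvalV toGLK.
(* Schur complement: k is the product of the unipotent block matrix of X0 and the lower triangular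
   one with blocks A', C, D. Factoring diag(A', A') out of the latter conjugates X0 into X. *)
pose X0 := B *m invmx D.
have X0m : mxle (p%:R ^- m) X0 by apply: mxleM1r.
pose A' := A - X0 *m C.
have A'm : mxle (p%:R ^- m) (A' - 1%:M).
  rewrite /A' addrAC; apply: mxleB => //; apply: mxleM1r => //.
  exact: mxle_trans Cm p1.
have [A'u A'p] := pcong_mx m0 A'm.
have A'1 : mxle 1 A' by rewrite -(toGLK A'u); apply: pcong_mxle1 A'p.
have A'V1 : mxle 1 (invmx A').
  by have := pcong_mxle1 p_pr (sV _ A'p); rewrite GLvalV toGLK.
pose X := invmx A' *m X0 *m A'.
have rm : mxle (p%:R ^- m) (block_mx 1%:M 0 (invmx A' *m C *m y) (invmx A' *m D) - 1%:M).
  rewrite scalar_mx_block opp_block_mx add_block_mx !oppr0 !addr0 subrr.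
  apply: mxle_block; do ?exact: mxle0.
    by apply: mxleM1r => //; apply: mxleM1l.
  have -> : invmx A' *m D - 1%:M = invmx A' *m ((D - 1%:M) - (A' - 1%:M)).
    by rewrite opprB addrA subrK mulmxBr mulVmx.
  by apply: mxleM1l => //; apply: mxleB.
have [ru rp] := pcong_mx m0 rm.
exists (toGL A'), X, (toGL (block_mx 1%:M 0 (invmx A' *m C *m y) (invmx A' *m D))).
split => //.
  apply: mxleM1r => //; apply: mxleM1l => //; exact: mxle_trans X0m p1.
apply: val_inj; rewrite /= !toGLK // kE.
rewrite !mulmx_block !(mulmx0, mul0mx, addr0, add0r, mulmx1, mul1mx).
have XE : A' *m X = X0 *m A' by rewrite /X !mulmxA mulmxV // mul1mx.
rewrite XE; congr block_mx.
- rewrite !mulmxA -[_ *m A' *m invmx A']mulmxA mulmxV // mulmx1.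
  by rewrite -mulmxDl /A' subrK.
- by rewrite !mulmxA -[_ *m A' *m invmx A']mulmxA mulmxV // mulmx1 /X0 -mulmxA mulVmx ?mulmx1.
- by rewrite !mulmxA mulmxV // mul1mx.
- by rewrite !mulmxA mulmxV // mul1mx.
Qed.

Lemma blkunip_iwahori (X : 'M[K]_n) : mxle 1 X -> iwahori (blkunip X).
Proof.
move=> X1; have u1 : mxle 1 (blkunip X).
  by apply: mxle_block => //; do ?exact: mxle0; exact: mxle1.
split; first by split=> //; rewrite det_ublock !det1 mulr1 pabs1.
move=> i j ji; rewrite /= (_ : block_mx _ _ _ _ i j = 0) ?pabs0 ?invr_ge0 //.
case: (split_ordP i) => i' iE; case: (split_ordP j) => j' jE; rewrite iE jE in ji *.
- by rewrite block_mxEul mxE -val_eqE /= gtn_eqF.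
- by move: ji; rewrite /= ltnNge (leq_trans (ltnW (ltn_ord i'))) ?leq_addr.
- by rewrite block_mxEdl mxE.
- by rewrite block_mxEdr mxE -val_eqE /= gtn_eqF //; move: ji; rewrite /= ltn_add2l.
Qed.

Variable pi : rep (GL K (n + n)) R[i].
Variable Sh : pi -> GL K (n + n) -> R[i].
Hypothesis Sh_model : shalika_model eta psi Sh.
Variable v0 : pi.
Hypothesis v0_iwahori : rep_invariants iwahori v0.

Lemma shalika_linear g : is_linear_form (fun v => Sh v g).
Proof.
move=> a u v; case: Sh_model => [[h _ _] _].
exact: h.
Qed.

Lemma shalika_act g v h : Sh (rep_act g v) h = Sh v (h * g)%g.
Proof. by case: Sh_model => [[_ _ e] _]; rewrite e. Qed.

Lemma shalika_eqv v (h : GL K n) (X : 'M[K]_n) g :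
  Sh v (blkdiag h h * blkunip X * g)%g = eta (\det h) * psi (\tr X) * Sh v g.
Proof. by case: Sh_model => _; apply. Qed.

Lemma shalika_iwahori g k : iwahori k -> Sh v0 (g * k)%g = Sh v0 g.
Proof. by move=> kI; rewrite -shalika_act (v0_iwahori kI). Qed.

Lemma blkdiag11 : blkdiag 1%g 1%g = 1%g :> GL K (n + n).
Proof. by apply: val_inj; rewrite /= -scalar_mx_block. Qed.

Lemma shalika_chi1 : eta 1 = 1 -> forall v (X : 'M[K]_n) g,
  Sh v (blkunip X * g)%g = psi (\tr X) * Sh v g.
Proof.
by move=> e1 v X g; rewrite -[in LHS](mul1g (blkunip X)) -blkdiag11 shalika_eqv det1 e1 mul1r.
Qed.

(** For integral X the Iwahori element [blkunip X] is absorbed on the right of diag(y, 1), while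
    moved to its left it contributes psi(tr(y X)). The elementary matrix X at (j, i) gives psi(y_ij)
    = 1 wherever the value is nonzero. *)
Lemma shalika_support (y : GL K n) : eta 1 = 1 ->
  Sh v0 (blkdiag y 1%g) != 0 -> mxle 1 y.
Proof.
move=> e1 y0 i j; rewrite leNgt; apply/negP => yij.
have /negP := addchar_neq1 p_pr psi_std yij; apply.
pose X : 'M[K]_n := delta_mx j i.
have X1 : mxle 1 X.
  by move=> k l; rewrite mxE; case: (_ && _); rewrite ?pabs1 ?pabs0.
have e : (blkdiag y 1 * blkunip X)%g = (blkunip (GLval y *m X) * blkdiag y 1)%g.
  apply: val_inj; rewrite /= !mulmx_block.
  by rewrite !(mulmx0, mul0mx, addr0, add0r, mulmx1, mul1mx).
have := shalika_iwahori (blkdiag y 1%g) (blkunip_iwahori X1).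
rewrite e shalika_chi1 // => /eqP; rewrite -subr_eq0 -[X in _ - X]mul1r -mulrBl.
rewrite mulf_eq0 (negPf y0) orbF subr_eq0.
rewrite (_ : \tr _ = y i j) //.
rewrite /mxtrace (bigD1 i) //= big1 => [|k ki]; last first.
  by rewrite mxE big1 // => l _; rewrite mxE (negPf ki) andbF mulr0.
rewrite addr0 mxE (bigD1 j) //= big1 => [|l lj]; last by rewrite mxE (negPf lj) mulr0.
by rewrite mxE !eqxx mulr1 addr0.
Qed.

Lemma rep_act_sum (I : Type) (r : seq I) (P : pred I) (F : I -> pi) g :
  rep_act g (\sum_(i <- r | P i) F i) = \sum_(i <- r | P i) rep_act g (F i).
Proof.
have D (u v : pi) : rep_act g (u + v) = rep_act g u + rep_act g v.
  by have := rep_linear g 1 u v; rewrite !scale1r.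
have Z0 : rep_act g (0 : pi) = 0 by apply: (addrI (rep_act g 0)); rewrite -D !addr0.
exact: (big_morph (rep_act g) D Z0).
Qed.

Lemma rep_actZ g a (v : pi) : rep_act g (a *: v) = a *: rep_act g v.
Proof.
have D (u w : pi) : rep_act g (u + w) = rep_act g u + rep_act g w.
  by have := rep_linear g 1 u w; rewrite !scale1r.
have Z0 : rep_act g (0 : pi) = 0 by apply: (addrI (rep_act g 0)); rewrite -D !addr0.
by have := rep_linear g a v 0; rewrite Z0 !addr0.
Qed.

Lemma linear_form_sum (f : pi -> R[i]) (I : Type) (r : seq I) (P : pred I) (F : I -> pi) :
  is_linear_form f -> f (\sum_(i <- r | P i) F i) = \sum_(i <- r | P i) f (F i).
Proof.
move=> fL; have D u v : f (u + v) = f u + f v.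
  by have := fL 1 u v; rewrite scale1r mul1r.
have f0 : f 0 = 0 by apply: (addrI (f 0)); rewrite -D !addr0.
exact: (big_morph f D f0).
Qed.

Lemma linear_formZ (f : pi -> R[i]) a v : is_linear_form f -> f (a *: v) = a * f v.
Proof.
move=> fL; have D u w : f (u + w) = f u + f w.
  by have := fL 1 u w; rewrite scale1r mul1r.
have f0 : f 0 = 0 by apply: (addrI (f 0)); rewrite -D !addr0.
by have := fL a v 0; rewrite f0 !addr0.
Qed.

Hypothesis eta_smooth : smooth_char eta.
Hypothesis pi_ps : unramified_principal_series pi.

(* pi^{K(m)} is finite dimensional, being embedded by a principal series in the
   functions on the finite set of residues mod p^m. Averaging diag(y, 1) v0 over
   K(m) changes neither its Shalika functional nor the growth in det y of the
   principal series function attached to it, and lands in this fixed finite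
   dimensional space, on which the Shalika functional is bounded. *)
Lemma shalika_growth : exists (C : R) (A : nat), 0 <= C /\
  forall y : GL K n, mxle 1 y ->
    normc (Sh v0 (blkdiag y 1%g)) <= C * pabs (\det y) ^- A.
Proof.
have [eta_char [m' etam']] := eta_smooth.
(* At level m' the character eta is trivial, which gives eta(det h) = 1 on K(m); the successor
   guarantees that K(m) is a group. *)
pose m := m'.+1; have m0 : (0 < m)%N by [].
have eta1 (h : GL K n) : pcong m h -> eta (\det h) = 1.
  move=> hm; apply: etam'; have [h1 hd] := pcong_GLint p_pr m0 hm; split=> //.
  rewrite -(det1 K n); apply: pabs_det_cong => //; first exact: mxle1.
  by apply: mxle_trans hm _; apply: pexpN_le.
have [theta [L [unr [L1 L2 L3] Lr]]] := pi_ps.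
have LL g : is_linear_form (fun v => L v g) by move=> a u v; apply: L1.
have Lact g v h : L (rep_act g v) h = L v (h * g)%g by rewrite L3.
have Lps v : parabolic_ind theta (L v) by rewrite -Lr; exists v.
pose G := (n + n)%N.
have sG := @GLint_subgroup p R K G.
have sm := pcong_subgroup p_pr m0 (K := K) (n := G).
have mI := pcong_GLint p_pr m0 (K := K) (n := G).
pose inv : set pi := [set v | forall k : GL K G, pcong m k -> rep_act k v = v].
have Linv v : inv v -> rinvariant m (L v) by move=> vi g k km; rewrite -Lact vi.
have [A hA] := parabolic_ind_growth p_pr unr.
have v0m : inv v0 by move=> k km; apply: v0_iwahori; apply: (pcong_iwahori p_pr m0).
have [S S0 hS] := hA m (L v0) m0 (Linv _ v0m) (Lps v0).
pose T := 'M['I_(p ^ m)]_G.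
(* Coordinates on the K(m)-invariants: values of L v at representatives of GL_2n(Z_p) / K(m), and 0
   at the other residue matrices. *)
pose ev (i : 'I_#|{: T}|) (v : pi) : R[i] :=
  if reps m (@GLint p R K G) (enum_val i) then L v (toGL (resmx (enum_val i))) else 0.
have [|||v vi v0'|c c0 hc] := @bounded_linear_form R pi _ inv ev (fun v => Sh v 1%g).
- move=> a u v ui vi k km; have := rep_linear k a u v.
  by rewrite ui // vi.
- move=> i a u v; rewrite /ev; case: ifP => _; last by rewrite mulr0 addr0.
  exact: LL.
- exact: shalika_linear.
- suff -> : v = 0 by have := linear_formZ 0 0 (shalika_linear 1%g); rewrite scale0r mul0r.
  apply: L2; apply/funext => g; have L0 : L 0 g = 0.
    by have := linear_formZ 0 0 (LL g); rewrite scale0r mul0r.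
  rewrite L0; apply: (parabolic_ind_eq0 (Lps v)) => k kI.
  have [a ra ka] := reps_cover p_pr m0 sG (fun g gI => gI) mI kI.
  rewrite -(mulKVg (toGL (resmx a)) k) Linv //.
  by have := v0' (enum_rank a); rewrite /ev enum_rankK ra.
exists (c * S), A; split; first exact: mulr_ge0.
move=> y y1; pose yy := blkdiag y 1%g.
have yy1 : mxle 1 yy by apply: mxle_blkdiag1.
have Shk k : pcong m k -> Sh v0 (k * yy)%g = Sh v0 yy.
  move=> km; have [h [X [r [hm X1 rm ->]]]] := pcong_shalika m0 km y1.
  rewrite shalika_eqv eta1 // addchar_int //; last first.
    by apply: pabs_sum_le => // i _; apply: X1.
  by rewrite !mul1r shalika_iwahori //; apply: (pcong_iwahori p_pr m0).
(* N depends on y: the translate u of v0 is fixed only by some K(M) that shrinks with y, and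
   averaging over K(m) / K(M) brings it back to the invariants of the fixed K(m). *)
have [N N0 hN] := pcong_conj_exists p_pr m yy.
pose M := maxn N m; have M0 : (0 < M)%N by rewrite leq_max m0 orbT.
have MC := @pcong_le p R K G p_pr _ _ (leq_maxr N m).
pose u := rep_act yy v0.
have uM h k : pcong m h -> pcong M k -> rep_act (h * k)%g u = rep_act h u.
  move=> _ kM; rewrite rep_actM; congr rep_act.
  rewrite /u -rep_actM -[(k * yy)%g](mulKVg yy) rep_actM; congr rep_act.
  by rewrite mulgA; apply/v0m/hN/(pcong_le p_pr (leq_maxl N m)).
pose q : R[i] := #|reps M (@pcong p R K G m)|%:R.
have q0 : q != 0.
  rewrite pnatr_eq0 -lt0n; have [a ra _] := reps_cover p_pr M0 sm mI MC (let: And3 x _ _ := sm in x).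
  by apply/card_gt0P; exists a.
pose w := q^-1 *: \sum_(a | reps M (@pcong p R K G m) a) rep_act (toGL (resmx a)) u.
have wi : inv w.
  move=> k km; rewrite rep_actZ rep_act_sum; congr (_ *: _).
  rewrite -(sum_reps_mull p_pr M0 sm mI MC uM km).
  by apply: eq_bigr => a _; rewrite rep_actM.
have avg (B : R) (F : GL K G -> R[i]) : (forall k, pcong m k -> normc (F k) <= B) ->
    normc (q^-1 * \sum_(a | reps M (@pcong p R K G m) a) F (toGL (resmx a))) <= B.
  move=> hF; rewrite normcM normcV.
  have qn : normc q = #|reps M (@pcong p R K G m)|%:R.
    by rewrite /q -(rmorph_nat (real_complex R)) normc_real ger0_norm.
  have qn0 : 0 < normc q.
    by rewrite qn ltr0n lt0n; move: q0; rewrite pnatr_eq0.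
  rewrite ler_pdivrMl // (le_trans (normc_sum_le _ _ _)) //.
  rewrite qn mulr_natl -sumr_const ler_sum // => a ra; apply: hF.
  by case: (reps_GL mI ra).
have SE : Sh w 1%g = Sh v0 yy.
  rewrite /w (linear_formZ _ _ (shalika_linear 1%g)) (linear_form_sum _ _ _ (shalika_linear 1%g)).
  apply: (mulfI q0); rewrite mulVKf // /q mulr_natl -sumr_const.
  apply: eq_bigr => a ra; have [am _ _] := reps_GL mI ra.
  by rewrite !shalika_act mul1g Shk.
rewrite -SE -mulrA; apply: hc => //.
  by rewrite mulr_ge0 // invr_ge0 exprn_ge0 // pabs_ge0.
move=> i; rewrite /ev; case: ifP => [ri|_]; last first.
  by rewrite normc0 mulr_ge0 // invr_ge0 exprn_ge0 // pabs_ge0.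
have [_ [k1 kd] _] := reps_GL (fun g gI => gI) ri.
set k := toGL _ in k1 kd *.
rewrite /w (linear_formZ _ _ (LL k)) (linear_form_sum _ _ _ (LL k)).
apply: (avg _ (fun h => L (rep_act h u) k)) => h hm.
rewrite Lact /u Lact; have [h1 hd] := mI _ hm.
have -> : pabs (\det y) = pabs (\det (k * h * yy)%g).
  by rewrite !detM !pabsM kd hd !mul1r det_blkdiag1.
by apply: hS; do 2! (apply: mxleM1l => //).
Qed.

End shalika_growth.

(** * Convergence and analytic continuation *)

Section convergence.
Context {p : nat} {R : realType} {K : padicFieldType p R} {n : nat}.
Hypothesis p_pr : prime p.
Variable mu : {measure set (borel (GL K n)) -> \bar R}.
Hypothesis mu_haar : haar_measure mu.

Let expN_ge0 M : 0 <= p%:R ^- M :> R.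
Proof. by rewrite ltW // pexpN_gt0. Qed.

Let p_gt0 : 0 < p%:R :> R. Proof. by rewrite ltr0n prime_gt0. Qed.
Let p_gt1 : 1 < p%:R :> R. Proof. by rewrite ltr1n prime_gt1. Qed.

Definition det_shell (k : nat) : set (GL K n) :=
  [set g | mxle 1 g /\ pabs (\det g) = p%:R ^- k].

Lemma measurable_det_shell k : measurable (det_shell k : set (borel (GL K n))).
Proof.
apply: open_measurable; apply: (rinvariant_open p_pr (ltn0Sn 0)) => g h [g1 gd] hM.
have [h1 hd] := pcong_GLint p_pr (ltn0Sn 0) hM.
by split; [exact: mxleM1l|rewrite detM pabsM gd hd mulr1].
Qed.

(* g K(1) is determined by g mod p^(k+1) when |det g| = p^-k, because p^k g^-1
   is integral. *)
Lemma det_shell_measure k :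
  (mu (det_shell k) <= ((p ^ k.+1) ^ (n * n))%:R%:E * mu (pcong 1))%E.
Proof.
pose P (a : 'M['I_(p ^ k.+1)]_n) (g : GL K n) :=
  det_shell k g /\ mxle (p%:R ^- k.+1) (GLval g - resmx a).
(* A point is chosen in each residue class meeting the shell; for the other classes 1 is a dummy
   value. *)
have h a : exists y : GL K n, (exists x, P a x) -> P a y.
  have [[x Px]|hn] := pselect (exists x, P a x); first by exists x.
  by exists 1%g.
have [g hg] := choice h.
have sub : det_shell k `<=`
    \big[setU/set0]_(a <- index_enum 'M['I_(p ^ k.+1)]_n | true) coset 1 (g a).
  move=> x xk; have [a xa] := resmx_exists p_pr k.+1 xk.1.
  apply/bigsetU_exists; exists a; split; rewrite ?mem_index_enum //.
  have [[ga1 gad] gar] := hg a (ex_intro _ x (conj xk xa)).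
  rewrite /coset /= pcongE GLvalM.
  have -> : GLval (g a)^-1%g *m GLval x - 1%:M = GLval (g a)^-1%g *m (GLval x - GLval (g a)).
    by rewrite mulmxBr -[GLval (g a)^-1%g *m GLval (g a)]GLvalM mulVg.
  have -> : p%:R ^- 1 = p%:R ^+ k * p%:R ^- k.+1 :> R.
    by rewrite expr1 exprSr invfM mulrA mulfV ?mul1r // gt_eqF // exprn_gt0.
  apply: mxleM => //.
    by have := mxle_inv ga1 (GLvalP (g a)); rewrite gad invrK.
  by apply: mxle_dist_trans xa _; apply: mxle_distC.
have m1 a : measurable (coset 1 (g a) : set (borel (GL K n))).
  exact: measurable_coset.
apply: le_trans (le_measure mu _ _ sub) _.
- by rewrite inE; apply: measurable_det_shell.
- by rewrite inE; apply: bigsetU_measurable => a _.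
apply: le_trans (measure_bigsetU_le mu _ _) _ => //.
rewrite (eq_bigr (fun=> mu (pcong 1))); last first.
  by move=> a _; rewrite left_invariant_coset //; apply: haar_left_invariant.
by rewrite sumr_const mule_natl card_mx card_ord.
Qed.

Lemma geometric_le N : \sum_(0 <= k < N) p%:R ^- k <= (1 - p%:R^-1)^-1 :> R.
Proof.
have q1 : 0 < 1 - p%:R^-1 :> R by rewrite subr_gt0 invf_lt1.
rewrite -[leRHS]mul1r ler_pdivlMr // mulrC.
have := subrX1 (p%:R^-1 : R) N; rewrite big_mkord => e.
rewrite (eq_bigr (fun i : 'I_N => p%:R^-1 ^+ i)); last by move=> i _; rewrite exprVn.
rewrite -opprB mulNr -e opprB lerBlDr lerDl exprVn; exact: expN_ge0.
Qed.

(** On the shell |det g| = p^-k the volume is O(p^(k n^2)) and h is O(p^(-k (n^2 + 1))), which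
    leaves a geometric series of ratio 1/p. *)
Lemma cintegrable_growth M (h : GL K n -> R[i]) (C : R) : (0 < M)%N ->
  rinvariant M h -> 0 <= C ->
  (forall g, h g != 0 -> mxle 1 g) ->
  (forall g : GL K n, mxle 1 g -> normc (h g) <= C * pabs (\det g) ^+ (n * n).+1) ->
  cintegrable mu setT h.
Proof.
move=> M0 hM C0 h0 hC.
pose c k : R := C * p%:R ^- (k * (n * n).+1).
have c0 k : 0 <= c k by rewrite mulr_ge0.
pose f k (g : borel (GL K n)) : \bar R := (c k * \1_(det_shell k) g)%:E.
have f0 k g : (0 <= f k g)%E by rewrite lee_fin mulr_ge0.
have mf k : measurable_fun setT (f k).
  apply/measurable_EFinP; apply: measurable_funM => //.
  by apply: measurable_indic; apply: measurable_det_shell.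
pose b (g : borel (GL K n)) : \bar R := (\sum_(0 <= k <oo) f k g)%E.
apply: (@cintegrable_bound _ _ _ mu h b).
- exact: rinvariant_cmeasurable hM.
- by apply: ge0_emeasurable_sum.
- move=> g; have [hg0|/h0 g1] := eqVneq (h g) 0.
    by rewrite hg0 normc0; apply: nneseries_ge0.
  have d1 : pabs (\det g) <= p%:R ^- 0 by rewrite expr0 invr1 pabs_det_le1.
  have [k _ dk] := pabs_le_expN p_pr (det_neq0 g) d1.
  apply: (@le_trans _ _ (f k g)).
    rewrite /f indicE mem_set // mulr1 lee_fin /c.
    by apply: le_trans (hC g g1) _; rewrite dk exprVn -exprM.
  have := @nneseries_lim_ge R (fun k => f k g) xpredT 0 k.+1 (fun i _ _ => f0 i g).
  apply: le_trans; rewrite big_nat_recr //=; apply: leeDr.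
  by apply: sume_ge0 => i _.
- rewrite /b integral_nneseries //.
  have [v v0 hv] : exists2 v : R, 0 <= v & mu (pcong 1) = v%:E.
    have := haar_pcong_fin p_pr mu_haar (ltn0Sn 0).
    have : (0 <= mu (pcong 1))%E by [].
    by case: (mu (pcong 1)) => [r| |] //; rewrite lee_fin => r0 _; exists r.
  pose D : R := C * v * p%:R ^+ (n * n).
  have D0 : 0 <= D by rewrite mulr_ge0 ?mulr_ge0 // exprn_ge0 // ltW.
  have le1 k : (\int[mu]_g f k g <= (D * p%:R ^- k)%:E)%E.
    rewrite /f; under eq_integral do rewrite EFinM.
    rewrite ge0_integralZl_EFin //; last first.
      by apply/measurable_EFinP; apply: measurable_indic; exact: measurable_det_shell.
    rewrite integral_indic ?setIT //; last exact: measurable_det_shell.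
    apply: le_trans (lee_wpmul2l _ (det_shell_measure k)) _; first by rewrite lee_fin.
    rewrite hv -!EFinM lee_fin /c /D -expnM natrX.
    have p0 : p%:R != 0 :> R by rewrite gt_eqF.
    have -> : (k.+1 * (n * n) = k * (n * n) + n * n)%N by rewrite mulSn addnC.
    have -> : (k * (n * n).+1 = k * (n * n) + k)%N by rewrite mulnS addnC.
    rewrite !exprD; set x := p%:R ^+ (k * _); have x0 : x != 0 by rewrite expf_neq0.
    have y0 : p%:R ^+ k != 0 :> R by rewrite expf_neq0.
    by rewrite le_eqVlt; apply/orP; left; apply/eqP; field; rewrite x0 y0.
  apply: (@le_lt_trans _ _ (\sum_(0 <= k <oo) (D * p%:R ^- k)%:E)%E).
    by apply: lee_nneseries => [k _ _|k _]; [apply: integral_ge0|exact: le1].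
  apply: (@le_lt_trans _ _ (D * (1 - p%:R^-1)^-1)%:E); last exact: ltry.
  apply: lime_le.
    by apply: is_cvg_nneseries => k _ _; rewrite lee_fin mulr_ge0.
  apply: nearW => N; rewrite sumEFin lee_fin -mulr_sumr ler_wpM2l //.
  exact: geometric_le.
Qed.

End convergence.

(** * Holomorphy of complex powers *)

Section complex_powers.
Context {R : realType}.
Implicit Types (x y : R) (s z w : R[i]).

Lemma cpow1 s : cpow (1 : R) s = 1.
Proof. by rewrite /cpow ln1 !mulr0 expR0 cos0 sin0 mulr0 mulr1. Qed.

Lemma cpowMl x y s : 0 < x -> 0 < y -> cpow (x * y) s = cpow x s * cpow y s.
Proof.
move=> x0 y0; rewrite /cpow lnM ?posrE // !mulrDr expRD cosD sinD.
by apply/eqP; rewrite eq_complex /=; apply/andP; split; apply/eqP; ring.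
Qed.

Lemma cpowDr x s z : cpow x (s + z) = cpow x s * cpow x z.
Proof.
rewrite /cpow Re_add Im_add !mulrDl expRD cosD sinD.
by apply/eqP; rewrite eq_complex /=; apply/andP; split; apply/eqP; ring.
Qed.

Lemma Re_natM k s : complex.Re (k%:R * s) = k%:R * complex.Re s.
Proof. by rewrite -(rmorph_nat (real_complex R)) Re_mul /= mul0r subr0. Qed.

Lemma Im_natM k s : complex.Im (k%:R * s) = k%:R * complex.Im s.
Proof. by rewrite -(rmorph_nat (real_complex R)) Im_mul /= mul0r addr0. Qed.

Lemma cpowXl x k s : 0 < x -> cpow (x ^+ k) s = cpow x (k%:R * s).
Proof.
by move=> x0; rewrite /cpow lnXn // Re_natM Im_natM -[ln x *+ k]mulr_natl !mulrA
  [complex.Re s * _]mulrC [complex.Im s * _]mulrC.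
Qed.

Lemma normc_cpow x s : normc (cpow x s) = expR (complex.Re s * ln x).
Proof.
by rewrite /cpow /= !exprMn -mulrDr cos2Dsin2 mulr1 sqrtr_sqr ger0_norm.
Qed.

Lemma is_derive_approx (f : R -> R) (a l e : R) : is_derive a 1 f l -> 0 < e ->
  exists2 d : R, 0 < d &
    forall x, `|x| < d -> `|f (x + a) - f a - l * x| <= e * `|x|.
Proof.
move=> [dE vE] e0.
have := dE; rewrite /derivable => /(cvgP _) _.
have : h^-1 *: ((f \o shift a) (h *: (1 : R)) - f a) @[h --> 0^'] --> 'D_1 f a by exact: dE.
rewrite vE => /cvgrPdist_lt /(_ e e0); rewrite near_withinE => /nbhs_ballP[d /= d0 hd].
exists d => // x xd; have [->|x0] := eqVneq x 0.
  by rewrite add0r subrr mulr0 subr0 normr0 mulr0.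
have := hd x; rewrite /ball /= sub0r normrN => /(_ xd x0).
rewrite /= /GRing.scale /= mulr1 => h.
have -> : f (x + a) - f a - l * x = - (x * (l - x^-1 * (f (x + a) - f a))).
  by rewrite mulrBr mulrA mulfV // mul1r opprB mulrC.
by rewrite normrN normrM mulrC ler_wpM2r // ltW.
Qed.

(** This is complex differentiability of exp at 0, assembled from the real derivatives of exp, cos
    and sin since [cpow] is given by its real and imaginary parts. *)
Lemma cexp_approx (e : R) : 0 < e -> exists2 d : R, 0 < d & forall x y,
  `|x| < d -> `|y| < d ->
  normc ((expR x * cos y +i* (expR x * sin y))%C - 1 - (x +i* y)%C) <= e * (`|x| + `|y|).
Proof.
(* The errors below add up to e'|x| + 6 e'|y|, which explains e / 8; the bound 1 / 2 gives exp x <=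
   2. *)
move=> e0; have [e' [e'0 e'e e'1]] : exists e' : R, [/\ 0 < e', e' <= e / 8 & e' <= 1 / 2].
  exists (Num.min (e / 8) (1 / 2)).
  by rewrite lt_min !divr_gt0 //= !ge_min !lexx orbT.
have [d1 d10 h1] := is_derive_approx (is_derive_expR 0) e'0.
have [d2 d20 h2] := is_derive_approx (is_derive_cos 0) e'0.
have [d3 d30 h3] := is_derive_approx (is_derive_sin 0) e'0.
pose d := Num.min (Num.min d1 d2) (Num.min d3 e').
exists d; first by rewrite !lt_min d10 d20 d30.
move=> x y; rewrite !lt_min => /andP[/andP[xd1 xd2] /andP[xd3 xe]].
move=> /andP[/andP[yd1 yd2] /andP[yd3 ye]].
have := h1 x xd1; have := h2 y yd2; have := h3 y yd3.
rewrite !addr0 expR0 cos0 sin0 oppr0 mul0r !subr0 !mul1r ?addr0 => hs hc hx.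
set E := expR x in hx *; set c := cos y in hc *; set s := sin y in hs *.
have nle (z : R[i]) : normc z <= `|complex.Re z| + `|complex.Im z|.
  case: z => a b; have -> : (a +i* b = a%:C + (0 +i* b))%C.
    by apply/eqP; rewrite eq_complex /= addr0 add0r !eqxx.
  rewrite (le_trans (normcD_le _ _)) // normc_real /= addr0 add0r.
  by rewrite expr0n add0r sqrtr_sqr.
apply: le_trans (nle _) _; rewrite /= subr0.
have E0 : 0 < E by apply: expR_gt0.
have x0 : 0 <= `|x| by []. have y0 : 0 <= `|y| by [].
have EE : `|E - 1| <= 2 * `|x|.
  have -> : E - 1 = (E - 1 - x) + x by rewrite subrK.
  by rewrite (le_trans (ler_normD _ _)) //; nra.
have E2 : E <= 2.
  have : E - 1 <= `|E - 1| by apply: ler_norm.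
  lra.
have hR : `|E * c - 1 - x| <= e' * `|x| + 2 * e' * `|y|.
  have -> : E * c - 1 - x = (E - 1 - x) + E * (c - 1) by ring.
  rewrite (le_trans (ler_normD _ _)) // lerD // normrM (gtr0_norm E0).
  have : E * `|c - 1| <= 2 * `|c - 1| by rewrite ler_wpM2r.
  lra.
have hI : `|E * s - y| <= 2 * e' * `|y| + 2 * e' * `|y|.
  have -> : E * s - y = E * (s - y) + (E - 1) * y by ring.
  rewrite (le_trans (ler_normD _ _)) // lerD // normrM.
    rewrite (gtr0_norm E0).
    have : E * `|s - y| <= 2 * `|s - y| by rewrite ler_wpM2r.
    lra.
  have : `|E - 1| <= 2 * e' by lra.
  by move=> h; rewrite ler_wpM2r.
apply: le_trans (lerD hR hI) _.
have : e' * `|x| <= e / 8 * `|x| by rewrite ler_wpM2r.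
have : e' * `|y| <= e / 8 * `|y| by rewrite ler_wpM2r.
have : 0 <= e * `|x| by rewrite mulr_ge0 // ltW.
have : 0 <= e * `|y| by rewrite mulr_ge0 // ltW.
lra.
Qed.

(** The functional equation f(h + z) = f(z) q^(r h) reduces the claim to the derivative k = r ln q
    of q^(r h) at h = 0. *)
Lemma derivable_cpow (c a : R[i]) (q r : R) (z : R[i]) :
  derivable ((fun s => c * cpow q (r%:C%C * (s - a))) : R[i]^o -> R[i]^o) z 1.
Proof.
pose f s := c * cpow q (r%:C%C * (s - a)).
pose k : R := r * ln q.
have ReR (t : R) s : complex.Re (t%:C%C * s) = t * complex.Re s.
  by rewrite Re_mul /= mul0r subr0.
have ImR (t : R) s : complex.Im (t%:C%C * s) = t * complex.Im s.
  by rewrite Im_mul /= mul0r addr0.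
have fE h : f (h + z) - f z = f z * (cpow q (r%:C%C * h) - 1).
  have -> : f (h + z) = f z * cpow q (r%:C%C * h).
    by rewrite /f -mulrA -cpowDr; congr (_ * cpow q _); ring.
  by rewrite mulrBr mulr1.
apply/cvg_ex; exists (f z * k%:C%C : R[i]^o).
apply/cvgrPdist_lt => eps eps0.
have [e e0 epsE] : exists2 e : R, 0 < e & eps = e%:C%C.
  move: eps0; case: eps => e i; rewrite ltcE /= => /andP[/eqP i0 e0].
  by exists e => //; rewrite i0.
(* The summand 1, here and in |k| + 1, keeps the denominators positive. *)
pose B := normc (f z) * `|k| + 1.
have B0 : 0 < B by rewrite ltr_wpDl // mulr_ge0 // normc_ge0.
have e'0 : 0 < e / (4 * B) by rewrite divr_gt0 // mulr_gt0.
have [d d0 hd] := cexp_approx e'0.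
have d'0 : 0 < d / (`|k| + 1) by rewrite divr_gt0 // ltr_wpDl.
rewrite near_withinE; apply/nbhs_ballP; exists (d / (`|k| + 1))%:C%C; first by rewrite /= ltcR.
move=> h /=; rewrite /ball /= sub0r normrN => hlt h0.
have nE (w : R[i]) : `|w| = (normc w)%:C%C by [].
have {}hlt : normc h < d / (`|k| + 1) by rewrite -ltcR -nE.
rewrite epsE nE ltcR /GRing.scale /= mulr1 fE.
pose x := k * complex.Re h; pose y := k * complex.Im h.
pose err := cpow q (r%:C%C * h) - 1 - (x +i* y)%C.
have kh : (x +i* y)%C = k%:C%C * h.
  by apply/eqP; rewrite eq_complex /= ReR ImR !eqxx.
have hk t : `|t| <= normc h -> `|k * t| <= `|k| * normc h.
  by move=> ht; rewrite normrM ler_wpM2l.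
have kd : `|k| * normc h < d.
  apply: le_lt_trans (_ : (`|k| + 1) * normc h < d).
    by rewrite ler_wpM2r ?normc_ge0 // lerDl.
  by rewrite mulrC -ltr_pdivlMr // ltr_wpDl.
have xh := hk _ (normc_Re h); have yh := hk _ (normc_Im h).
have errE : normc err <= e / (4 * B) * (`|x| + `|y|).
  have := hd x y (le_lt_trans xh kd) (le_lt_trans yh kd).
  rewrite /err /cpow ReR ImR.
  have -> : r * complex.Re h * ln q = x by rewrite /x /k mulrAC.
  by have -> : r * complex.Im h * ln q = y by rewrite /y /k mulrAC.
have -> : f z * k%:C%C - h^-1 * (f z * (cpow q (r%:C%C * h) - 1)) = - (f z * (h^-1 * err)).
  rewrite /err kh; field.
  exact: h0.
rewrite (normcN (_ : R[i])) (normcM (f z)) (normcM h^-1) normcV.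
have nh0 : 0 < normc h.
  rewrite lt_def normc_ge0 andbT; apply: contra h0 => /eqP /eq0_normc ->.
  by [].
have le2 : (normc h)^-1 * normc err <= e / (4 * B) * (2 * `|k|).
  rewrite ler_pdivrMl // (le_trans errE) // mulrCA ler_wpM2l ?(ltW e'0) //.
  by rewrite /x /y in xh yh *; lra.
apply: le_lt_trans (ler_wpM2l (normc_ge0 _) le2) _.
have -> : normc (f z) * (e / (4 * B) * (2 * `|k|)) = e / 2 * (normc (f z) * `|k| / B).
  by field; rewrite gt_eqF.
have h1 : normc (f z) * `|k| / B <= 1 by rewrite ler_pdivrMr // mul1r lerDl.
have : e / 2 * (normc (f z) * `|k| / B) <= e / 2 * 1 by rewrite ler_wpM2l // divr_ge0 // ltW.
lra.
Qed.

Lemma meromorphic_cpow (c a : R[i]) (q r : R) :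
  meromorphic (fun s => c * cpow q (r%:C%C * (s - a))).
Proof.
move=> z0; exists 0, (fun s => c * cpow q (r%:C%C * (s - a))); split => //.
  rewrite /holomorphic_near; near=> z; exact: derivable_cpow.
by near=> z; rewrite expr0 divr1.
Unshelve. all: by end_near.
Qed.

End complex_powers.

(** * The zeta integral *)

Section shalika_elements.
Context {p : nat} {R : realType} {K : padicFieldType p R} {n : nat}.
Hypothesis p_pr : prime p.
Implicit Types x y g : GL K n.

Lemma scalarGL_subproof (c : K) : c != 0 -> (c%:M : 'M[K]_n) \in unitmx.
Proof. by move=> c0; rewrite unitmxE det_scalar unitfE expf_neq0. Qed.

Definition scalarGL (c : K) (c0 : c != 0) : GL K n := MkGL (scalarGL_subproof c0).

Lemma scalarGL_central c (c0 : c != 0) g : (scalarGL c0 * g = g * scalarGL c0)%g.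
Proof. by apply: val_inj; rewrite /= scalar_mxC. Qed.

Lemma blkdiagM x y x' y' :
  (blkdiag x y * blkdiag x' y')%g = blkdiag (x * x')%g (y * y')%g.
Proof.
by apply: val_inj; rewrite /= mulmx_block !mulmx0 !mul0mx !addr0 !add0r.
Qed.

Lemma blkdiagX x y k : (blkdiag x y ^+ k)%g = blkdiag (x ^+ k)%g (y ^+ k)%g.
Proof. by elim: k => [|k IH]; rewrite ?expg0 ?blkdiag11 // !expgS IH blkdiagM. Qed.

Lemma blkunipV (X : 'M[K]_n) : (blkunip X)^-1%g = blkunip (- X).
Proof.
apply: (mulgI (blkunip X)); rewrite mulgV; apply: val_inj.
rewrite /= mulmx_block !mulmx0 !mul0mx !mulmx1 !mul1mx !addr0 !add0r addNr.
by rewrite -scalar_mx_block.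
Qed.

Lemma det_pX_neq0 k : (p%:R : K) ^+ k != 0.
Proof. by rewrite expf_neq0 // padicp_neq0. Qed.

Lemma pdiag_blkdiag : pdiag p_pr = blkdiag (scalarGL (det_pX_neq0 n) * pdiag p_pr)%g (pdiag p_pr)
  :> GL K (n + n).
Proof.
apply: val_inj; rewrite /= mul_scalar_mx; apply/matrixP => i j; rewrite /pdiag_mx.
case: (split_ordP i) => i' ->; case: (split_ordP j) => j' ->.
- rewrite block_mxEul !mxE (inj_eq (@lshift_inj _ _)); case: eqP => [->|]; rewrite ?mulr0n ?mulr0 //=.
  by rewrite !mulr1n -exprD; congr (_ ^+ _); have := ltn_ord j'; lia.
- rewrite block_mxEur !mxE; case: eqP => // e; have := congr1 val e => /= ij.
  by have := ltn_ord i'; rewrite ij ltnNge leq_addr.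
- rewrite block_mxEdl !mxE; case: eqP => // e; have := congr1 val e => /= ij.
  by have := ltn_ord j'; rewrite -ij ltnNge leq_addr.
- rewrite block_mxEdr !mxE (inj_eq (@rshift_inj _ _)); case: eqP => [->|] //=.
  by rewrite !mulr1n; congr (_ ^+ _); have := ltn_ord j'; lia.
Qed.

Lemma antidiagK : (antidiag * antidiag = 1 :> GL K n)%g.
Proof.
apply: val_inj; apply/matrixP => i j; rewrite /= !mxE (bigD1 (rev_ord i)) //=.
rewrite !mxE eqxx mul1r rev_ordK big1 ?addr0 1?eq_sym // => k ki.
by rewrite !mxE (negPf ki) mul0r.
Qed.

Lemma antidiag_GLint : GLint (antidiag : GL K n).
Proof.
have w1 : mxle 1 (antidiag : GL K n).
  by move=> i j; rewrite mxE pabs_nat_le1.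
split=> //; have := congr1 (fun g : GL K n => pabs (\det g)) antidiagK.
rewrite detM pabsM det1 pabs1 => /eqP; rewrite -expr2 sqrf_eq1 => /orP[/eqP//|/eqP e].
by have := pabs_ge0 (\det (antidiag : GL K n)); rewrite e oppr_ge0 ler10.
Qed.

Lemma pdiagX_val b i j : (pdiag p_pr ^+ b : GL K n)%g i j = (p%:R ^+ (b * (n - i.+1))) *+ (i == j).
Proof.
elim: b => [|b IH] in i j *; first by rewrite expg0 mul0n expr0 !mxE.
rewrite expgS GLvalM mxE (bigD1 i) //= big1 => [|k ki]; last first.
  by rewrite !mxE eq_sym (negPf ki) mul0r.
rewrite addr0 IH !mxE eqxx mulr1n mulrnAr -exprD; congr (_ ^+ _ *+ _).
Qed.

(* Conjugation by w reverses the diagonal of z^b. *)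
Lemma pdiag_antidiag b :
  (pdiag p_pr ^+ b * antidiag * pdiag p_pr ^+ b = scalarGL (det_pX_neq0 (b * n.-1)) * antidiag
   :> GL K n)%g.
Proof.
apply: val_inj; apply/matrixP => i j; rewrite /= mul_scalar_mx !mxE.
rewrite (bigD1 j) //= big1 => [|k kj]; last by rewrite pdiagX_val (negPf kj) mulr0.
rewrite addr0 !mxE (bigD1 i) //= big1 => [|k ki]; last first.
  by rewrite pdiagX_val eq_sym (negPf ki) mul0r.
rewrite addr0 !mxE !pdiagX_val !eqxx !mulr1n; case: eqP => [->|_]; last by rewrite !mulr0 mul0r.
rewrite !mulr1 -exprD -mulnDr; congr (_ ^+ (_ * _)).
by rewrite /=; have := ltn_ord i; lia.
Qed.

End shalika_elements.

(** * The change of variables in the zeta integral *)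

Section zeta_substitution.
Context {p : nat} {R : realType} {K : padicFieldType p R} {n : nat}.
Hypothesis p_pr : prime p.
Implicit Types x y g : GL K n.

Lemma blkunip_blkdiag (X : 'M[K]_n) g :
  (blkunip X * blkdiag g g = blkdiag g g * blkunip (GLval g^-1 *m X *m g))%g.
Proof.
apply: val_inj; rewrite /= !mulmx_block !mulmx0 !mul0mx !mul1mx !mulmx1 !addr0 !add0r.
by rewrite !mulmxA mulmxV ?GLvalP // mul1mx.
Qed.

Lemma blkdiag_blkunip x (X : 'M[K]_n) :
  (blkdiag x 1 * blkunip X = blkunip (GLval x *m X) * blkdiag x 1)%g.
Proof.
by apply: val_inj; rewrite /= !mulmx_block !mulmx0 !mul0mx !mul1mx !mulmx1 !addr0 !add0r.
Qed.

Lemma scalar_pX_split b : (0 < n)%N -> (scalarGL (det_pX_neq0 p_pr n) ^+ b =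
  scalarGL (det_pX_neq0 p_pr b) * scalarGL (det_pX_neq0 p_pr (b * n.-1)) :> GL K n)%g.
Proof.
move=> n0; have -> k : (scalarGL (det_pX_neq0 p_pr n) ^+ k)%g =
    scalarGL (det_pX_neq0 p_pr (n * k)) :> GL K n.
  elim: k => [|k IH]; first by apply: val_inj; rewrite expg0 /= muln0 expr0.
  by apply: val_inj; rewrite expgS IH /= -scalar_mxM -exprD mulnS.
apply: val_inj; rewrite /= -scalar_mxM -exprD; congr ((_ ^+ _)%:M).
by case: n n0 => // m _; rewrite /= mulSn mulnC.
Qed.

Lemma oppGL_subproof : (-1 : K) != 0.
Proof. by rewrite oppr_eq0 oner_neq0. Qed.

Definition oppGL : GL K n := scalarGL oppGL_subproof.

Lemma iwahori_blkdiag1 g : iwahori g -> iwahori (blkdiag g 1%g).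
Proof.
move=> [[g1 gd] gl]; split; first split.
- by apply: mxle_block; [exact: g1|apply: mxle0 => //|apply: mxle0 => //|apply: mxle1].
- by rewrite det_blkdiag1.
move=> i j; rewrite /=; case: (split_ordP i) => i' ->; case: (split_ordP j) => j' ->.
- by rewrite block_mxEul; apply: gl.
- by rewrite block_mxEur mxE pabs0 invr_ge0.
- by rewrite block_mxEdl mxE pabs0 invr_ge0.
- rewrite block_mxEdr mxE /= ltn_add2l => ji.
  by case: eqP => [e|_]; [rewrite e ltnn in ji|rewrite pabs0 invr_ge0].
Qed.

Lemma iwahori_oppGL : iwahori oppGL.
Proof.
split; first split.
- by move=> i j; rewrite mxE; case: eqP => _; rewrite ?mulr1n ?pabsN ?pabs1 ?pabs0.
- by rewrite /= det_scalar pabsX pabsN pabs1 expr1n.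
by move=> i j ji; rewrite mxE; case: eqP => [e|_]; [rewrite e ltnn in ji|rewrite pabs0 invr_ge0].
Qed.

Hypothesis n_gt0 : (0 < n)%N.
Variables (psi eta chi : K -> R[i]) (b : nat).
Hypothesis chi_char : mchar chi.
Hypothesis chi_p : chi p%:R = 1.
Variable pi : rep (GL K (n + n)) R[i].
Variable Sh : pi -> GL K (n + n) -> R[i].
Hypothesis Sh_model : shalika_model eta psi Sh.
Variable v0 : pi.
Hypothesis v0_iwahori : rep_invariants iwahori v0.

Lemma shalika_blkdiag_iwahori y (k : GL K n) : iwahori k ->
  Sh v0 (blkdiag (y * k)%g 1%g) = Sh v0 (blkdiag y 1%g).
Proof.
by move=> ik; rewrite -blkdiag1M (shalika_iwahori Sh_model v0_iwahori) //; apply: iwahori_blkdiag1.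
Qed.

Let w : GL K n := antidiag.
Let d : GL K n := (pdiag p_pr ^+ b)%g.

(** Moved to the left of diag(x, 1), u^-1 becomes the unipotent element of -x w. As t_p = diag(p^n
    z, z), pulling diag(d, d) out on the left leaves d^-1 x p^(nb) d in the upper block; conjugation
    by d does not affect the trace. *)
Lemma shalika_twisted x :
  Sh v0 (blkdiag x 1 * ((blkunip w)^-1 * pdiag p_pr ^+ b))%g =
  eta (\det d) * psi (- \tr (x * w)%g) *
  Sh v0 (blkdiag (d^-1 * x * scalarGL (det_pX_neq0 p_pr n) ^+ b * d)%g 1%g).
Proof.
set P := (scalarGL _ ^+ b)%g.
have -> : (blkdiag x 1 * ((blkunip w)^-1 * pdiag p_pr ^+ b) =
    blkdiag d d * blkunip (GLval d^-1%g *m - GLval (x * w)%g *m d)%R *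
    blkdiag (d^-1 * x * P * d) 1)%g.
  rewrite -blkunip_blkdiag mulgA blkunipV blkdiag_blkunip mulmxN -!mulgA.
  congr (_ * _)%g; rewrite pdiag_blkdiag blkdiagX expgMn; last exact: scalarGL_central.
  by rewrite !blkdiagM mul1g mulg1 !mulgA mulgV mul1g.
rewrite (shalika_eqv Sh_model) -mulmxA mxtrace_mulC -mulmxA mulmxV ?GLvalP //.
by rewrite mulmx1 raddfN.
Qed.

(* With x = zeta_shift * m * z^-b, the factor psi (- \tr (x * w)) produced by u^-1
   becomes psi (p^-b \tr m). *)
Definition zeta_shift : GL K n :=
  (oppGL * (scalarGL (det_pX_neq0 p_pr b))^-1 * w * d)%g.

(** Of the scalar p^(nb), a factor p^b cancels the p^-b in [zeta_shift], and the remaining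
    p^(b(n-1)) turns d^-1 w into w d by [pdiag_antidiag]. The sign is kept on the right, where it is
    an Iwahori element. *)
Lemma zeta_shift_twist g :
  (d^-1 * (zeta_shift * g * d^-1) * scalarGL (det_pX_neq0 p_pr n) ^+ b * d =
   w * pdiag p_pr ^+ (2 * b) * g * oppGL)%g.
Proof.
rewrite scalar_pX_split //; set q := scalarGL (det_pX_neq0 p_pr b); set q' := scalarGL _.
have qC h : (h * q = q * h)%g by rewrite scalarGL_central.
have q'C h : (h * q' = q' * h)%g by rewrite scalarGL_central.
have oC h : (h * oppGL = oppGL * h)%g by rewrite /oppGL scalarGL_central.
have dw : (d * w * d = q' * w)%g := pdiag_antidiag p_pr b.
rewrite oC mul2n -addnn expgnDr -/d /zeta_shift -/q -!mulgA.
have -> : (d^-1 * (q * (q' * d)) = q * q')%g.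
  by rewrite mulgA (qC d^-1%g) -mulgA (mulgA d^-1%g) (q'C d^-1%g) -(mulgA q') mulVg mulg1.
have -> : (w * (d * (g * (q * q'))) = q * (q' * w * (d * g)))%g.
  by rewrite !mulgA (qC (w * d * g)%g) -!(mulgA q) (q'C (w * d * g)%g) !mulgA.
by rewrite mulKg -dw !mulgA oC -!mulgA mulKg.
Qed.

Lemma zeta_shift_trace g :
  - \tr (zeta_shift * g * d^-1 * w)%g = p%:R ^- b * \tr g.
Proof.
rewrite GLvalM mxtrace_mulC -GLvalM /zeta_shift; set q := scalarGL _.
have qVC h : (h * q^-1 = q^-1 * h)%g.
  by apply: (mulgI q); rewrite !mulgA (scalarGL_central _ h) mulgK mulgV mul1g.
have oC h : (h * oppGL = oppGL * h)%g by rewrite /oppGL scalarGL_central.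
have -> : (w * (oppGL * q^-1 * w * d * g * d^-1) = oppGL * q^-1 * (d * g * d^-1))%g.
  by rewrite !mulgA (oC w) -(mulgA oppGL w) (qVC w) -!mulgA (mulgA w w) antidiagK mul1g.
have -> : GLval (oppGL * q^-1 * (d * g * d^-1))%g = - (p%:R ^- b) *: GLval (d * g * d^-1)%g.
  by rewrite !GLvalM /= invmx_scalar -scalar_mxM mulN1r mul_scalar_mx.
by rewrite mxtraceZ GLvalM mxtrace_mulC -GLvalM mulKg mulNr opprK.
Qed.

(** The power p^-(bn) is the source of p^(bn(s - 1/2)); chi does not see it because chi(p) = 1. *)
Lemma det_zeta_shift g :
  \det (zeta_shift * g * d^-1)%g = p%:R ^- (b * n) * \det (- (w : 'M[K]_n)) * \det g.
Proof.
have d0 := det_neq0 d; have p0 : (p%:R : K) ^+ (b * n) != 0 by apply: det_pX_neq0.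
rewrite !detM !detV /= !det_scalar -scaleN1r detZ -exprM; field.
by rewrite d0 p0.
Qed.

Definition zeta_section (s : R[i]) g : R[i] :=
  Sh v0 (blkdiag (w * pdiag p_pr ^+ (2 * b) * g)%g 1%g) * cpow (pabs (\det g)) (s - 2^-1).

Lemma zeta_integrand_twist s g :
  zeta_integrand (rtrans ((blkunip w)^-1 * pdiag p_pr ^+ b)%g (Sh v0)) chi s
    (zeta_shift * g * d^-1)%g =
  eta (\det d) * chi (\det (- (w : 'M[K]_n))) * cpow p%:R (b%:R * n%:R * (s - 2^-1)) *
  twist psi chi b (zeta_section s) g.
Proof.
rewrite /zeta_integrand /rtrans shalika_twisted zeta_shift_trace zeta_shift_twist.
rewrite det_zeta_shift shalika_blkdiag_iwahori; last exact: iwahori_oppGL.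
have p0 : (p%:R : K) != 0 by apply: padicp_neq0.
have w0 : \det (- (w : 'M[K]_n)) != 0.
  by rewrite -scaleN1r detZ mulf_neq0 ?expf_neq0 ?oppGL_subproof ?det_neq0.
have w1 : pabs (\det (- (w : 'M[K]_n))) = 1.
  by rewrite -scaleN1r detZ pabsM pabsX pabsN pabs1 expr1n mul1r; case: (@antidiag_GLint p R K n).
have chi1 : chi (p%:R ^- (b * n)) = 1.
  have := mcharM chi_char (expf_neq0 (b * n) p0) (invr_neq0 (expf_neq0 (b * n) p0)).
  by rewrite mulfV ?expf_neq0 // (mcharX chi_char) // chi_p expr1n mul1r (proj1 chi_char).
have q0 : 0 < p%:R :> R by rewrite ltr0n prime_gt0.
have g0 : 0 < pabs (\det g) by rewrite lt_def pabs_ge0 pabs_eq0 det_neq0.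
rewrite (mcharM chi_char) ?mulf_neq0 ?invr_neq0 ?expf_neq0 ?det_neq0 //.
rewrite (mcharM chi_char) ?invr_neq0 ?expf_neq0 // chi1 mul1r.
rewrite !pabsM w1 mulr1 pabsV pabsX pabs_p exprVn invrK cpowMl ?exprn_gt0 //.
rewrite cpowXl // natrM /twist /zeta_section.
ring.
Qed.

End zeta_substitution.

Section zeta_convergence.
Context {p : nat} {R : realType} {K : padicFieldType p R} {n : nat}.
Hypothesis p_pr : prime p.
Variables (psi eta chi : K -> R[i]) (b : nat).
Hypothesis psi_std : std_addchar psi.
Hypothesis eta_smooth : smooth_char eta.
Hypothesis chi_char : mchar chi.
Hypothesis chi_fin : finite_order chi.
Hypothesis chi_cond : conductor_exp chi b.
Hypothesis b0 : (0 < b)%N.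
Variable pi : rep (GL K (n + n)) R[i].
Hypothesis pi_ps : unramified_principal_series pi.
Variable Sh : pi -> GL K (n + n) -> R[i].
Hypothesis Sh_model : shalika_model eta psi Sh.
Variable v0 : pi.
Hypothesis v0_iwahori : rep_invariants iwahori v0.
Variable mu : {measure set (borel (GL K n)) -> \bar R}.
Hypothesis mu_haar : haar_measure mu.

Let D : GL K n := (antidiag * pdiag p_pr ^+ (2 * b))%g.
Let Phi s := zeta_section p_pr b Sh v0 s.

Lemma zeta_section_iwahori s (g k : GL K n) : iwahori k -> Phi s (g * k)%g = Phi s g.
Proof.
move=> ik; rewrite /Phi /zeta_section mulgA (shalika_blkdiag_iwahori Sh_model v0_iwahori _ ik).
by case: ik => -[_ kd] _; rewrite detM pabsM kd mulr1.
Qed.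

Lemma zeta_section_int s (g : GL K n) : Phi s g != 0 -> mxle 1 (D * g)%g.
Proof.
move=> h; apply: (shalika_support p_pr psi_std Sh_model v0_iwahori).
  by case: eta_smooth => -[].
by apply: contraNneq h; rewrite /Phi /zeta_section -/D => ->; rewrite mul0r.
Qed.

Lemma zeta_section_support : exists N, forall s (g : GL K n), Phi s g != 0 -> mxle (p%:R ^+ N) g.
Proof.
have [N hN] := GL_bounded p_pr D^-1%g; exists N => s g /zeta_section_int Dg.
have p0 : (p%:R : K) ^+ N != 0 by apply: det_pX_neq0.
have -> : GLval g = p%:R ^- N *: ((p%:R ^+ N *: GLval D^-1%g) *m GLval (D * g)%g).
  by rewrite -scalemxAl scalerA mulVf // scale1r -GLvalM mulKg.
have -> : p%:R ^+ N = pabs (p%:R ^- N : K) * 1.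
  by rewrite pabsV pabsX pabs_p exprVn invrK mulr1.
exact/mxleZ/mxleM1l.
Qed.

(** Translation by D^-1 moves the support into the integral matrices. There the Shalika function is
    O(|det|^-A) and [cintegrable_growth] asks for |det|^(n^2 + 1), so Re s - 1/2 > A + n^2 + 1
    suffices. *)
Lemma cintegrable_zeta_section : exists sigma : R, forall s, sigma < complex.Re s ->
  cintegrable mu setT (twist psi chi b (Phi s)).
Proof.
have [C [A [C0 hC]]] := shalika_growth p_pr psi_std Sh_model v0_iwahori eta_smooth pi_ps.
have [N hN] := zeta_section_support.
exists ((A + (n * n).+1)%:R + 2^-1) => s hs.
have ti : rinvariant (b + N) (twist psi chi b (Phi s)).
  apply: (twist_rinvariant p_pr psi_std chi_char chi_cond b0).
    by move=> g k; apply: zeta_section_iwahori.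
  by move=> g; apply: hN.
have M0 : (0 < b + N)%N by rewrite addn_gt0 b0.
pose h g := twist psi chi b (Phi s) (D^-1 * g)%g.
have hi : rinvariant (b + N) h by move=> g k kM; rewrite /h mulgA ti.
pose r := complex.Re (s - 2^-1 : R[i]).
have hr : (A + (n * n).+1)%:R <= r.
  have -> : r = complex.Re s - 2^-1.
    rewrite /r (_ : 2^-1 = (2^-1)%:C%C :> R[i]); last by rewrite fmorphV rmorph_nat.
    by case: (s).
  by rewrite lerBrDr ltW.
have pos (g : GL K n) : 0 < pabs (\det g) by rewrite lt_def pabs_ge0 pabs_eq0 det_neq0.
(* The constant |det D^-1|^r left by the translation. *)
pose E := expR (r * ln (pabs (\det D^-1%g))).
have ih : cintegrable mu setT h.
  apply: (cintegrable_growth p_pr mu_haar M0 hi (_ : 0 <= C * E)).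
  - by rewrite mulr_ge0 ?expR_ge0.
  - move=> g; rewrite /h /twist mulf_eq0 negb_or => /andP[_ /zeta_section_int].
    by rewrite mulKVg.
  move=> g g1; rewrite /h /twist !normcM (normc_addchar p_pr psi_std).
  rewrite (normc_mchar chi_fin) ?det_neq0 // mulr1 mul1r /Phi /zeta_section -/D mulKVg.
  set x := pabs (\det g).
  have x0 : 0 < x := pos g.
  have lnx : ln x <= 0 by rewrite ln_le0 // pabs_det_le1.
  have e : expR (r * ln x) <= x ^+ A * x ^+ (n * n).+1.
    rewrite -exprD -{2}[x]lnK ?posrE // -expRM_natl ler_expR.
    by rewrite ler_wnM2r.
  rewrite normc_cpow -/r detM pabsM lnM ?posrE // mulrDr expRD -/E.
  have -> : C * E * x ^+ (n * n).+1 = C / x ^+ A * (E * (x ^+ A * x ^+ (n * n).+1)).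
    have : x ^+ A != 0 by rewrite expf_neq0 ?gt_eqF.
    by move: (x ^+ A) (x ^+ _) => a c a0; field.
  by rewrite ler_pM ?normc_ge0 ?mulr_ge0 ?expR_ge0 // ?hC // ler_wpM2l ?expR_ge0.
have [GLint1 _ _] := @GLint_subgroup p R K n.
have [m1 m2] := haar_translate p_pr mu_haar D (right_stable_GLint p_pr mu_haar GLint1).
have := cintegrable_comp m1 m2 (rinvariant_cmeasurable p_pr M0 hi) ih.
by rewrite /h; under eq_fun do rewrite mulg1 mulKg.
Qed.

End zeta_convergence.

Section zeta_evaluation.
Context {p : nat} {R : realType} {K : padicFieldType p R} {n : nat}.
Hypothesis p_pr : prime p.
Hypothesis n_gt0 : (0 < n)%N.
Variables (psi eta chi : K -> R[i]) (b : nat).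
Hypothesis psi_std : std_addchar psi.
Hypothesis eta_smooth : smooth_char eta.
Hypothesis chi_char : mchar chi.
Hypothesis chi_fin : finite_order chi.
Hypothesis chi_cond : conductor_exp chi b.
Hypothesis b0 : (0 < b)%N.
Hypothesis chi_p : chi p%:R = 1.
Variable pi : rep (GL K (n + n)) R[i].
Hypothesis pi_ps : unramified_principal_series pi.
Variable Sh : pi -> GL K (n + n) -> R[i].
Hypothesis Sh_model : shalika_model eta psi Sh.
Variable v0 : pi.
Hypothesis v0_iwahori : rep_invariants iwahori v0.
Variable mu : {measure set (borel (GL K n)) -> \bar R}.
Hypothesis mu_haar : haar_measure mu.
Variable dc : {measure set (borel (GL K 1)) -> \bar R}.
Hypothesis dc_haar : haar_measure dc.
Hypothesis dc_mass : dc GLint = 1%E.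

Let w : GL K n := antidiag.
Let d : GL K n := (pdiag p_pr ^+ b)%g.
Let Phi s := zeta_section p_pr b Sh v0 s.

(** From d w d = q w with q scalar, w d^-1 w^-1 = q^-1 d: the element d^-1 is conjugate to a central
    multiple of its inverse. *)
Lemma right_stable_pdiagV : right_stable mu d^-1%g.
Proof.
have wint : GLint w by apply: antidiag_GLint.
have [_ _ GLintV] := @GLint_subgroup p R K n.
have dw := pdiag_antidiag (K := K) (n := n) p_pr b; rewrite -/d -/w in dw.
set q := scalarGL _ in dw.
have qVC h : (h * q^-1 = q^-1 * h)%g.
  by apply: (mulgI q); rewrite !mulgA (scalarGL_central _ h) mulgK mulgV mul1g.
apply: (right_stable_flip p_pr mu_haar (w := w) (z := q^-1%g)).
- exact: right_stable_GLint.
- exact/right_stable_GLint/GLintV.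
- by apply: right_stable_central.
have -> : q = (d * w * d * w^-1)%g by rewrite dw mulgK.
by rewrite !invMg !invgK !mulgA mulgVK.
Qed.

Lemma zeta_integral s : cintegrable mu setT (twist psi chi b (Phi s)) ->
  let H := zeta_integrand (rtrans ((blkunip w)^-1 * pdiag p_pr ^+ b)%g (Sh v0)) chi s in
  cintegrable mu setT H /\ cintegral mu setT H =
    eta (\det d) * chi (\det (- (w : 'M[K]_n))) * cpow p%:R (b%:R * n%:R * (s - 2^-1)) *
    cintegral mu setT (twist psi chi b (Phi s)).
Proof.
move=> iT H; set c := eta _ * _ * _; set T := twist _ _ _ _ in iT *.
have [N hN] := zeta_section_support p_pr b psi_std eta_smooth Sh_model v0_iwahori.
have Ti : rinvariant (b + N) T.
  apply: (twist_rinvariant p_pr psi_std chi_char chi_cond b0).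
    exact: (zeta_section_iwahori p_pr b Sh_model v0_iwahori).
  by move=> g; apply: hN.
pose a : GL K n := zeta_shift p_pr b.
have HE g : H (a * g * d^-1)%g = c * T g by apply: zeta_integrand_twist.
(* Expressing H through T conjugates by d, so H is invariant only at a new level M; this is what
   makes it measurable. *)
have [M M0 hM] := pcong_conj_exists p_pr (b + N) d.
have Hi : rinvariant M H.
  have HT x : H x = c * T (a^-1 * x * d)%g by rewrite -HE !mulgA mulgV mul1g mulgK.
  move=> x k kM; rewrite !HT; congr (_ * _).
  by rewrite -(Ti (a^-1 * x * d)%g _ (hM k kM)) -!mulgA mulKVg.
have iH : cintegrable mu setT (fun g => H (a * g * d^-1)%g).
  by under eq_fun do rewrite HE; apply: cintegrableZ.
have [iH' <-] := cintegral_translate p_pr mu_haar right_stable_pdiagV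
  (rinvariant_cmeasurable p_pr M0 Hi) iH.
by split=> //; under eq_fun do rewrite HE; rewrite cintegralZ.
Qed.

Lemma fine_iwahori : (fine (mu (@iwahori p R K n)))%:C%C =
  p%:R ^+ (b.-1 * ((n ^ 2 - n) %/ 2)) * (fine (mu (iwahori_level b)))%:C%C :> R[i].
Proof.
rewrite (iwahori_level_measure p_pr mu_haar b0) natrX.
rewrite fineM //; last by rewrite ge0_fin_numE ?measure_ge0 ?iwahori_level_fin.
by rewrite /= rmorphM rmorphXn rmorph_nat.
Qed.

Lemma pred_p_inv_neq0 : 1 - p%:R^-1 != 0 :> R[i].
Proof. by rewrite subr_eq0 eq_sym invr_eq1 pnatr_eq1 gtn_eqF // prime_gt1. Qed.

(** The averaged integral and the n-th power of the averaged Gauss sum carry the same nonzero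
    factor, the n-th power of the number of units mod p^M; cancelling it removes the level. *)
Lemma cintegral_twist_gauss s : cintegrable mu setT (twist psi chi b (Phi s)) ->
  cintegral mu setT (twist psi chi b (Phi s)) =
  Sh v0 (blkdiag (w * pdiag p_pr ^+ (2 * b))%g 1%g) *
  (fine (mu (iwahori_level b)))%:C%C * gauss_sum psi dc chi b ^+ n *
  (p%:R ^+ b * (1 - p%:R^-1)) ^- n.
Proof.
move=> iT.
have [N hN] := zeta_section_support p_pr b psi_std eta_smooth Sh_model v0_iwahori.
have := cintegral_twist p_pr psi_std chi_char chi_cond b0 mu_haar
  (zeta_section_iwahori p_pr b Sh_model v0_iwahori s) (hN s) (leqnn _) iT.
have := gauss_sum_unit_sum p_pr psi_std chi_char chi_fin chi_cond b0 dc_haar dc_mass (leq_addr N b).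
have M0 : (0 < b + N)%N by rewrite addn_gt0 b0.
have := expf_neq0 n (unit_sum1_neq0 (K := K) p_pr M0).
set u1 := unit_sum _ _; set g := unit_sum _ _; set tau := gauss_sum _ _ _ _.
set c := p%:R ^+ b * _; move=> u10 e.
have c0 : c != 0.
  by rewrite mulf_neq0 ?pred_p_inv_neq0 // expf_neq0 // pnatr_eq0 -lt0n prime_gt0.
rewrite {2}/zeta_section mulg1 det1 pabs1 cpow1 mulr1 -/w => eT.
apply: (mulIf u10); rewrite eT.
have -> : g = tau * u1 / c by rewrite e mulrAC mulfV // mul1r.
by clearbody c tau; rewrite !exprMn exprVn -!mulrA; do 3!congr (_ * _); apply: mulrC.
Qed.

(** With E = (n^2 - n)/2, the index p^((b-1)E) and the factor p^E of Upsilon' make p^(bE). Since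
    (n^2 + n)/2 = E + n, what remains is p^(-bn), from the normalisation of the n Gauss sums. *)
Lemma Upsilon_iwahori_level : Upsilon' mu * p%:R ^- (b * ((n ^ 2 + n) %/ 2)) =
  (fine (mu (iwahori_level b)))%:C%C * (p%:R ^+ b * (1 - p%:R^-1)) ^- n.
Proof.
have p0 : (p%:R : R[i]) != 0 by rewrite pnatr_eq0 -lt0n prime_gt0.
have x0 := pred_p_inv_neq0.
rewrite /Upsilon' fine_iwahori; set E := ((n ^ 2 - n) %/ 2)%N.
have -> : ((n ^ 2 + n) %/ 2 = E + n)%N.
  have -> : (n ^ 2 + n = n * 2 + (n ^ 2 - n))%N by nia.
  by rewrite divnMDl // addnC.
have e : p%:R ^+ (b.-1 * E) * p%:R ^+ E * p%:R ^- (b * (E + n)) = (p%:R ^+ b) ^- n :> R[i].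
  rewrite -exprD -exprM addnC -mulSn prednK // mulnDr exprD invfM mulrA.
  by rewrite mulfV ?mul1r ?expf_neq0.
rewrite exprMn invfM -e; ring.
Qed.

End zeta_evaluation.

Theorem proposition5p2 (R : realType) (p : nat) (p_pr : prime p)
  (K : padicFieldType p R) (n : nat) (n_gt0 : (0 < n)%N)
  (psi : K -> R[i]) (psi_std : std_addchar psi)
  (eta : K -> R[i]) (eta_smooth : smooth_char eta)
  (pi : rep (GL K (n + n)) R[i])
  (pi_ps : unramified_principal_series pi) (pi_gen : generic psi pi)
  (Sh : pi -> GL K (n + n) -> R[i]) (Sh_model : shalika_model eta psi Sh)
  (dx : {measure set (borel (GL K n)) -> \bar R}) (dx_haar : haar_measure dx)
  (dc : {measure set (borel (GL K 1)) -> \bar R}) (dc_haar : haar_measure dc)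
  (dc_mass : dc GLint = 1%E)
  (chi : K -> R[i]) (chi_char : mchar chi) (chi_fin : finite_order chi)
  (beta : nat) (chi_cond : conductor_exp chi beta) (beta_gt0 : (0 < beta)%N)
  (chi_p : chi p%:R = 1)
  (W : GL K (n + n) -> R[i]) (W_Iw : (Sh @` rep_invariants iwahori) W) :
  let w : GL K n := antidiag in
  let u : GL K (n + n) := blkunip w in
  let t : GL K (n + n) := pdiag p_pr in
  let z : GL K n := pdiag p_pr in
  is_zeta dx (rtrans (u^-1 * t ^+ beta)%g W) chi (fun s =>
    Upsilon' dx
    * eta (\det (z ^+ beta)%g)
    * p%:R ^- (beta * ((n ^ 2 + n) %/ 2))
    * cpow p%:R (beta%:R * n%:R * (s - 2^-1))
    * gauss_sum psi dc chi beta ^+ n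
    * chi (\det (- (w : 'M[K]_n)))
    * W (blkdiag (w * z ^+ (2 * beta))%g 1%g)).
Proof.
move=> w u t z; case: W_Iw => v0 v0_iwahori <-; split.
  (* As a function of s the formula is a constant times a complex power of p, hence entire. *)
  set x := eta _; set g := gauss_sum _ _ _ _; set y := chi _; set f := Sh _ _.
  rewrite (_ : (fun s => _) = fun s =>
    (Upsilon' dx * x * p%:R ^- (beta * ((n ^ 2 + n) %/ 2)) * g ^+ n * y * f) *
    cpow p%:R ((beta * n)%:R%:C%C * (s - 2^-1))); first exact: meromorphic_cpow.
  by apply/funext => s; rewrite rmorph_nat natrM; ring.
have [sigma hsigma] := cintegrable_zeta_section p_pr psi_std eta_smooth chi_char chi_fin
  chi_cond beta_gt0 pi_ps Sh_model v0_iwahori dx_haar.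
exists sigma => s /hsigma iT.
have [iH ->] := zeta_integral n_gt0 psi_std eta_smooth chi_char chi_cond beta_gt0 chi_p
  Sh_model v0_iwahori dx_haar iT.
split=> //; rewrite (cintegral_twist_gauss psi_std eta_smooth chi_char chi_fin chi_cond
  beta_gt0 Sh_model v0_iwahori dx_haar dc_haar dc_mass iT).
set x := eta _; set g := gauss_sum _ _ _ _; set y := chi _; set f := Sh _ _; set c := cpow _ _.
transitivity ((Upsilon' dx * p%:R ^- (beta * ((n ^ 2 + n) %/ 2))) * x * c * g ^+ n * y * f).
  by ring.
by rewrite (Upsilon_iwahori_level p_pr n_gt0 beta_gt0 dx_haar); ring.
Qed.
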